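(* Consider the Wishart prior $\Pi=\mathcal{W}_p(I,p+b-1)$ on $\Omega$ with integer $b=O(1)$. Let $v\in\mathbb{R}^p$ be nonzero. Assume $\|\Sigma^*\|\vee\|\Omega^*\|=O(1)$ and $p/n=o(1)$. Then $$P_{\Sigma^*}^n\sup_{t\in\mathbb{R}}\left|\Pi\left(\frac{\sqrt n(v^T\Sigma v-v^T\hat\Sigma v)}{\sqrt2\,|v^T\Sigma^*v|}\le t\,\Big|\,X^n\right)-\mathbb{P}(Z\le t)\right|\to0.$$ If additionally $p^2/n=o(1)$, then $$P_{\Sigma^*}^n\sup_{t\in\mathbb{R}}\left|\Pi\left(\frac{\sqrt n(v^T\Omega v-v^T\hat\Sigma^{-1}v)}{\sqrt2\,|v^T\Omega^*v|}\le t\,\Big|\,X^n\right)-\mathbb{P}(Z\le t)\right|\to0.$$ Here $Z\sim N(0,1)$.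
   Context: $X^n=(X_1,\dots,X_n)$ are i.i.d. $N(0,\Sigma^* )$ in $\mathbb{R}^p$, $\Omega^*=(\Sigma^* )^{-1}$, $\hat\Sigma=\frac1n\sum_{i=1}^nX_iX_i^T$. For a precision matrix $\Omega$, write $\Sigma=\Omega^{-1}$. The Wishart prior $\mathcal{W}_p(I,p+b-1)$ has density on symmetric positive semi-definite matrices (with respect to Lebesgue measure) $$\frac{d\Pi(\Omega)}{d\Omega}\propto\exp\Big(\frac{b-2}{2}\log\det(\Omega)-\frac12\mathrm{tr}(\Omega)\Big)$$ (well defined for integers $b\ge1$). The posterior is $\Pi(B|X^n)=\int_B e^{l_n(\Omega)}d\Pi(\Omega)/\int e^{l_n(\Omega)}d\Pi(\Omega)$ with $l_n(\Omega)=\frac n2\log\det(\Omega)-\frac n2\mathrm{tr}(\Omega\hat\Sigma)$. Asymptotics are as $n,p\to\infty$ jointly ($v$ may depend on $n$); $P_{\Sigma^*}^n$ applied to a random variable denotes expectation under the sampling distribution. $\|\cdot\|$ is the spectral norm, $a\vee b=\max(a,b)$. *)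

(* Defs.v *)
From HB Require Import structures.
From mathcomp Require Import all_boot all_order all_algebra.
From mathcomp Require Import all_classical all_reals all_analysis.
From mathcomp Require Import measurable_realfun.

Set Implicit Arguments.
Unset Strict Implicit.
Unset Printing Implicit Defensive.

Import Order.TTheory GRing.Theory Num.Theory.
Import numFieldNormedType.Exports.

Local Open Scope classical_set_scope.
Local Open Scope ring_scope.

Definition mx_display : measure_display -> measure_display.
Proof. exact. Qed.

(* Matrices carry the product sigma-algebra, generated by the entries.
   For a real matrix this is the Borel sigma-algebra. *)
Definition mx_cylinder d (T : measurableType d) m n : set_system 'M[T]_(m, n) :=
  [set A | exists i j, exists2 B : set T, measurable B &
    A = [set M : 'M[T]_(m, n) | B (M i j)]].

Section measurable_matrix.
Context d (T : measurableType d) (m n : nat).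

Let mx_set0 : <<s @mx_cylinder d T m n >> set0.
Proof. exact: sigma_algebra0. Qed.

Let mx_setC A : <<s @mx_cylinder d T m n >> A ->
  <<s @mx_cylinder d T m n >> (~` A).
Proof. exact: sigma_algebraC. Qed.

Let mx_bigcup (F : (set 'M[T]_(m, n))^nat) :
  (forall i, <<s @mx_cylinder d T m n >> (F i)) ->
  <<s @mx_cylinder d T m n >> (\bigcup_i (F i)).
Proof. exact: sigma_algebra_bigcup. Qed.

HB.instance Definition _ := @isMeasurable.Build (mx_display d)
  'M[T]_(m, n) <<s @mx_cylinder d T m n >> mx_set0 mx_setC mx_bigcup.

End measurable_matrix.

Lemma measurable_entry d (T : measurableType d) m n (i : 'I_m) (j : 'I_n) :
  measurable_fun [set: 'M[T]_(m, n)] (fun M : 'M[T]_(m, n) => M i j).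
Proof.
move=> _ Y mY; rewrite setTI; apply: sub_sigma_algebra.
by exists i, j, Y.
Qed.

Lemma measurable_fun_mx d d' (S : measurableType d) (T : measurableType d')
    m n (f : S -> 'M[T]_(m, n)) :
  (forall i j, measurable_fun [set: S] (fun x => f x i j)) ->
  measurable_fun [set: S] f.
Proof.
move=> mf; apply: (@measurability _ _ _ _ _ _ (@mx_cylinder _ T m n)) => //.
move=> _ [_ [i [j [B mB ->]]] <-].
have := mf i j measurableT _ mB.
by rewrite !setTI.
Qed.

Section product_cons.
Context d (T : measurableType d) (R : realType).
Variable m : {sigma_finite_measure set T -> \bar R}.

Section step.
Variables (n : nat) (mu : {sigma_finite_measure set (n.-tuple T) -> \bar R}).

Let cons_pair (x : T * n.-tuple T) : n.+1.-tuple T := [tuple of x.1 :: x.2].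

Let measurable_cons_pair : measurable_fun [set: T * n.-tuple T] cons_pair.
Proof. exact: measurable_cons. Qed.

Definition product_cons : set (n.+1.-tuple T) -> \bar R :=
  pushforward (m \x mu)%E cons_pair.

Let product_cons0 : product_cons set0 = 0%E.
Proof. by rewrite /product_cons /pushforward preimage_set0 measure0. Qed.

Let product_cons_ge0 A : (0 <= product_cons A)%E.
Proof. by rewrite /product_cons /pushforward measure_ge0. Qed.

Let product_cons_sigma_additive : semi_sigma_additive product_cons.
Proof.
move=> F mF tF mUF; rewrite /product_cons /pushforward preimage_bigcup.
have mpre A : measurable A -> measurable (cons_pair @^-1` A).
  by move=> mA; rewrite -[X in measurable X]setTI; exact: measurable_cons_pair.
apply: measure_semi_sigma_additive.
- by move=> i; exact: mpre.
- apply/trivIsetP => /= i j _ _ ij; rewrite -preimage_setI.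
  by move/trivIsetP : tF => /(_ _ _ _ _ ij) ->//; rewrite preimage_set0.
- by rewrite -preimage_bigcup; exact: mpre.
Qed.

HB.instance Definition _ := isMeasure.Build _ _ _ product_cons
  product_cons0 product_cons_ge0 product_cons_sigma_additive.

Let product_cons_sigma_finite : sigma_finite [set: n.+1.-tuple T] product_cons.
Proof.
have /sigma_finiteP[F [TF ndF Foo]] := sigma_finiteT m.
have /sigma_finiteP[G [TG ndG Goo]] := sigma_finiteT mu.
pose uncons (t : n.+1.-tuple T) : T * n.-tuple T :=
  (thead t, [tuple of behead t]).
have consK : cancel cons_pair uncons.
  move=> [x t]; rewrite /uncons /cons_pair /= theadE; congr pair.
  exact/val_inj.
exists (fun k => uncons @^-1` (F k `*` G k)).
  rewrite -preimage_bigcup -[LHS](preimage_setT uncons); congr (_ @^-1` _).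
  rewrite -setXTT TF TG predeqE => -[x y]; split.
    move=> [/= [i _ Fix] [k _ Gky]]; exists (maxn i k) => //; split.
    - by move: x Fix; exact/subsetPset/ndF/leq_maxl.
    - by move: y Gky; exact/subsetPset/ndG/leq_maxr.
  by move=> [k _ []/= ? ?]; split; exists k.
move=> k; have [mFk Fk] := Foo k; have [mGk Gk] := Goo k; split.
  rewrite -[X in measurable X]setTI.
  apply: (measurable_fun_pair _ _) => //.
  - exact: measurable_tnth.
  - exact: measurable_behead.
  - exact: measurableX.
rewrite /product_cons /pushforward -comp_preimage.
rewrite (_ : uncons \o cons_pair = id); last first.
  by apply/funext => x; exact: consK.
by rewrite product_measure1E// lte_mul_pinfty// ge0_fin_numE.
Qed.

HB.instance Definition _ := @Measure_isSigmaFinite.Build _ _ _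
  product_cons product_cons_sigma_finite.

End step.

(* The n-fold product measure m \x ... \x m. *)
Fixpoint product_tuple n : {sigma_finite_measure set (n.-tuple T) -> \bar R} :=
  match n with
  | 0 => \d_ ([tuple] : 0.-tuple T)
  | k.+1 => product_cons (product_tuple k)
  end.

End product_cons.

Section symmetric_matrices.
Context {R : realType}.

Definition quad_form p (A : 'M[R]_p) (x : 'cV[R]_p) : R :=
  (x^T *m A *m x) ord0 ord0.

Definition psd_mx (p : nat) : set 'M[R]_p :=
  [set A | A^T = A /\ forall x : 'cV[R]_p, 0 <= quad_form A x].

Definition pd_mx (p : nat) : set 'M[R]_p :=
  [set A | A^T = A /\ forall x : 'cV[R]_p, x != 0 -> 0 < quad_form A x].

Definition l2_norm p (x : 'cV[R]_p) : R := Num.sqrt (\sum_i x i ord0 ^+ 2).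

Definition spectral_norm p (A : 'M[R]_p) : R :=
  sup [set l2_norm (A *m x) | x in [set x : 'cV[R]_p | l2_norm x <= 1]].

Lemma quad_formE p (A : 'M[R]_p) x :
  quad_form A x = \sum_j (\sum_i x i ord0 * A i j) * x j ord0.
Proof.
rewrite /quad_form mxE; apply: eq_bigr => j _; congr (_ * _).
by rewrite mxE; apply: eq_bigr => i _; rewrite mxE.
Qed.

Lemma measurable_quad_form p (x : 'cV[R]_p) :
  measurable_fun [set: 'M[R]_p] (fun A => quad_form A x).
Proof.
under eq_fun do rewrite quad_formE.
apply: measurable_sum => j; apply: measurable_funM => //.
apply: measurable_sum => i; apply: measurable_funM => //.
exact: measurable_entry.
Qed.

Lemma measurable_det p : measurable_fun [set: 'M[R]_p] (fun A => \det A).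
Proof.
apply: measurable_sum => s; apply: measurable_funM => //.
apply: measurable_prod => i _; exact: measurable_entry.
Qed.

Lemma measurable_tr p : measurable_fun [set: 'M[R]_p] (fun A => \tr A).
Proof. by apply: measurable_sum => i; exact: measurable_entry. Qed.

Lemma continuous_quad_form p (A : 'M[R]_p) : continuous (quad_form A).
Proof.
rewrite (_ : quad_form A =
  fun x => \sum_j (\sum_i x i ord0 * A i j) * x j ord0); last first.
  by apply/funext => x; rewrite quad_formE.
have cA j : continuous (fun x : 'cV[R]_p => \sum_i x i ord0 * A i j).
  apply: continuous_big => [|i _ x]; first exact: add_continuous.
  exact: (cvgM (@coord_continuous R p 1 i ord0 x) (cvg_cst (A i j))).
apply: continuous_big => [|j _ x]; first exact: add_continuous.
exact: (cvgM (cA j x) (@coord_continuous R p 1 j ord0 x)).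
Qed.

Lemma quad_form_ge0_rat p (A : 'M[R]_p) :
  (forall q : 'cV[rat]_p, 0 <= quad_form A (map_mx ratr q)) ->
  forall x, 0 <= quad_form A x.
Proof.
move=> Aq x; rewrite leNgt; apply/negP => Ax0.
have : \forall y \near x, quad_form A y < 0.
  exact: (@continuous_quad_form p A x _ (lt_nbhsl Ax0)).
move=> /nbhs_ballP[e /= e0 xe].
have /choice[q qP] : forall i, exists q : rat, `|x i ord0 - ratr q| < e.
  move=> i; have /rat_in_itvoo[q] : x i ord0 - e < x i ord0 + e.
    by rewrite ltrBlDr -addrA ltrDl addr_gt0.
  rewrite in_itv /= -ltr_distlC => qe; exists q; exact: qe.
have := xe (map_mx ratr (\col_i q i)); rewrite ltNge Aq => /(_ _)/negP.
apply => //; split => // i j; rewrite !ord1 !mxE; exact: qP.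
Qed.

Lemma measurable_psd_mx p : measurable (@psd_mx p : set 'M[R]_p).
Proof.
have mle (f : 'M[R]_p -> R) : measurable_fun setT f ->
    measurable [set A | 0 <= f A].
  move=> mf; rewrite (_ : [set A | _] = f @^-1` `[0, +oo[%classic).
    by rewrite -[X in measurable X]setTI; exact: mf.
  by apply/seteqP; split => A /=; rewrite in_itv/= andbT.
pose S (k : nat) := if unpickle k is Some q then
  [set A : 'M[R]_p | 0 <= quad_form A (map_mx ratr (q : 'cV[rat]_p))] else setT.
pose D (ij : 'I_p * 'I_p) :=
  [set A : 'M[R]_p | 0 <= A ij.2 ij.1 - A ij.1 ij.2].
rewrite (_ : @psd_mx p = \big[setI/setT]_ij D ij `&` \bigcap_k S k).
  apply: measurableI.
    apply: bigsetI_measurable => -[i j] _.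
    by apply: mle; apply: measurable_funB; exact: measurable_entry.
  apply: bigcap_measurableType => k _; rewrite /S.
  by case: unpickle => // q; apply: mle; exact: measurable_quad_form.
apply/seteqP; split => A /=.
  move=> [AT A0]; split; last by move=> k _; rewrite /S; case: unpickle => /=.
  elim/big_ind : _ => // -[i j] _ /=.
  by rewrite /D/= -[in A j i]AT mxE subrr.
move=> [DA SA]; split.
  have leA i j : A i j <= A j i.
    move: DA; rewrite (bigD1 (i, j))//= => -[+ _].
    by rewrite /D/= subr_ge0.
  by apply/matrixP => i j; rewrite mxE; apply/le_anti; rewrite !leA.
apply: quad_form_ge0_rat => q.
by have := SA (pickle q) I; rewrite /S pickleK.
Qed.

End symmetric_matrices.
Arguments psd_mx {R} p _.
Arguments pd_mx {R} p _.

Section lebesgue_sym.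
Context {R : realType} (p : nat).

Definition upper_entries : seq ('I_p * 'I_p) :=
  [seq ij : 'I_p * 'I_p <- enum {: 'I_p * 'I_p} | (ij.1 <= ij.2)%N].

Definition sym_of_upper (x : (size upper_entries).-tuple R) : 'M[R]_p :=
  \matrix_(i, j)
    nth 0 x (index (if (i <= j)%N then (i, j) else (j, i)) upper_entries).

Lemma sym_of_upper_sym x : (sym_of_upper x)^T = sym_of_upper x.
Proof.
apply/matrixP => i j; rewrite !mxE.
case: ltngtP => // ij; congr nth; congr index.
by congr pair; exact/val_inj.
Qed.

Lemma measurable_sym_of_upper : measurable_fun
  [set: (size upper_entries).-tuple (measurableTypeR R)]
  (sym_of_upper : (size upper_entries).-tuple (measurableTypeR R) -> 'M[R]_p).
Proof.
apply: measurable_fun_mx => i j.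
set k := index (if (i <= j)%N then (i, j) else (j, i)) upper_entries.
have kN : (k < size upper_entries)%N.
  rewrite index_mem mem_filter mem_enum andbT.
  by case: ifPn => //=; rewrite -ltnNge => /ltnW.
rewrite (_ : (fun x => _) =
    (fun x : _.-tuple _ => tnth x (Ordinal kN)) :> (_ -> R)); last first.
  by apply/funext => x; rewrite mxE (tnth_nth 0).
exact: (@measurable_tnth _ (measurableTypeR R)).
Qed.

(* Lebesgue measure on symmetric matrices: the entries on and above the
   diagonal are the p(p+1)/2 coordinates. *)
Definition lebesgue_sym : set 'M[R]_p -> \bar R :=
  pushforward (product_tuple lebesgue_measure (size upper_entries))
    sym_of_upper.

Let lebesgue_sym0 : lebesgue_sym set0 = 0%E.
Proof. by rewrite /lebesgue_sym /pushforward preimage_set0 measure0. Qed.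

Let lebesgue_sym_ge0 A : (0 <= lebesgue_sym A)%E.
Proof. by rewrite /lebesgue_sym /pushforward measure_ge0. Qed.

Let lebesgue_sym_sigma_additive : semi_sigma_additive lebesgue_sym.
Proof.
move=> F mF tF mUF; rewrite /lebesgue_sym /pushforward preimage_bigcup.
have mpre A : measurable A -> measurable
    (sym_of_upper @^-1` A : set (_.-tuple (measurableTypeR R))).
  move=> mA; rewrite -[X in measurable X]setTI.
  exact: measurable_sym_of_upper.
apply: measure_semi_sigma_additive.
- by move=> i; exact: mpre.
- apply/trivIsetP => /= i j _ _ ij; rewrite -preimage_setI.
  by move/trivIsetP : tF => /(_ _ _ _ _ ij) ->//; rewrite preimage_set0.
- by rewrite -preimage_bigcup; exact: mpre.
Qed.

HB.instance Definition _ := isMeasure.Build _ _ _ lebesgue_sym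
  lebesgue_sym0 lebesgue_sym_ge0 lebesgue_sym_sigma_additive.

End lebesgue_sym.
Arguments lebesgue_sym {R} p _.

Section wishart.
Context {R : realType} (p b : nat).

(* Unnormalized density of W_p(I, p + b - 1).  On the boundary of the cone,
   which is Lebesgue-null, ln 0 = 0 is a junk value. *)
Definition wishart_density (Om : 'M[R]_p) : R :=
  expR ((b%:R - 2) / 2 * ln (\det Om) - 2^-1 * \tr Om).

Lemma measurable_wishart_density :
  measurable_fun [set: 'M[R]_p] wishart_density.
Proof.
apply: measurableT_comp => //; apply: measurable_funB.
  apply: measurable_funM => //.
  by apply: measurableT_comp => //; exact: measurable_det.
by apply: measurable_funM => //; exact: measurable_tr.
Qed.

Definition wishart_weight (B : set 'M[R]_p) : \bar R :=
  \int[lebesgue_sym p]_(Om in B `&` psd_mx p) (wishart_density Om)%:E.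

Let wishart_weight0 : wishart_weight set0 = 0%E.
Proof. by rewrite /wishart_weight set0I integral_set0. Qed.

Let wishart_weight_ge0 B : (0 <= wishart_weight B)%E.
Proof. by apply: integral_ge0 => Om _; rewrite lee_fin expR_ge0. Qed.

Let wishart_weight_sigma_additive : semi_sigma_additive wishart_weight.
Proof.
move=> F mF tF mUF; rewrite /wishart_weight setI_bigcupl.
have mpsd := @measurable_psd_mx R p.
rewrite ge0_integral_bigcup//; last 4 first.
- by move=> k; exact: measurableI.
- apply/measurable_EFinP; apply: measurable_funTS.
  exact: measurable_wishart_density.
- by move=> Om _; rewrite lee_fin expR_ge0.
- exact: trivIset_setIr.
by apply: is_cvg_ereal_nneg_natsum_cond => k _ _; exact: wishart_weight_ge0.
Qed.

HB.instance Definition _ := isMeasure.Build _ _ _ wishart_weight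
  wishart_weight0 wishart_weight_ge0 wishart_weight_sigma_additive.

(* The prior W_p(I, p + b - 1).  The total weight is positive and finite for
   b >= 1, so that the default argument of mnormalize is irrelevant. *)
Definition wishart_prior : probability 'M[R]_p R :=
  mnormalize wishart_weight (\d_ (0 : 'M[R]_p)).

End wishart.
Arguments wishart_weight {R} p b _.
Arguments wishart_prior {R} p b.

Section model.
Context {R : realType}.

Definition log_likelihood p n (S Om : 'M[R]_p) : R :=
  n%:R / 2 * ln (\det Om) - n%:R / 2 * \tr (Om *m S).

(* [S] is the sample covariance matrix of n observations. *)
Definition posterior p (Pi : probability 'M[R]_p R) n (S : 'M[R]_p)
    (B : set 'M[R]_p) : R :=
  fine (\int[Pi]_(Om in B) (expR (log_likelihood n S Om))%:E) /
  fine (\int[Pi]_Om (expR (log_likelihood n S Om))%:E).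

Definition sample_covariance p n (x : 'I_n -> 'cV[R]_p) : 'M[R]_p :=
  n%:R^-1 *: \sum_i x i *m (x i)^T.

(* normal_prob is parametrized by the standard deviation and is not a point
   mass when the latter is 0. *)
Definition centered_normal (s2 : R) (A : set R) : \bar R :=
  if s2 == 0 then \d_ (0 : R) A else normal_prob 0 (Num.sqrt s2) A.

Definition std_normal_cdf (t : R) : R := fine (normal_prob 0 1 `]-oo, t]).

Definition gaussian_vector d (T : measurableType d) (P : probability T R) p
    (X : {RV P >-> 'cV[R]_p}) (Sigma : 'M[R]_p) :=
  forall (u : 'cV[R]_p) (A : set R), measurable A ->
    P [set w | A ((u^T *m X w) ord0 ord0)] =
    centered_normal (quad_form Sigma u) A.

Definition independent_vectors d (T : measurableType d) (P : probability T R)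
    p n (X : 'I_n -> {RV P >-> 'cV[R]_p}) :=
  forall A : 'I_n -> set 'cV[R]_p, (forall i, measurable (A i)) ->
    P (\bigcap_i (X i @^-1` A i)) = (\prod_i P (X i @^-1` A i))%E.

End model.

(* Main.v *)
Require Import Defs.
From HB Require Import structures.
From mathcomp Require Import all_boot all_order all_algebra.
From mathcomp Require Import all_classical all_reals all_analysis.
From mathcomp Require Import measurable_realfun perm.
From mathcomp Require Import ring lra zify.

(** Write S for the sample covariance.  The posterior is again a Wishart-type
    law: by conjugacy its density on the positive definite cone is
    proportional to det(Om)^al exp(- tr(Om A) / 2) with al = (n + b - 2) / 2
    and A = I + n S (lemma [posteriorE]).  Both linear functionals in the
    statement have an exact one-dimensional law under such a density.

    - y = 1 / (v' Om^-1 v) has density proportional to s^al exp(- c s) with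
      c = v' A v / 2 (lemma [pivot_law]).  Moving Om along Om + u v v'
      preserves Lebesgue measure and replaces y by y + u, det(Om) by
      det(Om) (y + u) / y and tr(Om A) by tr(Om A) + 2 c u.  So, relative to
      the density s^al exp(- c s), the law of y is translation invariant on
      the half-line, hence a multiple of Lebesgue measure.
    - q = v' Om v has density proportional to s^al' exp(- c s) with
      al' = al + (p + 1) / 2 - 1 and 1 / c = 2 v' A^-1 v (lemma [quad_law]).
      The congruences that multiply v by sqrt s and fix the A^-1-orthogonal
      complement of v scale q by s, scale det by s, and have Jacobian
      s^((p + 1) / 2) on symmetric matrices; uniqueness of the Haar measure
      of the multiplicative group gives the law.

    A gamma density with large exponent, centred at its mode and scaled by the
    curvature there, is close to the normal one in total variation,
    uniformly in the rate (lemma [gamma_ratio_normal]).  It remains to see that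
    the events of the statement are half-lines for this standardized variable
    with end points close to - t, respectively t: for the first functional
    this needs v' S v / v' Sigma v -> 1 only, for the second that
    v' S^-1 v / v' Sigma^-1 v -> 1, that S is bounded below, and that
    p / sqrt n -> 0, the size of the shift from al to al' in standard units
    (lemmas [z_inv_uniform] and [z_dir_uniform]).  Monotonicity of distribution
    functions makes the approximation uniform in t (lemma [polya_grid]).

    These conditions on S hold with probability tending to one.  The variance
    of u' S u is at most a constant times (u' Sigma u)^2 / n (lemma
    [sample_quad_dev]).  With u = v this settles the first claim.  For the
    second, polarization bounds the mean square of every entry of S - Sigma, so
    the squared Frobenius distance is of order p^2 / n (lemma [frob_tail]), and
    a small Frobenius distance sandwiches S between multiples of Sigma in the
    Loewner order, which inversion reverses (lemma [loewner_sandwich]).  On the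
    exceptional event the supremum is at most 1.

    Most of the length comes from the measure theory of symmetric matrices:
    the Jacobians above, the Lebesgue-nullity of the boundary of the cone, and
    the finiteness of the total mass, which is delicate for b = 1, where the
    prior density blows up at the boundary (lemma [cone_dens_half_lty]). *)

Set Implicit Arguments.
Unset Strict Implicit.
Unset Printing Implicit Defensive.

Import Order.TTheory GRing.Theory Num.Theory.
Import numFieldNormedType.Exports.

Local Open Scope classical_set_scope.
Local Open Scope ring_scope.

(** * Affine changes of variables *)

(** The pushforward packaged as a measure, so that it can be integrated against. *)
Definition image_measure d d' (T1 : measurableType d) (T2 : measurableType d')
    (R : realType) (m : {measure set T1 -> \bar R}) (f : T1 -> T2)
    (mf : measurable_fun [set: T1] f) : {measure set T2 -> \bar R} :=
  measure_function_pushforward__canonical__measure_function_Measure m mf.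

Section line.
Context {R : realType}.
Notation leb := (@lebesgue_measure R).
Implicit Type F : R -> \bar R.

Lemma lebesgue_measure_affine (a c : R) (A : set R) : 0 < a -> measurable A ->
  (a%:E * leb ((fun x => (a * x + c)%R) @^-1` A) = leb A)%E.
Proof.
move=> a0 mA.
have mphi : measurable_fun setT (fun x : measurableTypeR R => a * x + c : measurableTypeR R).
  by apply: measurable_funD => //; apply: measurable_funM.
pose a' : {nonneg R} := NngNum (ltW a0).
pose m := mscale a' (image_measure leb mphi).
suff : leb A = m A by move=> ->.
apply: lebesgue_measure_unique => // _ [[x y]] _ <-.
rewrite -[RHS]/(a%:E * leb ((fun z => (a * z + c)%R) @^-1` `]x, y]%classic))%E.
rewrite (_ : _ @^-1` _ = `](x - c) / a, (y - c) / a]%classic); last first.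
  apply/seteqP; split => z /=; rewrite !in_itv/=.
    by rewrite ltr_pdivrMr// ler_pdivlMr// ltrBlDr lerBrDr ![z * a]mulrC.
  by rewrite ltr_pdivrMr// ler_pdivlMr// ltrBlDr lerBrDr ![z * a]mulrC.
rewrite !lebesgue_measure_itv/= !lte_fin ltr_pM2r ?invr_gt0// ltrD2r.
case: ifP => _; last by rewrite mule0.
rewrite -!EFinD -EFinM; congr EFin; field; lra.
Qed.

Lemma ge0_integral_affine (a c : R) F : 0 < a ->
  measurable_fun setT F -> (forall x, 0 <= F x)%E ->
  (a%:E * \int[leb]_x F (a * x + c)%R = \int[leb]_x F x)%E.
Proof.
move=> a0 mF F0.
have mphi : measurable_fun setT (fun x : measurableTypeR R => a * x + c : measurableTypeR R).
  by apply: measurable_funD => //; apply: measurable_funM.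
pose a' : {nonneg R} := NngNum (ltW a0).
pose m := mscale a' (image_measure leb mphi).
transitivity (\int[m]_x F x)%E.
  rewrite ge0_integral_mscale//=.
  by rewrite (ge0_integral_pushforward mphi)// => x _; exact: F0.
apply: eq_measure_integral => A mA _.
by rewrite -[RHS](lebesgue_measure_affine c a0 mA).
Qed.

End line.

(** * Integrals over product measures *)
Section product_tuple.
Context {R : realType}.
Notation leb := (@lebesgue_measure R).

Lemma ge0_integral_product_cons d (T : measurableType d)
    (m : {sigma_finite_measure set T -> \bar R}) n (F : n.+1.-tuple T -> \bar R) :
  measurable_fun setT F -> (forall x, 0 <= F x)%E ->
  (\int[product_tuple m n.+1]_x F x =
   \int[m]_x \int[product_tuple m n]_t F [tuple of x :: t])%E.
Proof.
move=> mF F0.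
pose cons_pair (x : T * n.-tuple T) : n.+1.-tuple T := [tuple of x.1 :: x.2].
have mc : measurable_fun setT cons_pair by exact: measurable_cons.
transitivity (\int[image_measure (m \x product_tuple m n)%E mc]_x F x)%E.
  exact: eq_measure_integral.
rewrite ge0_integral_pushforward//.
rewrite preimage_setT fubini_tonelli1//=.
exact: measurableT_comp.
Qed.

Definition affine_tuple n (a c : 'I_n -> R) (x : n.-tuple R) : n.-tuple R :=
  [tuple a i * tnth x i + c i | i < n].

Lemma measurable_affine_tuple n (a c : 'I_n -> R) :
  measurable_fun setT
    (affine_tuple a c : n.-tuple (measurableTypeR R) -> n.-tuple (measurableTypeR R)).
Proof.
apply/measurable_fun_tnthP => i.
rewrite (_ : _ \o _ = fun x : n.-tuple (measurableTypeR R) =>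
  a i * tnth x i + c i :> measurableTypeR R); last first.
  by apply/funext => x /=; rewrite tnth_mktuple.
apply: measurable_funD => //; apply: measurable_funM => //.
exact: measurable_tnth.
Qed.

Lemma ge0_integral_affine_tuple n (a c : 'I_n -> R)
    (F : n.-tuple (measurableTypeR R) -> \bar R) :
  (forall i, 0 < a i) -> measurable_fun setT F -> (forall x, 0 <= F x)%E ->
  ((\prod_i a i)%:E * \int[product_tuple leb n]_x F (affine_tuple a c x) =
   \int[product_tuple leb n]_x F x)%E.
Proof.
elim: n a c F => [|n ih] a c F a0 mF F0.
  rewrite big_ord0 mul1e; apply: eq_integral => x _; congr F.
  by apply: eq_from_tnth => -[].
have maff := measurable_affine_tuple a c.
rewrite big_ord_recl !ge0_integral_product_cons//; last exact: measurableT_comp.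
have mG : measurable_fun setT (fun y : measurableTypeR R * n.-tuple (measurableTypeR R) =>
    F [tuple of y.1 :: y.2]).
  by apply: measurableT_comp => //; exact: measurable_cons.
pose G y := (\int[product_tuple leb n]_t F [tuple of y :: t])%E.
have mG1 : measurable_fun setT G by exact: (measurable_fun_fubini_tonelli_F _ mG).
have G0 y : (0 <= G y)%E by apply: integral_ge0.
pose a' i := a (lift ord0 i); pose c' i := c (lift ord0 i).
have a'0 : 0 < \prod_i a' i by apply: prodr_gt0 => i _; exact: a0.
transitivity ((a ord0)%:E * \int[leb]_x ((\prod_i a' i)%:E *
    \int[product_tuple leb n]_t F (affine_tuple a c [tuple of x :: t])))%E.
  rewrite ge0_integralZl//; last 3 first.
  - apply: (measurable_fun_fubini_tonelli_F (m2 := product_tuple leb n)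
      (fun y : measurableTypeR R * n.-tuple (measurableTypeR R) =>
      F (affine_tuple a c [tuple of y.1 :: y.2]))) => //.
    by apply: measurableT_comp => //; apply: measurableT_comp => //; exact: measurable_cons.
  - by move=> x _; exact: integral_ge0.
  - by rewrite lee_fin ltW.
  by rewrite muleA -EFinM.
rewrite -(ge0_integral_affine (c ord0) (a0 ord0) mG1 G0); congr (_ * _)%E.
apply: eq_integral => x _.
rewrite -[RHS](ih a' c' (fun t => F [tuple of a ord0 * x + c ord0 :: t])) => [|i|| t]//; last 2 first.
- exact: a0.
- exact: (measurableT_comp mF (measurable_cons (measurable_cst (a ord0 * x + c ord0 : measurableTypeR R)) (@measurable_id _ _ setT))).
congr (_ * _)%E; apply: eq_integral => t _; congr F.
apply: eq_from_tnth => i; rewrite tnth_mktuple.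
case: (unliftP ord0 i) => [j ->|->]; last by rewrite !tnth0.
by rewrite !tnthS tnth_mktuple.
Qed.

Lemma integral_product_lty n (f : 'I_n -> R -> R) :
  (forall i, measurable_fun setT (f i)) -> (forall i x, 0 <= f i x) ->
  (forall i, \int[leb]_x (f i x)%:E < +oo)%E ->
  (\int[product_tuple leb n]_x (\prod_i f i (tnth x i))%:E < +oo)%E.
Proof.
elim: n f => [|n ih] f mf f0 fy.
  under eq_integral do rewrite big_ord0.
  by rewrite integral_cst//= mul1e diracT ltry.
have mprod k (g : 'I_k -> R -> R) : (forall i, measurable_fun setT (g i)) ->
    measurable_fun setT (fun x : k.-tuple (measurableTypeR R) =>
      (\prod_i g i (tnth x i))%:E).
  move=> mg; apply/measurable_EFinP; apply: measurable_prod => i _.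
  apply: (measurableT_comp (mg i)); exact: measurable_tnth.
rewrite ge0_integral_product_cons//; [|exact: mprod|]; last first.
  by move=> x; rewrite lee_fin prodr_ge0.
have fin : (\int[product_tuple leb n]_x
    (\prod_i f (lift ord0 i) (tnth x i))%:E < +oo)%E.
  by apply: (ih (fun i => f (lift ord0 i))) => [i|i x|i]; [exact: mf|exact: f0|exact: fy].
pose C := fine (\int[product_tuple leb n]_x
    (\prod_i f (lift ord0 i) (tnth x i))%:E)%E.
have CE : (C%:E = \int[product_tuple leb n]_x
    (\prod_i f (lift ord0 i) (tnth x i))%:E)%E.
  rewrite fineK// ge0_fin_numE//.
  by apply: integral_ge0 => x _; rewrite lee_fin prodr_ge0.
have C0 : 0 <= C.
  by rewrite fine_ge0// integral_ge0// => x _; rewrite lee_fin prodr_ge0.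
under eq_integral => x _.
  under eq_integral => t _.
    rewrite big_ord_recl tnth0 EFinM.
    under eq_bigr do rewrite tnthS.
    over.
  rewrite ge0_integralZl//; last 3 first.
  - by apply: (mprod _ (fun i => f (lift ord0 i))) => i; exact: mf.
  - by move=> t _; rewrite lee_fin prodr_ge0.
  - by rewrite lee_fin.
  rewrite -CE.
  over.
rewrite ge0_integralZr//.
- rewrite lte_mul_pinfty ?ltry//; last 2 first.
  + by apply: integral_ge0 => x _; rewrite lee_fin.
  + by rewrite ge0_fin_numE// integral_ge0// => x _; rewrite lee_fin.
- by apply/measurable_EFinP; exact: (mf ord0).
- by move=> x _; rewrite lee_fin.
Qed.

End product_tuple.

(** * Measurability of matrix operations *)
Section measurable_matrices.
Context {R : realType} d (T : measurableType d).

Lemma measurable_fun_entry m n (f : T -> 'M[R]_(m, n)) i j :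
  measurable_fun setT f -> measurable_fun setT (fun x => f x i j).
Proof. by move=> mf; exact: (measurableT_comp (measurable_entry i j) mf). Qed.

Lemma measurable_mulmx m n k (f : T -> 'M[R]_(m, n)) (g : T -> 'M[R]_(n, k)) :
  measurable_fun setT f -> measurable_fun setT g ->
  measurable_fun setT (fun x => f x *m g x).
Proof.
move=> mf mg; apply: measurable_fun_mx => i j.
under eq_fun do rewrite mxE.
apply: measurable_sum => l; apply: measurable_funM; exact: measurable_fun_entry.
Qed.

Lemma measurable_addmx m n (f g : T -> 'M[R]_(m, n)) :
  measurable_fun setT f -> measurable_fun setT g ->
  measurable_fun setT (fun x => f x + g x).
Proof.
move=> mf mg; apply: measurable_fun_mx => i j.
under eq_fun do rewrite mxE.
apply: measurable_funD; exact: measurable_fun_entry.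
Qed.

Lemma measurable_scalemx m n (k : T -> R) (f : T -> 'M[R]_(m, n)) :
  measurable_fun setT k -> measurable_fun setT f ->
  measurable_fun setT (fun x => k x *: f x).
Proof.
move=> mk mf; apply: measurable_fun_mx => i j.
under eq_fun do rewrite mxE.
apply: measurable_funM => //; exact: measurable_fun_entry.
Qed.

Lemma measurable_oppmx m n (f : T -> 'M[R]_(m, n)) :
  measurable_fun setT f -> measurable_fun setT (fun x => - f x).
Proof.
move=> mf; under eq_fun do rewrite -scaleN1r.
exact: measurable_scalemx.
Qed.

Lemma measurable_trmx m n (f : T -> 'M[R]_(m, n)) :
  measurable_fun setT f -> measurable_fun setT (fun x => (f x)^T).
Proof.
move=> mf; apply: measurable_fun_mx => i j.
under eq_fun do rewrite mxE.
exact: measurable_fun_entry.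
Qed.

End measurable_matrices.

Lemma symE (R : Type) p (M : 'M[R]_p) : M^T = M -> forall i j, M i j = M j i.
Proof. by move=> MT i j; rewrite -[in LHS]MT mxE. Qed.

(** The Jacobian exponent [p.+1]: each index i occurs once in every pair
    {i, j} with j <> i and twice in (i, i). *)
Lemma prod_upper_pairs (R : comPzRingType) p (d : 'I_p -> R) :
  \prod_(ij : 'I_p * 'I_p | (ij.1 <= ij.2)%N) (d ij.1 * d ij.2) =
  (\prod_i d i) ^+ p.+1.
Proof.
rewrite -(pair_big_dep xpredT (fun i j : 'I_p => (i <= j)%N) (fun i j => d i * d j))/=.
under eq_bigr do rewrite big_split/=.
rewrite big_split/= [X in _ * X](exchange_big_dep xpredT)//= -big_split/=.
rewrite -prodrXl; apply: eq_bigr => i _.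
rewrite !prodr_const -exprD; congr (_ ^+ _).
rewrite -cardUI [X in (X + _)%N](_ : _ = p); last first.
  rewrite -[RHS]card_ord; apply: eq_card => j.
  by rewrite !inE; exact: leq_total.
rewrite [X in (_ + X)%N](_ : _ = 1%N) ?addn1// -(card1 i); apply: eq_card => j.
by rewrite !inE -eqn_leq eq_sym.
Qed.

(** * Lebesgue measure on symmetric matrices *)
Section lebesgue_sym_coordinates.
Context {R : realType} (p : nat).
Notation leb := (@lebesgue_measure R).
Let N := size (upper_entries p).
Implicit Type F : 'M[R]_p -> \bar R.

Lemma ge0_integral_lebesgue_sym F :
  measurable_fun setT F -> (forall M, 0 <= F M)%E ->
  (\int[lebesgue_sym p]_M F M =
   \int[product_tuple leb N]_x F (sym_of_upper x))%E.
Proof.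
move=> mF F0.
transitivity (\int[image_measure (product_tuple leb N)
    (@measurable_sym_of_upper R p)]_M F M)%E; first exact: eq_measure_integral.
by rewrite ge0_integral_pushforward//; exact: measurable_sym_of_upper.
Qed.

(** Lebesgue measure lives on symmetric matrices, so integrands need only agree
    there; all computations with transposes enter through this lemma. *)
Lemma eq_integral_lebesgue_sym F G :
  measurable_fun setT F -> (forall M, 0 <= F M)%E ->
  measurable_fun setT G -> (forall M, 0 <= G M)%E ->
  (forall M, M^T = M -> F M = G M) ->
  (\int[lebesgue_sym p]_M F M = \int[lebesgue_sym p]_M G M)%E.
Proof.
move=> mF F0 mG G0 FG; rewrite !ge0_integral_lebesgue_sym//.
by apply: eq_integral => x _; apply: FG; exact: sym_of_upper_sym.
Qed.

Definition upper_pos (k : 'I_N) : 'I_p * 'I_p := tnth (in_tuple (upper_entries p)) k.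

Lemma upper_pos_le k : ((upper_pos k).1 <= (upper_pos k).2)%N.
Proof.
have := mem_tnth k (in_tuple (upper_entries p)).
by rewrite mem_filter => /andP[].
Qed.

Lemma uniq_upper_entries : uniq (upper_entries p).
Proof. exact/filter_uniq/enum_uniq. Qed.

Lemma sym_of_upperE (x : N.-tuple R) k :
  sym_of_upper x (upper_pos k).1 (upper_pos k).2 = tnth x k.
Proof.
rewrite mxE upper_pos_le -surjective_pairing.
rewrite /upper_pos (tnth_nth (upper_pos k)) index_uniq ?uniq_upper_entries//.
by rewrite -tnth_nth.
Qed.

Lemma sym_of_upper_eq (x : N.-tuple R) (M : 'M[R]_p) : M^T = M ->
  (forall k, tnth x k = M (upper_pos k).1 (upper_pos k).2) -> sym_of_upper x = M.
Proof.
move=> MT xM.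
have le_case (i j : 'I_p) : (i <= j)%N -> sym_of_upper x i j = M i j.
  move=> ij.
  have ijN : (index (i, j) (upper_entries p) < N)%N.
    by rewrite index_mem mem_filter mem_enum ij.
  pose k := Ordinal ijN.
  have kE : upper_pos k = (i, j).
    by rewrite /upper_pos (tnth_nth (i, j))/= nth_index// -index_mem.
  by have := xM k; rewrite -sym_of_upperE kE.
apply/matrixP => i j; have [/le_case//|/ltnW ji] := leqP i j.
by rewrite (symE (sym_of_upper_sym x)) (symE MT) le_case.
Qed.

Lemma lebesgue_sym_translate (C : 'M[R]_p) F : C^T = C ->
  measurable_fun setT F -> (forall M, 0 <= F M)%E ->
  (\int[lebesgue_sym p]_M F (M + C)%R = \int[lebesgue_sym p]_M F M)%E.
Proof.
move=> CT mF F0.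
rewrite !ge0_integral_lebesgue_sym//; last first.
  by apply: measurableT_comp => //; apply: measurable_addmx.
pose c k := C (upper_pos k).1 (upper_pos k).2.
rewrite -[RHS](ge0_integral_affine_tuple (a := fun=> 1) c)//; last first.
  exact: (measurableT_comp mF (@measurable_sym_of_upper R p)).
rewrite big1// mul1e; apply: eq_integral => x _; congr F.
apply/esym/sym_of_upper_eq => [|k].
  by rewrite linearD/= sym_of_upper_sym CT.
by rewrite mxE sym_of_upperE tnth_mktuple mul1r.
Qed.

Lemma lebesgue_sym_dilate (d : 'I_p -> R) F : (forall i, 0 < d i) ->
  measurable_fun setT F -> (forall M, 0 <= F M)%E ->
  (((\prod_i d i) ^+ p.+1)%R%:E *
     \int[lebesgue_sym p]_M F (diag_mx (\row_i d i) *m M *m diag_mx (\row_i d i))%R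
   = \int[lebesgue_sym p]_M F M)%E.
Proof.
move=> d0 mF F0.
rewrite !ge0_integral_lebesgue_sym//; last first.
  by apply: measurableT_comp => //; do 2 apply: measurable_mulmx => //.
pose a k := d (upper_pos k).1 * d (upper_pos k).2.
rewrite -[RHS](ge0_integral_affine_tuple (a := a) (fun=> 0)); last first.
- by [].
- exact: (measurableT_comp mF (@measurable_sym_of_upper R p)).
- by move=> k; exact: mulr_gt0.
congr (_%:E * _)%E.
  rewrite /a /upper_pos -(big_tnth _ _ (upper_entries p) xpredT (fun ij => d ij.1 * d ij.2)).
  by rewrite big_filter big_enum_cond/= prod_upper_pairs.
apply: eq_integral => x _; congr F.
apply/esym/sym_of_upper_eq => [|k].
  by rewrite !trmx_mul !tr_diag_mx sym_of_upper_sym mulmxA.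
rewrite tnth_mktuple addr0 mul_mx_diag mxE mul_diag_mx mxE sym_of_upperE !mxE.
by rewrite /a; ring.
Qed.

End lebesgue_sym_coordinates.

Section lebesgue_sym_sigma_finite.
Context {R : realType} (p : nat).
Notation leb := (@lebesgue_measure R).
Let N := size (upper_entries p).

Let upper_of (M : 'M[R]_p) : N.-tuple (measurableTypeR R) :=
  [tuple M (upper_pos k).1 (upper_pos k).2 | k < N].

Let measurable_upper_of : measurable_fun setT upper_of.
Proof.
apply/measurable_fun_tnthP => k.
rewrite (_ : _ \o _ = fun M : 'M[R]_p => M (upper_pos k).1 (upper_pos k).2).
  exact: measurable_entry.
by apply/funext => M /=; rewrite tnth_mktuple.
Qed.

Let upper_ofK x : upper_of (sym_of_upper x) = x.
Proof. by apply: eq_from_tnth => k; rewrite tnth_mktuple sym_of_upperE. Qed.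

Let lebesgue_sym_sigma_finite : sigma_finite setT (@lebesgue_sym R p).
Proof.
have /sigma_finiteP[F [TF ndF Foo]] := sigma_finiteT (product_tuple leb N).
exists (fun k => upper_of @^-1` F k); first by rewrite -preimage_bigcup -TF.
move=> k; have [mFk Fk] := Foo k; split.
  by rewrite -[X in measurable X]setTI; exact: measurable_upper_of.
rewrite /lebesgue_sym/= /pushforward -comp_preimage.
by rewrite (_ : upper_of \o _ = id)//; apply/funext => x; exact: upper_ofK.
Qed.

HB.instance Definition _ := @Measure_isSigmaFinite.Build _ _ _
  (@lebesgue_sym R p) lebesgue_sym_sigma_finite.

Lemma product_tuple_setT_gt0 n : (0 < product_tuple leb n setT)%E.
Proof.
elim: n => [|n ih]; first by rewrite /= diracT lte01.
have : (\int[product_tuple leb n.+1]_x (cst 1 x) = +oo)%E.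
  rewrite ge0_integral_product_cons//=.
  under eq_integral do rewrite integral_cst// mul1e.
  rewrite integral_cst//= -set_itvNyy lebesgue_measure_itv/=.
  by rewrite gt0_muley.
by rewrite integral_cst// mul1e => ->.
Qed.

Lemma lebesgue_sym_setT_gt0 : (0 < @lebesgue_sym R p setT)%E.
Proof. exact: product_tuple_setT_gt0. Qed.

End lebesgue_sym_sigma_finite.

(** * Congruences acting on symmetric matrices *)
Section lebesgue_sym_congruence.
Context {R : realType} (p : nat).
Notation lsym := (@lebesgue_sym R p).
Implicit Type F : 'M[R]_p -> \bar R.

Lemma lebesgue_sym_finite_set :
  exists E : set 'M[R]_p, [/\ measurable E, (0 < lsym E)%E & (lsym E < +oo)%E].
Proof.
have /sigma_finiteP[F [TF ndF Foo]] := sigma_finiteT lsym.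
apply: contrapT => noE.
have F0 k : lsym (F k) = 0%E.
  have [mFk Fk] := Foo k.
  apply/eqP; apply: contrapT => /negP Fk0; apply: noE; exists (F k); split => //.
  by rewrite lt_neqAle eq_sym Fk0 measure_ge0.
have := @lebesgue_sym_setT_gt0 R p.
rewrite TF lt_neqAle => /andP[+ _]; rewrite eq_sym => /negP; apply.
rewrite -measure_le0.
have mF k : measurable (F k) by have [] := Foo k.
have := measure_sigma_subadditive lsym (A := \bigcup_k F k) mF.
move=> /(_ (bigcupT_measurable _ mF) (@subset_refl _ _)) /le_trans; apply.
by rewrite eseries0// => i _ _; exact: F0.
Qed.

Definition congr_mx (B M : 'M[R]_p) := B *m M *m B^T.

Lemma congr_mx_sym B M : M^T = M -> (congr_mx B M)^T = congr_mx B M.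
Proof. by move=> MT; rewrite /congr_mx !trmx_mul trmxK MT mulmxA. Qed.

Lemma congr_mxM A B M : congr_mx (A *m B) M = congr_mx A (congr_mx B M).
Proof. by rewrite /congr_mx trmx_mul !mulmxA. Qed.

Lemma congr_mx1 M : congr_mx 1%:M M = M.
Proof. by rewrite /congr_mx trmx1 mul1mx mulmx1. Qed.

Lemma congr_mxD B M M' : congr_mx B (M + M') = congr_mx B M + congr_mx B M'.
Proof. by rewrite /congr_mx mulmxDr mulmxDl. Qed.

Lemma measurable_congr_mx d (T : measurableType d) B (f : T -> 'M[R]_p) :
  measurable_fun setT f -> measurable_fun setT (fun x => congr_mx B (f x)).
Proof. by move=> mf; do 2 apply: measurable_mulmx => //. Qed.

(** A congruence carries Lebesgue measure to a translation invariant measure,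
    hence to a multiple of it.  Only the existence of the constant is claimed:
    it cancels in the Jacobian of a conjugate of a diagonal dilation.  The
    uniqueness of the invariant measure is obtained by comparing with a set E
    of finite positive measure through Tonelli. *)
Lemma lebesgue_sym_congr_const (B : 'M[R]_p) : B \in unitmx ->
  exists2 c : \bar R, (0 <= c)%E &
  forall F, measurable_fun setT F -> (forall M, 0 <= F M)%E ->
  (\int[lsym]_M F (congr_mx B M) = c * \int[lsym]_M F M)%E.
Proof.
move=> Bu.
have [E [mE E0 Ey]] := lebesgue_sym_finite_set.
pose g M := (\1_E M : R)%:E.
have mg : measurable_fun setT g by apply/measurable_EFinP.
have g0 M : (0 <= g M)%E by rewrite lee_fin.
have gE : (\int[lsym]_M g M = lsym E)%E by rewrite integral_indic// setIT.
pose B' := invmx B.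
have BB' C : congr_mx B (congr_mx B' C) = C.
  by rewrite -congr_mxM mulmxV// congr_mx1.
have Efin : lsym E \is a fin_num by rewrite ge0_fin_numE.
pose m := (\int[lsym]_y g (- congr_mx B y)%R)%E.
have m0 : (0 <= m)%E by exact: integral_ge0.
exists ((fine (lsym E))^-1%:E * m)%E.
  by rewrite mule_ge0// lee_fin invr_ge0 fine_ge0.
move=> F mF F0.
suff H : (lsym E * \int[lsym]_M F (congr_mx B M) = m * \int[lsym]_M F M)%E.
  rewrite -muleA -H muleA -[in X in _ = (_ * X * _)%E](fineK Efin) -EFinM mulVf ?mul1e//.
  by rewrite gt_eqF// fine_gt0// E0 Ey.
have mB : measurable_fun setT (congr_mx B) by apply: measurable_congr_mx.
have mFB : measurable_fun setT (fun y => F (congr_mx B y)) by exact: measurableT_comp.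
have p1 : measurable_fun setT (fst : 'M[R]_p * 'M[R]_p -> _) := measurable_fst.
have p2 : measurable_fun setT (snd : 'M[R]_p * 'M[R]_p -> _) := measurable_snd.
pose H1 (z : 'M[R]_p * 'M[R]_p) := (g z.1 * F (congr_mx B z.2))%E.
pose H2 (z : 'M[R]_p * 'M[R]_p) := (g z.1 * F (congr_mx B z.2 + z.1)%R)%E.
pose H3 (z : 'M[R]_p * 'M[R]_p) := (g (z.1 - congr_mx B z.2)%R * F z.1)%E.
have mH1 : measurable_fun setT H1.
  apply: emeasurable_funM; first exact: measurableT_comp.
  exact: (measurableT_comp mFB p2).
have mH2 : measurable_fun setT H2.
  apply: emeasurable_funM; first exact: measurableT_comp.
  apply: (measurableT_comp mF); apply: measurable_addmx => //.
  exact: measurable_congr_mx.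
have mH3 : measurable_fun setT H3.
  apply: emeasurable_funM; last exact: measurableT_comp.
  apply: (measurableT_comp mg); apply: measurable_addmx => //.
  by apply: measurable_oppmx; exact: measurable_congr_mx.
have H10 z : (0 <= H1 z)%E by rewrite mule_ge0.
have H20 z : (0 <= H2 z)%E by rewrite mule_ge0.
have H30 z : (0 <= H3 z)%E by rewrite mule_ge0.
transitivity (\int[lsym]_x \int[lsym]_y H1 (x, y))%E.
  rewrite -gE -ge0_integralZr//; last exact: integral_ge0.
  apply: eq_integral => x _ /=.
  by rewrite -ge0_integralZl.
transitivity (\int[lsym]_x \int[lsym]_y H2 (x, y))%E.
  apply: eq_integral_lebesgue_sym.
  - exact: (measurable_fun_fubini_tonelli_F _ mH1).
  - by move=> x; exact: integral_ge0.
  - exact: (measurable_fun_fubini_tonelli_F _ mH2).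
  - by move=> x; exact: integral_ge0.
  move=> x xT.
  rewrite -(@lebesgue_sym_translate _ _ (congr_mx B' x)); last 3 first.
  - exact: congr_mx_sym.
  - exact: measurable_fun_pair2.
  - by [].
  by apply: eq_integral => y _; rewrite /H1/H2/= congr_mxD BB'.
rewrite fubini_tonelli//.
transitivity (\int[lsym]_y \int[lsym]_x H3 (x, y))%E.
  apply: eq_integral_lebesgue_sym.
  - exact: (measurable_fun_fubini_tonelli_G _ mH2).
  - by move=> x; exact: integral_ge0.
  - exact: (measurable_fun_fubini_tonelli_G _ mH3).
  - by move=> x; exact: integral_ge0.
  move=> y yT.
  rewrite -[LHS](@lebesgue_sym_translate _ _ (- congr_mx B y)); last 3 first.
  - by rewrite linearN/= congr_mx_sym.
  - exact: measurable_fun_pair1.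
  - by [].
  by apply: eq_integral => x _; rewrite /H2/H3/= addrCA subrr addr0.
rewrite -fubini_tonelli//.
rewrite -ge0_integralZl//.
apply: eq_integral_lebesgue_sym.
- exact: (measurable_fun_fubini_tonelli_F _ mH3).
- by move=> x; exact: integral_ge0.
- by apply: emeasurable_funM.
- by move=> x; rewrite mule_ge0.
move=> x xT; rewrite /H3/= ge0_integralZr//; last first.
  apply: (measurableT_comp mg); apply: measurable_addmx => //.
  exact: measurable_oppmx.
congr (_ * _)%E.
rewrite -(@lebesgue_sym_translate _ _ (congr_mx B' x)); last 3 first.
- exact: congr_mx_sym.
- apply: (measurableT_comp mg); apply: measurable_addmx => //.
  exact: measurable_oppmx.
- by [].
by apply: eq_integral => y _; rewrite congr_mxD BB' opprD addrCA subrr addr0.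
Qed.

End lebesgue_sym_congruence.

(** * Rank-one matrices and stretches along a direction *)
Section rank_one.
Context {F : fieldType} (p : nat).
Implicit Types u v x y : 'cV[F]_p.

Definition dotmx u v : F := (u^T *m v) ord0 ord0.

Lemma mx11E (A : 'M[F]_1) : A = (A ord0 ord0)%:M.
Proof. by apply/matrixP => i j; rewrite !ord1 mxE eqxx mulr1n. Qed.

Lemma dotmxE u v : u^T *m v = (dotmx u v)%:M.
Proof. exact: mx11E. Qed.

Lemma dotmxC u v : dotmx u v = dotmx v u.
Proof.
rewrite /dotmx !mxE; apply: eq_bigr => i _.
by rewrite !mxE mulrC.
Qed.

Lemma mul_rank1 u v x : u *m v^T *m x = dotmx v x *: u.
Proof. by rewrite -mulmxA dotmxE mul_mx_scalar. Qed.

Lemma mul_tr_rank1 u v x : x^T *m (u *m v^T) = dotmx x u *: v^T.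
Proof. by rewrite mulmxA dotmxE mul_scalar_mx. Qed.

Lemma mul_rank1_rank1 u v x y : (u *m v^T) *m (x *m y^T) = dotmx v x *: (u *m y^T).
Proof. by rewrite mulmxA mul_rank1 scalemxAl. Qed.

Lemma rank1_update_unitmx x y : 1 + dotmx y x != 0 -> 1%:M + x *m y^T \in unitmx.
Proof.
move=> c0.
suff /mulmx1_unit[] : (1%:M + x *m y^T) *m
  (1%:M - (1 + dotmx y x)^-1 *: (x *m y^T)) = 1%:M by [].
rewrite mulmxDl mul1mx mulmxBr mulmx1 -scalemxAr mul_rank1_rank1 scalerA.
move: (x *m y^T) => X; rewrite -addrA -[RHS]addr0; congr (_ + _).
transitivity ((- (1 + dotmx y x)^-1 + (1 - (1 + dotmx y x)^-1 * dotmx y x)) *: X).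
  by rewrite !scalerDl !scaleNr scale1r.
by rewrite (_ : _ + _ = 0) ?scale0r//; field.
Qed.

(** A basis change taking the pair (u, v) to a coordinate vector and its dual.
    It is a product of two rank-one updates of the identity: the first moves
    the coordinate vector to u, the second corrects the dual vector. *)
Lemma rank1_basis u v : dotmx v u = 1 -> exists i (B : 'M[F]_p),
  [/\ B \in unitmx, B *m delta_mx i ord0 = u & v^T *m B = (delta_mx i ord0)^T].
Proof.
move=> vu1.
have [i ui0] : exists i, u i ord0 != 0.
  apply/existsP; rewrite -[X in is_true X]negbK; apply/negP => /existsPn u0.
  move/eqP: vu1; rewrite /dotmx mxE big1; last first.
    by move=> i _; move/negPn/eqP: (u0 i) => ->; rewrite mulr0.
  by rewrite eq_sym oner_eq0.
pose e : 'cV[F]_p := delta_mx i ord0.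
have eE x : dotmx e x = x i ord0.
  by rewrite /dotmx /e trmx_delta -rowE mxE.
have ee : dotmx e e = 1 by rewrite eE mxE !eqxx.
pose Q := 1%:M + (u - e) *m e^T.
have Qu : Q \in unitmx.
  apply: rank1_update_unitmx.
  by rewrite eE !mxE !eqxx/= (_ : _ + _ = u i ord0)//; ring.
have Qe : Q *m e = u by rewrite mulmxDl mul1mx mul_rank1 ee scale1r addrC subrK.
pose w : 'cV[F]_p := (v^T *m Q)^T.
have we : dotmx w e = 1.
  by rewrite /dotmx /w trmxK -mulmxA Qe.
pose R := 1%:M + e *m (e - w)^T.
have dB x y z : dotmx (x - y) z = dotmx x z - dotmx y z.
  by rewrite /dotmx linearB/= mulmxBl !mxE.
have Re : R *m e = e.
  by rewrite mulmxDl mul1mx mul_rank1 dB ee we subrr scale0r addr0.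
exists i, (Q *m R); split.
- rewrite unitmx_mul Qu/=; apply: rank1_update_unitmx.
  by rewrite dB ee we subrr addr0 oner_neq0.
- by rewrite -mulmxA Re.
rewrite mulmxA -[v^T *m Q]trmxK -/w mulmxDr mulmx1 mul_tr_rank1 we scale1r.
by rewrite linearB/= addrC subrK.
Qed.

(** Multiplies u by s and fixes the kernel of v^T, when [dotmx v u = 1]. *)
Definition stretch_mx u v (s : F) : 'M[F]_p := 1%:M + (s - 1) *: (u *m v^T).

Definition dilation_coef (i : 'I_p) (s : F) (j : 'I_p) : F := if j == i then s else 1.

Lemma stretch_mx_conj u v : dotmx v u = 1 -> exists i (B : 'M[F]_p), B \in unitmx /\
  forall s, stretch_mx u v s = B *m diag_mx (\row_j dilation_coef i s j) *m invmx B.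
Proof.
move=> /rank1_basis[i [B [Bu Be Bv]]]; exists i, B; split => // s.
pose e : 'cV[F]_p := delta_mx i ord0.
have -> : diag_mx (\row_j dilation_coef i s j) = 1%:M + (s - 1) *: (e *m e^T).
  apply/matrixP => j k; rewrite !mxE big_ord1 !mxE !eqxx/= !andbT /dilation_coef.
  have [->|jk] := eqVneq j k.
    by case: eqP => _; rewrite ?mulr1n/=; ring.
  rewrite mulr0n add0r; have [ji|_] := eqVneq j i; last by rewrite mul0r mulr0.
  by move: jk; rewrite ji eq_sym => /negPf ->; rewrite !mulr0.
rewrite mulmxDr mulmx1 -scalemxAr mulmxA Be -Bv !mulmxDl mulmxV// -scalemxAl.
by rewrite /stretch_mx -!mulmxA mulmxV// mulmx1.
Qed.

Lemma prod_dilation_coef i s : \prod_j dilation_coef i s j = s.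
Proof.
by rewrite (bigD1 i)//= /dilation_coef eqxx big1 ?mulr1// => j /negPf ->.
Qed.

Lemma det_stretch_mx u v s : dotmx v u = 1 -> \det (stretch_mx u v s) = s.
Proof.
move=> /stretch_mx_conj[i [B [Bu ->]]].
rewrite !det_mulmx mulrAC -det_mulmx mulmxV// det1 mul1r det_diag.
by rewrite -[RHS](prod_dilation_coef i); apply: eq_bigr => j _; rewrite mxE.
Qed.

End rank_one.

Section stretch.
Context {R : realType} (p : nat).
Notation lsym := (@lebesgue_sym R p).

(** Up to a basis change a stretch is a dilation of one coordinate, with
    Jacobian [s ^+ p.+1]; the constants of the basis change and of its inverse
    multiply to one. *)
Lemma lebesgue_sym_stretch (u v : 'cV[R]_p) (s : R) (F : 'M[R]_p -> \bar R) :
  dotmx v u = 1 -> 0 < s ->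
  measurable_fun setT F -> (forall M, 0 <= F M)%E ->
  ((s ^+ p.+1)%:E * \int[lsym]_M F (congr_mx (stretch_mx u v s) M)
   = \int[lsym]_M F M)%E.
Proof.
move=> /stretch_mx_conj[i [B [Bu SE]]] s0 mF F0.
pose B' := invmx B.
pose a := dilation_coef i s.
pose D := diag_mx (\row_j a j).
have [c c0 cE] := lebesgue_sym_congr_const Bu.
have B'u : B' \in unitmx by rewrite unitmx_inv.
have [c' c'0 c'E] := lebesgue_sym_congr_const B'u.
have mcongr C (G : 'M[R]_p -> \bar R) : measurable_fun setT G ->
    measurable_fun setT (fun M => G (congr_mx C M)).
  by move=> mG; apply: (measurableT_comp mG); exact: measurable_congr_mx.
have cc1 : (c' * c = 1)%E.
  have [E [mE E0 Ey]] := @lebesgue_sym_finite_set R p.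
  pose g M := (\1_E M : R)%:E.
  have mg : measurable_fun setT g by apply/measurable_EFinP.
  have g0 M : (0 <= g M)%E by rewrite lee_fin.
  have : (c' * (c * \int[lsym]_M g M) = \int[lsym]_M g M)%E.
    rewrite -cE// -(c'E (fun M => g (congr_mx B M)))//; last exact: mcongr.
    by apply: eq_integral => M _; rewrite -congr_mxM mulmxV// congr_mx1.
  rewrite integral_indic// setIT muleA => H.
  have Ef : lsym E \is a fin_num by rewrite ge0_fin_numE.
  have En : lsym E != 0%E by rewrite gt_eqF.
  by rewrite -[LHS]mule1 -{1}(divee Ef En) muleA H divee.
pose G M := F (congr_mx B (congr_mx D M)).
have mG : measurable_fun setT G by apply: (mcongr D (fun M => F (congr_mx B M))); exact: mcongr.
have G0 M : (0 <= G M)%E by exact: F0.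
rewrite [X in (_ * X)%E](_ : _ = c' * \int[lsym]_M G M)%E; last first.
  rewrite -c'E//; apply: eq_integral => M _.
  by rewrite /G SE -!congr_mxM.
rewrite muleCA [X in (_ * X)%E](_ : _ = \int[lsym]_M F (congr_mx B M))%E; last first.
  rewrite -(@lebesgue_sym_dilate _ _ a (fun M => F (congr_mx B M)))//; last 2 first.
  - by move=> j; rewrite /a /dilation_coef; case: eqP.
  - exact: mcongr.
  congr ((_ ^+ _)%:E * _)%E; first by rewrite prod_dilation_coef.
  by apply: eq_integral => M _; rewrite /G (_ : congr_mx D M = D *m M *m D)// /congr_mx /D tr_diag_mx.
by rewrite cE// muleA cc1 mul1e.
Qed.

End stretch.

(** * Positive definite matrices *)
Section pd.
Context {R : realType}.

Section fixed_size.
Context (p : nat).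
Implicit Types (x y v : 'cV[R]_p) (A M : 'M[R]_p).

Lemma dotmxDl x y v : dotmx (x + y) v = dotmx x v + dotmx y v.
Proof. by rewrite /dotmx linearD/= mulmxDl mxE. Qed.

Lemma dotmxDr x y v : dotmx v (x + y) = dotmx v x + dotmx v y.
Proof. by rewrite /dotmx mulmxDr mxE. Qed.

Lemma dotmxZl k x v : dotmx (k *: x) v = k * dotmx x v.
Proof. by rewrite /dotmx linearZ/= -scalemxAl mxE. Qed.

Lemma dotmxZr k x v : dotmx v (k *: x) = k * dotmx v x.
Proof. by rewrite /dotmx -scalemxAr mxE. Qed.

Lemma dotmx0r x : dotmx x 0 = 0.
Proof. by rewrite /dotmx mulmx0 mxE. Qed.

Lemma dotmx_mull M x y : dotmx (M *m x) y = dotmx x (M^T *m y).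
Proof. by rewrite /dotmx trmx_mul mulmxA. Qed.

Lemma dotmx_sumE x y : dotmx x y = \sum_i x i ord0 * y i ord0.
Proof. by rewrite /dotmx mxE; apply: eq_bigr => i _; rewrite mxE. Qed.

Lemma dotmx_ge0 x : 0 <= dotmx x x.
Proof. by rewrite dotmx_sumE sumr_ge0// => i _; rewrite -expr2 sqr_ge0. Qed.

Lemma dotmx_eq0 x : (dotmx x x == 0) = (x == 0).
Proof.
apply/eqP/eqP => [|->]; last by rewrite /dotmx mulmx0 mxE.
rewrite dotmx_sumE => /eqP; rewrite psumr_eq0; last by move=> i _; rewrite -expr2 sqr_ge0.
move=> /allP x0; apply/matrixP => i j; rewrite ord1 mxE.
by apply/eqP; have := x0 i (mem_index_enum _); rewrite /= -expr2 sqrf_eq0.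
Qed.

Lemma dotmx_gt0 x : x != 0 -> 0 < dotmx x x.
Proof. by move=> x0; rewrite lt_neqAle eq_sym dotmx_eq0 x0 dotmx_ge0. Qed.

Lemma quad_form_dot A x : quad_form A x = dotmx x (A *m x).
Proof. by rewrite /quad_form /dotmx mulmxA. Qed.

Lemma quad_formD A x y : A^T = A ->
  quad_form A (x + y) = quad_form A x + 2 * dotmx y (A *m x) + quad_form A y.
Proof.
move=> AT; rewrite !quad_form_dot mulmxDr !dotmxDl !dotmxDr.
rewrite [dotmx x (A *m y)]dotmxC dotmx_mull AT; ring.
Qed.

Lemma quad_formZ A k x : quad_form A (k *: x) = k ^+ 2 * quad_form A x.
Proof. by rewrite !quad_form_dot -scalemxAr dotmxZl dotmxZr; ring. Qed.

Lemma quad_form_addmx A M x : quad_form (A + M) x = quad_form A x + quad_form M x.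
Proof. by rewrite !quad_form_dot mulmxDl dotmxDr. Qed.

Lemma quad_form_scalemx k M x : quad_form (k *: M) x = k * quad_form M x.
Proof. by rewrite !quad_form_dot -scalemxAl dotmxZr. Qed.

Lemma quad_form1 x : quad_form 1%:M x = dotmx x x.
Proof. by rewrite quad_form_dot mul1mx. Qed.

Lemma quad_form_rank1 v x : quad_form (v *m v^T) x = dotmx v x ^+ 2.
Proof. by rewrite quad_form_dot mul_rank1 dotmxZr [dotmx x v]dotmxC expr2. Qed.

Lemma quad_form_congr B A x : quad_form (congr_mx B A) x = quad_form A (B^T *m x).
Proof.
by rewrite !quad_form_dot [RHS]dotmx_mull trmxK /congr_mx !mulmxA.
Qed.

Lemma pd_psd A : pd_mx p A -> psd_mx p A.
Proof.
move=> [AT A0]; split => // x; have [->|/A0/ltW//] := eqVneq x 0.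
by rewrite quad_form_dot mulmx0 /dotmx mulmx0 mxE.
Qed.

Lemma pd_unitmx A : pd_mx p A -> A \in unitmx.
Proof.
move=> [AT A0]; rewrite unitmxE unitfE; apply/negP => /det0P[x x0 xA].
have := A0 x^T; rewrite trmx_eq0 => /(_ x0).
by rewrite /quad_form trmxK xA mul0mx mxE ltxx.
Qed.

Lemma pd_congr B A : B \in unitmx -> pd_mx p A -> pd_mx p (congr_mx B A).
Proof.
move=> Bu [AT A0]; split; first exact: congr_mx_sym.
move=> x x0; rewrite quad_form_congr; apply: A0.
apply: contra_neq x0 => Bx0.
have BTu : B^T \in unitmx by rewrite unitmx_tr.
by rewrite -[x]mul1mx -(mulVmx BTu) -mulmxA Bx0 mulmx0.
Qed.

Lemma pd_inv A : pd_mx p A -> pd_mx p (invmx A).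
Proof.
move=> Apd; have Au := pd_unitmx Apd; have [AT A0] := Apd.
rewrite (_ : invmx A = congr_mx (invmx A) A).
  by apply: pd_congr => //; rewrite unitmx_inv.
by rewrite /congr_mx mulVmx// mul1mx trmx_inv AT.
Qed.

Lemma quad_form_inv_gt0 A v : pd_mx p A -> v != 0 -> 0 < quad_form (invmx A) v.
Proof. by move=> /pd_inv[_]; apply. Qed.

(** Cauchy-Schwarz for the scalar product attached to [A] *)
Lemma pd_cauchy_schwarz A x v : pd_mx p A ->
  dotmx x v ^+ 2 <= quad_form A x * quad_form (invmx A) v.
Proof.
move=> Apd; have Au := pd_unitmx Apd; have [AT A0] := Apd.
have [->|v0] := eqVneq v 0.
  by rewrite !quad_form_dot mulmx0 !dotmx0r mulr0 expr0n.
have q0 := quad_form_inv_gt0 Apd v0.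
set q := quad_form (invmx A) v in q0 *; set k := dotmx x v.
have e1 : dotmx (invmx A *m v) (A *m x) = k.
  by rewrite dotmx_mull trmx_inv AT mulmxA mulVmx// mul1mx dotmxC.
have e2 : quad_form A (invmx A *m v) = q.
  by rewrite quad_form_dot mulmxA mulmxV// mul1mx dotmxC -quad_form_dot.
have [_ /(_ (x + (- (k / q)) *: (invmx A *m v)))] := pd_psd Apd.
rewrite quad_formD// quad_formZ dotmxZl e1 e2.
rewrite (_ : _ + _ = quad_form A x - k ^+ 2 / q); last by field; rewrite gt_eqF.
by rewrite subr_ge0 ler_pdivrMr.
Qed.

Lemma psd_quad_form_eq0 A x : psd_mx p A -> quad_form A x = 0 -> A *m x = 0.
Proof.
move=> [AT A0] x0; apply/eqP; rewrite -dotmx_eq0.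
set c := dotmx _ _; set y := A *m x.
have H t : 0 <= 2 * t * c + t ^+ 2 * quad_form A y.
  have := A0 (x + t *: y).
  by rewrite quad_formD// x0 add0r quad_formZ dotmxZl mulrA.
have q0 := A0 y.
have c0 : 0 <= c := dotmx_ge0 _.
rewrite eq_le c0 andbT leNgt; apply/negP => cgt.
have := H (- c / (quad_form A y + c)).
rewrite leNgt => /negP; apply.
have qc0 : 0 < quad_form A y + c by lra.
rewrite (_ : _ + _ = - (c ^+ 2 * (quad_form A y + 2 * c)) / (quad_form A y + c) ^+ 2); last first.
  by field; rewrite gt_eqF.
by rewrite mulNr oppr_lt0 divr_gt0 ?exprn_gt0// mulr_gt0 ?exprn_gt0//; lra.
Qed.

(** The boundary of the cone is contained in the zero set of the determinant. *)
Lemma psd_det_neq0 A : psd_mx p A -> \det A != 0 -> pd_mx p A.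
Proof.
move=> Apsd Ad; have [AT A0] := Apsd; split => // x x0.
rewrite lt_neqAle A0 andbT eq_sym; apply: contra_neq x0 => /(psd_quad_form_eq0 Apsd) Ax0.
have Au : A \in unitmx by rewrite unitmxE unitfE.
by rewrite -[x]mul1mx -(mulVmx Au) -mulmxA Ax0 mulmx0.
Qed.

Lemma quad_form_delta A i : quad_form A (delta_mx i ord0) = A i i.
Proof. by rewrite /quad_form trmx_delta -rowE -colE !mxE. Qed.

Lemma psd_diag_ge0 A i : psd_mx p A -> 0 <= A i i.
Proof. by move=> [_ A0]; rewrite -quad_form_delta. Qed.

Lemma psd_entry_le_tr A i j : psd_mx p A -> `|A i j| <= \tr A.
Proof.
move=> Apsd; have [AT A0] := Apsd.
have trE k : A k k <= \tr A.
  rewrite /mxtrace (bigD1 k)//= lerDl sumr_ge0// => l _; exact: psd_diag_ge0.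
have eAe k l : dotmx (delta_mx k ord0 : 'cV[R]_p) (A *m delta_mx l ord0) = A k l.
  by rewrite /dotmx trmx_delta mulmxA -rowE -colE !mxE.
have := A0 (delta_mx i ord0 + 1 *: delta_mx j ord0).
have := A0 (delta_mx i ord0 + (-1) *: delta_mx j ord0).
rewrite !quad_formD// !quad_formZ !dotmxZl !quad_form_delta eAe [A j i]symE//.
have := trE i; have := trE j; rewrite ler_norml; lra.
Qed.

End fixed_size.
End pd.

(** * Rank-one perturbations and stretches in the cone *)
Section pd_operations.
Context {R : realType}.

Section fixed_size.
Context (p : nat).
Implicit Types (x y v : 'cV[R]_p) (A B Om : 'M[R]_p).

(** The Schur complement of Om in the direction v: up to the choice of basis
    it is the last pivot of Gaussian elimination.  It is affine along
    Om + u v v^T, which the quadratic form of the inverse is not. *)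
Definition pivot v Om : R := (quad_form (invmx Om) v)^-1.

Lemma pivot_gt0 v Om : pd_mx p Om -> v != 0 -> 0 < pivot v Om.
Proof. by move=> ? ?; rewrite invr_gt0 quad_form_inv_gt0. Qed.

Lemma mxtrace_mul_rank1 Om v : \tr (Om *m (v *m v^T)) = quad_form Om v.
Proof. by rewrite mulmxA mxtrace_mulC /mxtrace big_ord1 quad_form_dot /dotmx. Qed.

Lemma pd_inv_mulmx A B v : pd_mx p A -> A *m (invmx A *m v) = v.
Proof. by move=> /pd_unitmx Au; rewrite mulmxA mulmxV// mul1mx. Qed.

(** Sherman-Morrison and the matrix determinant lemma, together with the fact
    that positive definiteness along the line Om + u v v^T is exactly positivity
    of the pivot. *)
Lemma pd_add_rank1 Om v (u : R) : pd_mx p Om -> v != 0 -> 0 < pivot v Om + u ->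
  [/\ pd_mx p (Om + u *: (v *m v^T)),
      pivot v (Om + u *: (v *m v^T)) = pivot v Om + u &
      \det (Om + u *: (v *m v^T)) = \det Om * ((pivot v Om + u) / pivot v Om)].
Proof.
move=> Opd v0 yu0; have y0 := pivot_gt0 Opd v0; have [OT Ogt] := Opd.
have Ou := pd_unitmx Opd.
set y := pivot v Om in yu0 y0 *; set q := quad_form (invmx Om) v.
have qy : q = y^-1 by rewrite /y /pivot invrK.
pose w := y *: (invmx Om *m v).
have vw : dotmx v w = 1.
  by rewrite dotmxZr -quad_form_dot -/q qy mulfV// gt_eqF.
have E : Om + u *: (v *m v^T) = Om *m stretch_mx w v ((y + u) / y).
  rewrite /stretch_mx mulmxDr mulmx1; congr (_ + _).
  rewrite -scalemxAr mulmxA /w -scalemxAr mulmxA mulmxV// mul1mx -scalemxAl.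
  by rewrite scalerA; congr (_ *: _); field; rewrite gt_eqF.
have pd' : pd_mx p (Om + u *: (v *m v^T)).
  split; first by rewrite linearD/= linearZ/= trmx_mul trmxK OT.
  move=> x x0; rewrite quad_form_addmx quad_form_scalemx quad_form_rank1.
  have := pd_cauchy_schwarz x v Opd; rewrite dotmxC -/q qy => cs.
  have := Ogt _ x0; set qx := quad_form Om x in cs * => qx0.
  have [u0|u0] := leP 0 u.
    by rewrite ltr_wpDr// mulr_ge0// sqr_ge0.
  have : u * (qx * y^-1) <= u * dotmx v x ^+ 2 by rewrite ler_nM2l.
  have : 0 < qx * ((y + u) / y) by rewrite mulr_gt0// divr_gt0.
  rewrite mulrA mulrDr mulrDl mulfK ?gt_eqF//; lra.
split => //; last by rewrite E det_mulmx det_stretch_mx.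
have e1 : invmx (Om + u *: (v *m v^T)) *m v = (y / (y + u)) *: (invmx Om *m v).
  have u' := pd_unitmx pd'.
  have H : (Om + u *: (v *m v^T)) *m (invmx Om *m v) = ((y + u) / y) *: v.
    rewrite mulmxDl mulmxA mulmxV// mul1mx -scalemxAl mul_rank1 -quad_form_dot -/q qy.
    rewrite scalerA -{1}[v]scale1r -scalerDl; congr (_ *: _).
    by field; rewrite gt_eqF.
  rewrite -[RHS](mulKmx u') -scalemxAr H scalerA (_ : _ * _ = 1) ?scale1r//.
  by field; rewrite !gt_eqF.
rewrite {1}/pivot quad_form_dot e1 dotmxZr -quad_form_dot -/q qy.
by field; rewrite !gt_eqF.
Qed.

(** Inversion reverses the Loewner order.  Cauchy-Schwarz for A at
    x = B^-1 v bounds (v' B^-1 v)^2 by (x' A x) (v' A^-1 v), and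
    x' A x <= k v' B^-1 v. *)
Lemma loewner_inv A B k v : pd_mx p A -> pd_mx p B ->
  (forall x, quad_form A x <= k * quad_form B x) ->
  quad_form (invmx B) v <= k * quad_form (invmx A) v.
Proof.
move=> Apd Bpd AB.
have [->|v0] := eqVneq v 0; first by rewrite !quad_form_dot !mulmx0 !dotmx0r mulr0.
have q0 := quad_form_inv_gt0 Bpd v0; set q := quad_form (invmx B) v in q0 *.
have qA0 := quad_form_inv_gt0 Apd v0.
have := pd_cauchy_schwarz (invmx B *m v) v Apd.
rewrite dotmxC -quad_form_dot -/q => H.
have := AB (invmx B *m v).
rewrite [X in _ <= _ * X]quad_form_dot pd_inv_mulmx// dotmxC -quad_form_dot -/q => H'.
rewrite -(ler_pM2l q0) -expr2; apply: (le_trans H).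
by rewrite mulrA [q * k]mulrC ler_pM2r.
Qed.

Section stretch.
Context A v (s : R) (Apd : pd_mx p A) (v0 : v != 0) (s0 : 0 < s).
Let q := quad_form (invmx A) v.
Let q0 : 0 < q. Proof. exact: quad_form_inv_gt0. Qed.

(** Chosen so that M^T A M = A + (s^2 - 1) / q v v^T for the stretch M by s, with
    q = v' A^-1 v: the trace against A then changes only through v' Om v. *)
Definition stretch_dir : 'cV[R]_p := (quad_form (invmx A) v)^-1 *: (invmx A *m v).
Let M := stretch_mx stretch_dir v s.

Lemma dotmx_stretch_dir : dotmx v stretch_dir = 1.
Proof. by rewrite dotmxZr -quad_form_dot mulVf// gt_eqF. Qed.

Lemma stretch_unitmx : M \in unitmx.
Proof.
by rewrite unitmxE det_stretch_mx ?dotmx_stretch_dir// unitfE gt_eqF.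
Qed.

Lemma quad_form_stretch Om : quad_form (congr_mx M Om) v = s ^+ 2 * quad_form Om v.
Proof.
rewrite quad_form_congr (_ : M^T *m v = s *: v) ?quad_formZ//.
rewrite /M /stretch_mx linearD/= linearZ/= trmx1 trmx_mul trmxK mulmxDl mul1mx.
rewrite -scalemxAl mul_rank1 dotmxC dotmx_stretch_dir scale1r -{1}[v]scale1r -scalerDl.
by congr (_ *: _); ring.
Qed.

Lemma det_congr_stretch Om : \det (congr_mx M Om) = s ^+ 2 * \det Om.
Proof.
rewrite /congr_mx !det_mulmx det_tr det_stretch_mx ?dotmx_stretch_dir//; ring.
Qed.

Lemma tr_congr_stretch Om :
  \tr (congr_mx M Om *m A) = \tr (Om *m A) + (s ^+ 2 - 1) / q * quad_form Om v.
Proof.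
have [AT _] := Apd; have Au := pd_unitmx Apd.
have Aw : A *m stretch_dir = q^-1 *: v by rewrite -scalemxAr pd_inv_mulmx.
have E : M^T *m A *m M = A + ((s ^+ 2 - 1) / q) *: (v *m v^T).
  have AM : A *m M = A + ((s - 1) / q) *: (v *m v^T).
    by rewrite mulmxDr mulmx1 -scalemxAr mulmxA Aw -scalemxAl scalerA.
  have MTA : M^T *m A = A + ((s - 1) / q) *: (v *m v^T).
    by rewrite -[LHS]trmxK trmx_mul trmxK AT AM linearD/= linearZ/= trmx_mul trmxK AT.
  rewrite MTA mulmxDl AM -addrA; congr (_ + _).
  rewrite -scalemxAl mulmxDr mulmx1 -scalemxAr mul_rank1_rank1 dotmx_stretch_dir.
  rewrite scale1r scalerDr scalerA -!scalerDl.
  by congr (_ *: _); field; rewrite gt_eqF.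
rewrite /congr_mx -!mulmxA mxtrace_mulC -mulmxA E mulmxDr linearD/= -scalemxAr.
by rewrite linearZ/= mxtrace_mul_rank1.
Qed.

End stretch.
End fixed_size.

(** Completing the square in the first coordinate. *)
Lemma block_mx_pd n (a : R) (w : 'cV[R]_n) (V : 'M[R]_n) :
  pd_mx (1 + n) (block_mx a%:M w^T w V) ->
  [/\ 0 < a, pd_mx n (V - a^-1 *: (w *m w^T)),
   \det (block_mx a%:M w^T w V) = a * \det (V - a^-1 *: (w *m w^T)) &
   forall (x0 : R) (x : 'cV[R]_n),
     quad_form (block_mx a%:M w^T w V) (col_mx x0%:M x) =
     a * (x0 + a^-1 * dotmx w x) ^+ 2 + quad_form (V - a^-1 *: (w *m w^T)) x].
Proof.
set A := block_mx _ _ _ _; set S := V - _ => -[AT Agt].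
have VT : V^T = V by move: AT; rewrite /A tr_block_mx => /eq_block_mx[].
have qE (x0 : R) (x : 'cV[R]_n) :
    quad_form A (col_mx x0%:M x) = a * x0 ^+ 2 + 2 * x0 * dotmx w x + quad_form V x.
  rewrite quad_form_dot /dotmx tr_col_mx mul_block_col mul_row_col tr_scalar_mx.
  rewrite mul_scalar_mx mul_scalar_mx mul_mx_scalar mulmxDr -scalemxAr !dotmxE !mxE.
  by rewrite eqxx !mulr1n [dotmx x w]dotmxC -quad_form_dot; ring.
have a0 : 0 < a.
  have := Agt (col_mx 1%:M 0); rewrite qE dotmx0r quad_form_dot mulmx0 dotmx0r.
  rewrite expr1n mulr1 mulr0 !addr0; apply.
  apply/eqP => /(congr1 (fun M : 'cV_(1 + n) => M (lshift n ord0) ord0)).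
  by rewrite col_mxEu !mxE eqxx => /eqP; rewrite oner_eq0.
have qS (x0 : R) (x : 'cV[R]_n) :
    quad_form A (col_mx x0%:M x) = a * (x0 + a^-1 * dotmx w x) ^+ 2 + quad_form S x.
  rewrite qE quad_form_addmx -scaleNr quad_form_scalemx quad_form_rank1.
  by field; rewrite gt_eqF.
split => //.
- split; first by rewrite linearB/= linearZ/= trmx_mul trmxK VT.
  move=> x x0.
  have := Agt (col_mx (- a^-1 * dotmx w x)%:M x).
  rewrite qS mulNr addNr expr0n/= mulr0 add0r; apply.
  by apply: contra_neq x0; rewrite -col_mx0 => /eq_col_mx[].
have -> : A = block_mx 1%:M 0 (a^-1 *: w) 1%:M *m block_mx a%:M w^T 0 S.
  rewrite mulmx_block !mul1mx !mul0mx !addr0 mul_mx_scalar scalerA mulfV ?gt_eqF//.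
  by rewrite scale1r -scalemxAl addrC subrK.
by rewrite det_mulmx det_lblock !det1 !mul1r det_ublock det_scalar1.
Qed.

End pd_operations.

(** * Gaussian integrals *)
Section gaussian_integral.
Context {R : realType}.
Notation leb := (@lebesgue_measure R).

Lemma pd_blockE n (A : 'M[R]_(1 + n)) : A^T = A ->
  A = block_mx (A ord0 ord0)%:M (dlsubmx A)^T (dlsubmx A) (drsubmx A).
Proof.
move=> AT; rewrite -{1}[A]submxK; congr block_mx.
- by rewrite [LHS]mx11E !mxE; congr (A _ _)%:M; exact/val_inj.
- by rewrite trmx_dlsub AT.
Qed.

Lemma pd_det_gt0 p (A : 'M[R]_p) : pd_mx p A -> 0 < \det A.
Proof.
elim: p A => [|n ih] A Apd; first by rewrite det_mx00.
have [AT _] := Apd; move: Apd; rewrite [A](@pd_blockE n)// => /block_mx_pd[a0 Spd -> _].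
by rewrite mulr_gt0// ih.
Qed.

Lemma integral_gauss_affine (a c : R) : 0 < a ->
  (\int[leb]_x (expR (- 2^-1 * (a * (x + c) ^+ 2)))%:E =
   (Num.sqrt (2 * pi) / Num.sqrt a)%:E)%E.
Proof.
move=> a0; pose s := Num.sqrt (a / 2).
have s0 : 0 < s by rewrite sqrtr_gt0 divr_gt0.
have mg : measurable_fun setT (fun x : R => (gauss_fun x)%:E).
  by apply/measurable_EFinP; exact: measurable_gauss_fun.
have := ge0_integral_affine (s * c) s0 mg (fun x => gauss_fun_ge0 x).
rewrite integralT_gauss => H.
have -> : Num.sqrt (2 * pi) / Num.sqrt a = s^-1 * Num.sqrt pi.
  by rewrite /s !sqrtrM ?ltW// sqrtrV// invfM invrK; ring.
rewrite EFinM -H muleA -EFinM mulVf ?gt_eqF// mul1e.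
apply: eq_integral => x _; rewrite /gauss_fun; congr (expR _)%:E.
rewrite -mulrDr exprMn /s sqr_sqrtr ?divr_ge0 ?ltW//; ring.
Qed.

Definition col_tuple n (t : n.-tuple R) : 'cV[R]_n := \col_i tnth t i.

Lemma col_tuple_cons n x (t : n.-tuple R) :
  col_tuple [tuple of x :: t] = col_mx x%:M (col_tuple t) :> 'cV[R]_(1 + n).
Proof.
apply/matrixP => i j; rewrite !ord1 mxE.
case: (split_ordP i) => k ->.
  by rewrite col_mxEu !ord1 mxE eqxx (_ : lshift n (ord0 : 'I_1) = (ord0 : 'I_n.+1)) ?tnth0//; exact/val_inj.
rewrite col_mxEd mxE (_ : rshift 1 k = (lift ord0 k : 'I_n.+1)) ?tnthS ?mxE//; exact/val_inj.
Qed.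

Lemma measurable_col_tuple n :
  measurable_fun setT (@col_tuple n : n.-tuple (measurableTypeR R) -> 'cV[R]_n).
Proof.
apply: measurable_fun_mx => i j; under eq_fun do rewrite mxE.
exact: measurable_tnth.
Qed.

Lemma measurable_fun_quad_form d (T : measurableType d) n (f : T -> 'M[R]_n)
    (g : T -> 'cV[R]_n) : measurable_fun setT f -> measurable_fun setT g ->
  measurable_fun setT (fun x => quad_form (f x) (g x)).
Proof.
move=> mf mg; apply: (@measurable_fun_entry _ _ _ _ _ (fun x => (g x)^T *m f x *m g x)).
by do 2 apply: measurable_mulmx => //; exact: measurable_trmx.
Qed.

Definition gauss_quad p (A : 'M[R]_p) (t : p.-tuple R) : R :=
  expR (- 2^-1 * quad_form A (col_tuple t)).

Lemma measurable_gauss_quad p A : measurable_fun setT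
  (fun t : p.-tuple (measurableTypeR R) => (gauss_quad A t)%:E).
Proof.
apply/measurable_EFinP; apply: measurableT_comp => //.
apply: measurable_funM => //; apply: measurable_fun_quad_form => //.
exact: measurable_col_tuple.
Qed.

(** Induction on the dimension: completing the square in the first coordinate
    leaves the Gaussian integral of the Schur complement. *)
Lemma integral_gauss_quad p (A : 'M[R]_p) : pd_mx p A ->
  (\int[product_tuple leb p]_t (gauss_quad A t)%:E =
   (Num.sqrt (2 * pi) ^+ p / Num.sqrt (\det A))%:E)%E.
Proof.
elim: p A => [|n ih] A Apd.
  rewrite det_mx00 sqrtr1 invr1 mulr1 /=.
  rewrite integral_dirac//; last exact: measurable_gauss_quad.
  rewrite diracT mul1e /gauss_quad (_ : quad_form _ _ = 0) ?mulr0 ?expR0//.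
  by rewrite /quad_form mxE big_ord0.
rewrite ge0_integral_product_cons; [|exact: measurable_gauss_quad|]; last first.
  by move=> t; rewrite lee_fin expR_ge0.
have [AT _] := Apd.
move: Apd; rewrite [A](@pd_blockE n)//.
set a := A ord0 ord0; set w := dlsubmx _; set V := drsubmx _.
move=> /block_mx_pd[a0 Spd detE qE].
set B := block_mx _ _ _ _ in detE qE *; set S := V - _ in Spd detE qE.
have d0 := pd_det_gt0 Spd.
transitivity (\int[product_tuple leb n]_t ((gauss_quad S t)%:E *
   (Num.sqrt (2 * pi) / Num.sqrt a)%:E))%E; last first.
  rewrite ge0_integralZr//; last 2 first.
  - exact: measurable_gauss_quad.
  - by move=> t _; rewrite lee_fin expR_ge0.
  rewrite ih// -EFinM detE (sqrtrM _ (ltW a0)) exprSr; congr EFin.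
  by field; rewrite !gt_eqF// sqrtr_gt0.
have mG : measurable_fun setT
    (fun z : measurableTypeR R * n.-tuple (measurableTypeR R) =>
      (gauss_quad B [tuple of z.1 :: z.2])%:E).
  apply: (measurableT_comp (@measurable_gauss_quad n.+1 B)).
  exact: measurable_cons.
rewrite (fubini_tonelli (m1 := leb) (m2 := product_tuple leb n) _ mG)//; last first.
  by move=> z; rewrite lee_fin expR_ge0.
apply: eq_integral => t _.
rewrite -(integral_gauss_affine (a^-1 * dotmx w (col_tuple t)) a0).
rewrite -ge0_integralZl//; last 2 first.
- apply/measurable_EFinP; apply: measurableT_comp => //.
  do 2 apply: measurable_funM => //.
  by apply: measurable_funX; exact: measurable_funD.
- by rewrite lee_fin expR_ge0.
apply: eq_integral => x _.
rewrite -EFinM /gauss_quad/= col_tuple_cons qE -expRD; congr (expR _)%:E; ring.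
Qed.

End gaussian_integral.

Lemma measurable_invr {R : realType} : measurable_fun [set: R] (@GRing.inv R).
Proof.
rewrite (_ : GRing.inv = fun x : R => if 0 < x then expR (- ln x) else
  if x < 0 then - expR (- ln (- x)) else 0); last first.
  apply/funext => x; case: ltgtP => [x0|x0|<-]; last by rewrite invr0.
  - by rewrite expRN lnK.
  - by rewrite expRN lnK ?posrE ?oppr_gt0// invrN opprK.
apply: measurable_fun_if => //; first exact: measurable_fun_ltr.
  apply: measurable_funTS; apply: measurableT_comp => //.
  apply: measurableT_comp => //; exact: measurable_ln.
apply: measurable_fun_if => //.
- exact: measurable_fun_ltr.
- exact: measurable_fun_ltr.
apply: measurable_funTS; apply: measurableT_comp => //; apply: measurableT_comp => //.
apply: measurableT_comp => //; apply: measurableT_comp => //; exact: measurable_ln.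
Qed.

(** * Laws determined by invariance under a flow *)
Section flow.
Context {R : realType} d (X : measurableType d) (mu : {sigma_finite_measure set X -> \bar R}).
Notation leb := (@lebesgue_measure R).
Context (K : X -> \bar R) (phi : X -> R).
Hypotheses (mK : measurable_fun setT K) (K0 : forall x, (0 <= K x)%E)
  (mphi : measurable_fun setT phi).

Lemma ge0_integral_reflect (c : R) (F : R -> \bar R) :
  measurable_fun setT F -> (forall x, 0 <= F x)%E ->
  (\int[leb]_x F (c - x)%R = \int[leb]_x F x)%E.
Proof.
move=> mF F0.
have mFN : measurable_fun setT (fun x : R => F (- x)%R).
  by apply: measurableT_comp => //; exact: measurable_funN.
transitivity (\int[leb]_x F (- x)%R)%E.
  rewrite -(ge0_integral_affine (- c) ltr01 mFN)// mul1e.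
  by apply: eq_integral => x _; rewrite mul1r opprB.
have mN : measurable_fun setT (-%R : measurableTypeR R -> measurableTypeR R).
  exact: measurable_funN.
transitivity (\int[image_measure leb mN]_x F x)%E.
  by rewrite (ge0_integral_pushforward mN)// => x _; exact: F0.
by apply: eq_measure_integral => A mA _; exact: lebesgue_measureN.
Qed.

(** If translating phi by u leaves the measure K mu invariant, as long as phi
    stays in I, then its image under phi is proportional to Lebesgue measure
    on I.  The proportionality is stated without dividing, since neither total
    mass is known to be finite: integrate h(phi x) g(phi x + u) over x and u
    in both orders. *)
Lemma translation_flow_swap (I : set R) (h g : R -> \bar R) :
  (forall (u : R) (h g : R -> \bar R), measurable_fun setT h -> measurable_fun setT g ->
     (forall z, 0 <= h z)%E -> (forall z, 0 <= g z)%E ->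
     (forall z, ~ I z -> h z = 0%E) -> (forall z, ~ I z -> g z = 0%E) ->
     \int[mu]_x (K x * (h (phi x) * g (phi x + u)%R)) =
     \int[mu]_x (K x * (h (phi x - u)%R * g (phi x))))%E ->
  measurable_fun setT h -> measurable_fun setT g ->
  (forall z, 0 <= h z)%E -> (forall z, 0 <= g z)%E ->
  (forall z, ~ I z -> h z = 0%E) -> (forall z, ~ I z -> g z = 0%E) ->
  (\int[mu]_x (K x * h (phi x)) * \int[leb]_s g s =
   \int[mu]_x (K x * g (phi x)) * \int[leb]_s h s)%E.
Proof.
move=> inv mh mg h0 g0 hI gI.
have p1 : measurable_fun setT (fst : X * measurableTypeR R -> X) := measurable_fst.
have p2 : measurable_fun setT (snd : X * measurableTypeR R -> measurableTypeR R) := measurable_snd.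
have mphi1 : measurable_fun setT (fun z : X * measurableTypeR R => phi z.1).
  exact: (measurableT_comp mphi p1).
pose H1 (z : X * measurableTypeR R) := (K z.1 * (h (phi z.1) * g (phi z.1 + z.2)%R))%E.
pose H2 (z : X * measurableTypeR R) := (K z.1 * (h (phi z.1 - z.2)%R * g (phi z.1)))%E.
have mH1 : measurable_fun setT H1.
  apply: emeasurable_funM; first exact: (measurableT_comp mK p1).
  apply: emeasurable_funM; first exact: (measurableT_comp mh mphi1).
  by apply: (measurableT_comp mg); exact: measurable_funD.
have mH2 : measurable_fun setT H2.
  apply: emeasurable_funM; first exact: (measurableT_comp mK p1).
  apply: emeasurable_funM; last exact: (measurableT_comp mg mphi1).
  by apply: (measurableT_comp mh); exact: measurable_funB.
have H10 z : (0 <= H1 z)%E by rewrite !mule_ge0.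
have H20 z : (0 <= H2 z)%E by rewrite !mule_ge0.
have mhp : measurable_fun setT (fun x => h (phi x)) by exact: measurableT_comp.
have mgp : measurable_fun setT (fun x => g (phi x)) by exact: measurableT_comp.
transitivity (\int[mu]_x \int[leb]_u H1 (x, u))%E.
  rewrite -ge0_integralZr//; last 3 first.
  - exact: emeasurable_funM.
  - by move=> x _; exact: mule_ge0.
  - exact: integral_ge0.
  apply: eq_integral => x _; rewrite /H1/=.
  rewrite -(ge0_integral_affine (phi x) ltr01 mg)// mul1e.
  rewrite -ge0_integralZl//; last 2 first.
  - by apply: (measurableT_comp mg); apply: measurable_funD => //; exact: measurable_funM.
  - by rewrite mule_ge0.
  by apply: eq_integral => u _; rewrite mul1r addrC muleA.
rewrite (fubini_tonelli (m1 := mu) (m2 := leb) _ mH1)//.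
transitivity (\int[leb]_u \int[mu]_x H2 (x, u))%E.
  by apply: eq_integral => u _; exact: inv.
rewrite -(fubini_tonelli (m1 := mu) (m2 := leb) _ mH2)//.
rewrite -ge0_integralZr//; last 3 first.
- exact: emeasurable_funM.
- by move=> x _; exact: mule_ge0.
- exact: integral_ge0.
apply: eq_integral => x _; rewrite /H2/=.
rewrite -(ge0_integral_reflect (phi x) mh)//.
rewrite -ge0_integralZl//; last 2 first.
- by apply: (measurableT_comp mh); exact: measurable_funB.
- by rewrite mule_ge0.
by apply: eq_integral => u _; rewrite -muleA [(g _ * _)%E]muleC.
Qed.

(** Density of the Haar measure of the multiplicative group of positive reals. *)
Definition mulhaar (s : R) : R := if 0 < s then s^-1 else 0.

Lemma mulhaar_ge0 s : 0 <= mulhaar s.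
Proof. by rewrite /mulhaar; case: ifP => // s0; rewrite invr_ge0 ltW. Qed.

Lemma measurable_mulhaar : measurable_fun setT mulhaar.
Proof.
apply: measurable_fun_if => //; first exact: measurable_fun_ltr.
apply: measurable_funTS; exact: measurable_invr.
Qed.

Lemma mulhaar_integral_scale (t : R) (F : R -> \bar R) : 0 < t ->
  measurable_fun setT F -> (forall x, 0 <= F x)%E ->
  (\int[leb]_s ((mulhaar s)%:E * F (t * s)%R) = \int[leb]_s ((mulhaar s)%:E * F s))%E.
Proof.
move=> t0 mF F0.
have mG : measurable_fun setT (fun s => (mulhaar s)%:E * F s)%E.
  by apply: emeasurable_funM => //; apply/measurable_EFinP; exact: measurable_mulhaar.
rewrite -(ge0_integral_affine 0 t0 mG); last first.
  by move=> s; rewrite mule_ge0// lee_fin mulhaar_ge0.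
rewrite -ge0_integralZl//; last 3 first.
- apply: (measurableT_comp mG); apply: measurable_funD => //; exact: measurable_funM.
- by move=> s _; rewrite mule_ge0// lee_fin mulhaar_ge0.
- by rewrite lee_fin ltW.
apply: eq_integral => s _; rewrite addr0 muleA -EFinM; congr (_%:E * _)%E.
rewrite /mulhaar pmulr_rgt0//; case: ifPn => // _; last by rewrite mulr0.
by rewrite invfM mulVKf// gt_eqF.
Qed.

(** The multiplicative analogue: an image measure invariant under all dilations
    is proportional to the Haar measure. *)
Lemma dilation_flow_swap (h g : R -> \bar R) :
  (forall x, phi x <= 0 -> K x = 0%E) ->
  (forall (s : R) (h : R -> \bar R), 0 < s -> measurable_fun setT h ->
     (forall z, 0 <= h z)%E ->
     (\int[mu]_x (K x * h (s * phi x)%R) = \int[mu]_x (K x * h (phi x)))%E) ->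
  measurable_fun setT h -> measurable_fun setT g ->
  (forall z, 0 <= h z)%E -> (forall z, 0 <= g z)%E ->
  (\int[mu]_x (K x * h (phi x)) * \int[leb]_s ((mulhaar s)%:E * g s) =
   \int[mu]_x (K x * g (phi x)) * \int[leb]_s ((mulhaar s)%:E * h s))%E.
Proof.
move=> phi0 inv.
have p1 : measurable_fun setT (fst : X * measurableTypeR R -> X) := measurable_fst.
have p2 : measurable_fun setT (snd : X * measurableTypeR R -> measurableTypeR R) := measurable_snd.
have mphi1 : measurable_fun setT (fun z : X * measurableTypeR R => phi z.1).
  exact: (measurableT_comp mphi p1).
have mhaar : measurable_fun setT (fun s => (mulhaar s)%:E : \bar R).
  by apply/measurable_EFinP; exact: measurable_mulhaar.
have haar0 s : (0 <= (mulhaar s)%:E :> \bar R)%E by rewrite lee_fin mulhaar_ge0.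
(* Tonelli first gives the identity with the inverse of phi on the right.
   Applying it to h and to g against one function e of Haar integral one
   removes the inverse. *)
suff weil h0 g0 : measurable_fun setT h0 -> measurable_fun setT g0 ->
    (forall z, 0 <= h0 z)%E -> (forall z, 0 <= g0 z)%E ->
    (\int[mu]_x (K x * h0 (phi x)) * \int[leb]_s ((mulhaar s)%:E * g0 s) =
     \int[mu]_x (K x * g0 (phi x)^-1%R) * \int[leb]_s ((mulhaar s)%:E * h0 s))%E.
  move=> mh mg h0 g0.
  pose e (s : R) : \bar R := (s * \1_(`[1, 2]%classic) s)%:E.
  have me : measurable_fun setT e.
    by apply/measurable_EFinP; apply: measurable_funM.
  have e0 s : (0 <= e s)%E.
    rewrite lee_fin /= indicE; case: (boolP (s \in _)); rewrite ?mulr0// mulr1.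
    by rewrite inE/= in_itv/= => /andP[/(le_trans ler01)].
  have e1 : (\int[leb]_s ((mulhaar s)%:E * e s) = 1)%E.
    transitivity (\int[leb]_s (\1_(`[1, 2]%classic : set R) s)%:E)%E.
      apply: eq_integral => s _; rewrite /e -EFinM mulrA; congr EFin.
      rewrite indicE; case: (boolP (s \in _)); rewrite ?mulr0// !mulr1.
      rewrite inE/= in_itv/= => /andP[/(lt_le_trans ltr01) s0 _].
      by rewrite /mulhaar s0 mulVf// gt_eqF.
    rewrite integral_indic//= setIT lebesgue_measure_itv/= lte_fin ltr1n/=.
    by rewrite -EFinD; congr EFin; ring.
  have := weil _ _ mh me h0 e0; rewrite e1 mule1 => ->.
  have := weil _ _ mg me g0 e0; rewrite e1 mule1 => ->.
  by rewrite -!muleA [X in (_ * X)%E]muleC.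
move=> mh mg h00 g00.
have minv (G : R -> \bar R) : measurable_fun setT G -> measurable_fun setT (fun s : R => G s^-1).
  by move=> mG; apply: (measurableT_comp mG); exact: measurable_invr.
pose H1 (z : X * measurableTypeR R) := (K z.1 * ((mulhaar z.2)%:E * g0 z.2 * h0 (z.2 * phi z.1)%R))%E.
pose H2 (z : X * measurableTypeR R) := (K z.1 * ((mulhaar z.2)%:E * g0 (z.2 * (phi z.1)^-1)%R * h0 z.2))%E.
have mhaar2 := measurableT_comp mhaar p2.
have mH1 : measurable_fun setT H1.
  apply: emeasurable_funM; first exact: (measurableT_comp mK p1).
  apply: emeasurable_funM.
    by apply: emeasurable_funM => //; exact: (measurableT_comp mg p2).
  by apply: (measurableT_comp mh); exact: measurable_funM.
have mphiV1 : measurable_fun setT (fun z : X * measurableTypeR R => (phi z.1)^-1).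
  by apply: measurableT_comp => //; exact: measurable_invr.
have mH2 : measurable_fun setT H2.
  apply: emeasurable_funM; first exact: (measurableT_comp mK p1).
  apply: emeasurable_funM; last exact: (measurableT_comp mh p2).
  apply: emeasurable_funM => //.
  by apply: (measurableT_comp mg); exact: measurable_funM.
have H10 z : (0 <= H1 z)%E by rewrite !mule_ge0.
have H20 z : (0 <= H2 z)%E by rewrite !mule_ge0.
have mhp : measurable_fun setT (fun x => h0 (phi x)) by exact: measurableT_comp.
have mgp : measurable_fun setT (fun x => g0 (phi x)^-1) by apply: (measurableT_comp (minv _ mg)).
have Kpos x : K x != 0%E -> 0 < phi x.
  by move=> Kx; rewrite ltNge; apply: contra Kx => /phi0 ->.
transitivity (\int[leb]_s \int[mu]_x H1 (x, s))%E.
  rewrite -ge0_integralZl//; last 3 first.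
  - exact: emeasurable_funM.
  - by move=> s _; exact: mule_ge0.
  - by apply: integral_ge0 => x _; exact: mule_ge0.
  apply: eq_integral => s _.
  have [s0|s0] := ltP 0 s; last first.
    rewrite /mulhaar ltNge s0/= mul0e mule0; apply/esym.
    apply: integral0_eq => x _.
    by rewrite /H1/= /mulhaar ltNge s0/= !mul0e mule0.
  rewrite -(inv s h0)// -ge0_integralZr//; last 3 first.
  - apply: emeasurable_funM => //; apply: (measurableT_comp mh).
    exact: measurable_funM.
  - by move=> x _; exact: mule_ge0.
  - exact: mule_ge0.
  by apply: eq_integral => x _; rewrite /H1/= -muleA [(h0 _ * _)%E]muleC.
rewrite -(fubini_tonelli (m1 := mu) (m2 := leb) _ mH1)//.
transitivity (\int[mu]_x \int[leb]_s H2 (x, s))%E.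
  apply: eq_integral => x _.
  have [Kx|/Kpos px] := eqVneq (K x) 0%E.
    by rewrite /H1 /H2/= Kx; under eq_integral do rewrite mul0e;
       under [RHS]eq_integral do rewrite mul0e.
  rewrite /H1 /H2/= ge0_integralZl//; last 2 first.
  - apply: emeasurable_funM; first exact: emeasurable_funM.
    by apply: (measurableT_comp mh); exact: measurable_funM.
  - by move=> s _; rewrite !mule_ge0.
  rewrite ge0_integralZl//; last 2 first.
  - apply: emeasurable_funM => //; apply: emeasurable_funM => //.
    by apply: (measurableT_comp mg); exact: measurable_funM.
  - by move=> s _; rewrite !mule_ge0.
  congr (_ * _)%E.
  have := @mulhaar_integral_scale (phi x) (fun z => g0 (z * (phi x)^-1)%R * h0 z)%E px.
  move=> scale.
  transitivity (\int[leb]_s ((mulhaar s)%:E * (g0 (phi x * s * (phi x)^-1)%R * h0 (phi x * s)%R)))%E.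
    apply: eq_integral => s _; rewrite muleA; congr (_ * g0 _ * h0 _)%E; last exact: mulrC.
    by rewrite mulrAC mulfV ?mul1r// gt_eqF.
  rewrite scale.
  - by apply: eq_integral => s _; rewrite muleA.
  - apply: emeasurable_funM => //.
    by apply: (measurableT_comp mg); exact: measurable_funM.
  - by move=> z; exact: mule_ge0.
rewrite (fubini_tonelli (m1 := mu) (m2 := leb) _ mH2)//.
rewrite -ge0_integralZl//; last 3 first.
- exact: emeasurable_funM.
- by move=> s _; exact: mule_ge0.
- by apply: integral_ge0 => x _; exact: mule_ge0.
apply: eq_integral => s _.
have [s0|s0] := ltP 0 s; last first.
  rewrite /mulhaar ltNge s0/= mul0e mule0.
  apply: integral0_eq => x _.
  by rewrite /H2/= /mulhaar ltNge s0/= !mul0e mule0.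
have sV0 : 0 < s^-1 by rewrite invr_gt0.
rewrite -(inv s^-1 (fun z => g0 z^-1))//; last exact: minv.
rewrite -ge0_integralZr//; last 3 first.
- apply: emeasurable_funM => //; apply: (measurableT_comp (minv _ mg)).
  exact: measurable_funM.
- by move=> x _; exact: mule_ge0.
- exact: mule_ge0.
apply: eq_integral => x _; rewrite /H2/= invfM invrK.
by rewrite -!muleA; congr (_ * _)%E; rewrite muleCA.
Qed.

End flow.

(** * The Wishart-type density and the law of the pivot *)
Section cone.
Context {R : realType} (p : nat).
Notation leb := (@lebesgue_measure R).
Notation lsym := (@lebesgue_sym R p).
Implicit Types (v : 'cV[R]_p) (A Om : 'M[R]_p).

Lemma measurable_invmx d (T : measurableType d) (f : T -> 'M[R]_p) :
  measurable_fun setT f -> measurable_fun setT (fun x => invmx (f x)).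
Proof.
move=> mf; rewrite /invmx.
have mdet : measurable_fun setT (fun x => \det (f x)).
  exact: measurableT_comp (@measurable_det R p) mf.
apply: measurable_fun_if => //.
- rewrite [X in measurable_fun _ X](_ : _ = fun x => \det (f x) != 0); last first.
    by apply/funext => x; rewrite unitmxE unitfE.
  by apply: measurable_neg; exact: measurable_fun_eqr.
- apply: measurable_funTS; apply: measurable_scalemx.
    by apply: measurableT_comp => //; exact: measurable_invr.
  apply: measurable_fun_mx => i j; under eq_fun do rewrite mxE.
  apply: measurable_funM => //.
  apply: (measurableT_comp (@measurable_det R p.-1)).
  apply: measurable_fun_mx => k l; under eq_fun do rewrite !mxE.
  exact: measurable_fun_entry.
- exact: measurable_funTS.
Qed.

Lemma measurable_pd_mx : measurable (@pd_mx R p).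
Proof.
rewrite (_ : pd_mx p = psd_mx p `&` (fun M : 'M[R]_p => \det M) @^-1` (~` [set 0])).
  apply: measurableI; first exact: measurable_psd_mx.
  by rewrite -[X in measurable X]setTI; apply: measurable_det => //; exact: measurableC.
apply/seteqP; split => M /=.
  by move=> Mpd; split; [exact: pd_psd|apply/eqP; rewrite gt_eqF// pd_det_gt0].
by move=> [Mpsd /eqP d0]; exact: psd_det_neq0.
Qed.

Lemma measurable_pivot v : measurable_fun setT (pivot v : 'M[R]_p -> R).
Proof.
apply: (measurableT_comp (@measurable_invr R)).
by apply: measurable_fun_quad_form => //; exact: measurable_invmx.
Qed.

(** Unnormalized Wishart-type density of exponent al and scale A, extended by
    zero outside the open cone. *)
Definition cone_dens (al : R) A Om : R :=
  \1_(pd_mx p) Om * expR (al * ln (\det Om) - 2^-1 * \tr (Om *m A)).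

Lemma cone_dens_ge0 al A Om : 0 <= cone_dens al A Om.
Proof. by rewrite mulr_ge0 ?expR_ge0. Qed.

Lemma measurable_indic_pd : measurable_fun setT (\1_(pd_mx p) : 'M[R]_p -> R).
Proof. by apply: measurable_indic; exact: measurable_pd_mx. Qed.

Lemma measurable_log_dens al A : measurable_fun setT
  (fun Om : 'M[R]_p => al * ln (\det Om) - 2^-1 * \tr (Om *m A)).
Proof.
apply: measurable_funB; apply: measurable_funM => //.
  by apply: measurableT_comp => //; exact: measurable_det.
apply: (measurableT_comp (@measurable_tr R p)); exact: measurable_mulmx.
Qed.

Lemma measurable_cone_dens al A : measurable_fun setT (cone_dens al A).
Proof.
apply: measurable_funM; first exact: measurable_indic_pd.
by apply: measurableT_comp => //; exact: measurable_log_dens.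
Qed.

(** Unnormalized gamma density, with shape a + 1 and rate c. *)
Definition gamma_dens (a c s : R) : R := \1_(`]0, +oo[%classic) s * expR (a * ln s - c * s).

Lemma gamma_dens_ge0 a c s : 0 <= gamma_dens a c s.
Proof. by rewrite mulr_ge0 ?expR_ge0. Qed.

Lemma gamma_dens_le0 a c s : ~ (0 < s) -> gamma_dens a c s = 0.
Proof.
by move=> s0; rewrite /gamma_dens indicE memNset ?mul0r//= in_itv/= andbT.
Qed.

Lemma gamma_dens_gt0 a c s : 0 < s -> gamma_dens a c s = expR (a * ln s - c * s).
Proof.
by move=> s0; rewrite /gamma_dens indicE mem_set ?mul1r//= in_itv/= andbT.
Qed.

Lemma measurable_gamma_dens a c : measurable_fun setT (gamma_dens a c).
Proof.
apply: measurable_funM => //; apply: measurableT_comp => //.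
apply: measurable_funB; apply: measurable_funM => //; exact: measurable_ln.
Qed.

(** K is the density divided by the claimed gamma factor.  It is constant along
    the lines Om + u v v^T, on which Lebesgue measure is invariant and the
    pivot moves at unit speed, so the image of K under the pivot is
    proportional to Lebesgue measure on the half-line. *)
Lemma pivot_law al A v (h : R -> \bar R) : v != 0 ->
  measurable_fun setT h -> (forall z, 0 <= h z)%E ->
  let c := 2^-1 * quad_form A v in
  (\int[lsym]_Om ((cone_dens al A Om)%:E * h (pivot v Om)) *
     \int[leb]_s (gamma_dens al c s)%:E =
   \int[lsym]_Om (cone_dens al A Om)%:E *
     \int[leb]_s ((gamma_dens al c s)%:E * h s))%E.
Proof.
move=> v0 mh h0 c.
pose L Om := al * ln (\det Om) - 2^-1 * \tr (Om *m A)
  - (al * ln (pivot v Om) - c * pivot v Om).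
pose K Om : \bar R := (\1_(pd_mx p) Om * expR (L Om))%:E.
have mpivot := measurable_pivot v.
have mK : measurable_fun setT K.
  apply/measurable_EFinP; apply: measurable_funM; first exact: measurable_indic_pd.
  apply: measurableT_comp => //; apply: measurable_funB; first exact: measurable_log_dens.
  by apply: measurable_funB; apply: measurable_funM => //;
     apply: measurableT_comp => //; exact: measurable_ln.
have K0 Om : (0 <= K Om)%E by rewrite lee_fin mulr_ge0 ?expR_ge0.
have KN Om : ~ pd_mx p Om -> K Om = 0%E.
  by move=> nOm; rewrite /K indicE memNset// mul0r.
have Kpd Om : pd_mx p Om -> K Om = (expR (L Om))%:E.
  by move=> nOm; rewrite /K indicE mem_set// mul1r.
have mg : measurable_fun setT (fun s => (gamma_dens al c s)%:E).
  apply/measurable_EFinP; exact: measurable_gamma_dens.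
have gam0 s : (0 <= (gamma_dens al c s)%:E)%E by rewrite lee_fin gamma_dens_ge0.
have Kg Om (x : \bar R) : (K Om * ((gamma_dens al c (pivot v Om))%:E * x) =
    (cone_dens al A Om)%:E * x)%E.
  rewrite muleA; congr (_ * _)%E; rewrite /cone_dens.
  have [Opd|nO] := pselect (pd_mx p Om); last first.
    by rewrite KN// mul0e indicE memNset// mul0r.
  rewrite Kpd// gamma_dens_gt0 ?pivot_gt0// -EFinM -expRD indicE mem_set// mul1r.
  by congr (expR _)%:E; rewrite /L; ring.
(* the gamma factor is designed to make K constant along the flow *)
have shift u Om : pd_mx p Om -> 0 < pivot v Om + u ->
    K (Om + u *: (v *m v^T)) = K Om.
  move=> Opd yu0; have [pd' piv' det'] := pd_add_rank1 Opd v0 yu0.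
  have y0 := pivot_gt0 Opd v0.
  rewrite !Kpd//; congr (expR _)%:E; rewrite /L piv' det'.
  rewrite lnM ?posrE ?pd_det_gt0 ?divr_gt0// ln_div ?posrE//.
  have trE : \tr (v *m v^T *m A) = quad_form A v.
    by rewrite mxtrace_mulC mxtrace_mul_rank1.
  rewrite mulmxDl mxtraceD -scalemxAl mxtraceZ trE /c.
  by field.
have swap := @translation_flow_swap R _ _ lsym K (pivot v) mK K0 mpivot `]0, +oo[%classic.
transitivity ((\int[lsym]_Om (K Om * ((gamma_dens al c (pivot v Om))%:E * h (pivot v Om)))
   * \int[leb]_s (gamma_dens al c s)%:E)%E).
  by congr (_ * _)%E; apply: eq_integral => Om _; rewrite Kg.
rewrite (swap (fun s => (gamma_dens al c s)%:E * h s)%E (fun s => (gamma_dens al c s)%:E)); first last.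
- by move=> z /=; rewrite in_itv/= andbT => z0; rewrite gamma_dens_le0.
- by move=> z /=; rewrite in_itv/= andbT => z0; rewrite gamma_dens_le0// mul0e.
- by [].
- by move=> z; rewrite mule_ge0.
- by [].
- exact: emeasurable_funM.
- move=> u h1 g1 mh1 mg1 h10 g10 h1N g1N.
  rewrite -[RHS](@lebesgue_sym_translate _ _ (u *: (v *m v^T))); last 3 first.
  - by rewrite linearZ/= trmx_mul trmxK.
  - apply: emeasurable_funM => //; apply: emeasurable_funM.
      by apply: (measurableT_comp mh1); exact: measurable_funB.
    exact: measurableT_comp.
  - by move=> Om; rewrite !mule_ge0.
  apply: eq_integral => Om _.
  have back : pd_mx p (Om + u *: (v *m v^T)) ->
      0 < pivot v (Om + u *: (v *m v^T)) - u ->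
      pd_mx p Om /\ pivot v Om = pivot v (Om + u *: (v *m v^T)) - u.
    move=> Opd' /(pd_add_rank1 Opd' v0)[].
    by rewrite scaleNr addrK.
  have [Opd|nO] := pselect (pd_mx p Om).
    have y0 := pivot_gt0 Opd v0.
    have [yu0|yu0] := ltP 0 (pivot v Om + u).
      have [pd' piv' _] := pd_add_rank1 Opd v0 yu0.
      by rewrite shift// piv' addrK.
    rewrite (g1N (pivot v Om + u)) ?mule0; last by rewrite /= in_itv/= andbT; apply/negP; rewrite -leNgt.
    have [Opd'|nO'] := pselect (pd_mx p (Om + u *: (v *m v^T))); last by rewrite KN// mul0e.
    rewrite (h1N (pivot v _ - u)) ?mul0e ?mule0//= in_itv/= andbT => yu.
    have [_ E] := back Opd' yu.
    have := pivot_gt0 Opd' v0; move: yu0; rewrite E subrK => /le_lt_trans /[apply].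
    by rewrite ltxx.
  rewrite KN// mul0e.
  have [Opd'|nO'] := pselect (pd_mx p (Om + u *: (v *m v^T))); last by rewrite KN// mul0e.
  rewrite (h1N (pivot v _ - u)) ?mul0e ?mule0//= in_itv/= andbT => yu.
  by have [] := back Opd' yu.
congr (_ * _)%E; apply: eq_integral => Om _.
by have := Kg Om 1%E; rewrite !mule1.
Qed.

End cone.

(** * The cone and its boundary under Lebesgue measure *)
Section cone_measure.
Context {R : realType} (p : nat).
Notation leb := (@lebesgue_measure R).
Notation lsym := (@lebesgue_sym R p).
Implicit Types (v : 'cV[R]_p) (A Om : 'M[R]_p).

Lemma psd_add_scalar Om (r : R) : psd_mx p Om -> 0 < r -> pd_mx p (Om + r%:M).
Proof.
move=> [OT O0] r0; split; first by rewrite linearD/= tr_scalar_mx OT.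
move=> x x0; rewrite -scalemx1 quad_form_addmx quad_form_scalemx quad_form1.
by rewrite ltr_wpDl// mulr_gt0// dotmx_gt0.
Qed.

(** Each line M + r I meets the boundary in at most one point, and Lebesgue
    measure is invariant along these lines; Tonelli then forces
    +oo times the measure of the boundary to vanish. *)
Lemma psd_boundary_null : lsym (psd_mx p `\` pd_mx p) = 0%E.
Proof.
set Bd := psd_mx p `\` pd_mx p.
have mBd : measurable Bd.
  by apply: measurableD; [exact: measurable_psd_mx|exact: measurable_pd_mx].
pose F (z : 'M[R]_p * measurableTypeR R) : \bar R := (\1_Bd (z.1 + z.2%:M))%:E.
have mind : measurable_fun setT (fun M => (\1_Bd M)%:E : \bar R).
  by apply/measurable_EFinP.
have mF : measurable_fun setT F.
  apply: (measurableT_comp mind); apply: measurable_addmx; first exact: measurable_fst.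
  under eq_fun do rewrite -scalemx1.
  by apply: measurable_scalemx => //; exact: measurable_snd.
have F0 z : (0 <= F z)%E by rewrite lee_fin.
have := fubini_tonelli (m1 := lsym) (m2 := leb) _ mF F0.
rewrite [LHS]integral0_eq; last first.
  move=> M _; have [[r Mr]|nr] := pselect (exists r : R, Bd (M + r%:M)); last first.
    by apply: integral0_eq => r _; rewrite /F/= indicE memNset// => Br; apply: nr; exists r.
  transitivity (\int[leb]_s (\1_([set r] : set R) s)%:E)%E; last first.
    by rewrite integral_indic//= setIT lebesgue_measure_set1.
  apply: eq_integral => s _; rewrite /F/= !indicE.
  have [->|sr] := eqVneq s r; first by rewrite !mem_set.
  rewrite [in RHS]memNset; last by move/eqP: sr.
  rewrite memNset// => Ms.
  have Msr : M + s%:M = (M + r%:M) + (s - r)%:M by rewrite -addrA -raddfD/= addrCA subrr addr0.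
  have Mrs : M + r%:M = (M + s%:M) + (r - s)%:M by rewrite -addrA -raddfD/= addrCA subrr addr0.
  move: sr; rewrite neq_lt => /orP[sr|rs].
    by case: Mr => _; apply; rewrite Mrs; apply: psd_add_scalar; [exact: Ms.1|rewrite subr_gt0].
  by case: Ms => _; apply; rewrite Msr; apply: psd_add_scalar; [exact: Mr.1|rewrite subr_gt0].
under eq_integral => r _.
  rewrite /F/= (@lebesgue_sym_translate _ _ _ (fun M => (\1_Bd M)%:E))//; last exact: tr_scalar_mx.
  rewrite integral_indic// setIT.
  over.
rewrite integral_cst//= -set_itvNyy lebesgue_measure_itv/=.
have := measure_ge0 lsym Bd; rewrite le_eqVlt => /predU1P[<-//|B0].
by rewrite gt0_muley.
Qed.

Lemma sym_add_scalar_pd A : A^T = A -> exists k : nat, pd_mx p (A + k%:R%:M).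
Proof.
move=> AT; pose c := \sum_j \sum_i `|A i j|.
have c0 : 0 <= c by do 2 apply: sumr_ge0 => ? _.
exists (Num.truncn c).+1; split; first by rewrite linearD/= tr_scalar_mx AT.
move=> x x0; rewrite -scalemx1 quad_form_addmx quad_form_scalemx quad_form1.
have x2 := dotmx_gt0 x0.
have ck : c < (Num.truncn c).+1%:R by exact: truncnS_gt.
apply: (@lt_le_trans _ _ (((Num.truncn c).+1%:R - c) * dotmx x x)).
  by rewrite mulr_gt0// subr_gt0.
rewrite mulrBl addrC lerD2r lerNl quad_formE -sumrN mulr_suml.
apply: ler_sum => j _; rewrite -mulNr -sumrN !mulr_suml; apply: ler_sum => i _.
have xx : `|x i ord0 * x j ord0| <= dotmx x x.
  have le_dot k : x k ord0 ^+ 2 <= dotmx x x.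
    rewrite dotmx_sumE (bigD1 k)//= -expr2 lerDl sumr_ge0// => l _.
    by rewrite -expr2 sqr_ge0.
  have := le_dot i; have := le_dot j.
  have := sqr_ge0 (x i ord0 - x j ord0); have := sqr_ge0 (x i ord0 + x j ord0).
  rewrite ler_norml; nra.
apply: (le_trans (ler_norm _)).
rewrite (_ : `|_| = `|A i j| * `|x i ord0 * x j ord0|); last first.
  by rewrite !normrM normrN normrM; ring.
by rewrite ler_wpM2l.
Qed.

(** The translates of the cone by - k I cover all symmetric matrices. *)
Lemma pd_measure_gt0 : (0 < lsym (pd_mx p))%E.
Proof.
rewrite lt_neqAle measure_ge0 andbT eq_sym; apply/negP => /eqP pd0.
pose T k : set 'M[R]_p := (fun M => M + k%:R%:M) @^-1` pd_mx p.
have mpd := @measurable_pd_mx R p.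
have mT k : measurable (T k).
  rewrite -[X in measurable X]setTI; apply: (_ : measurable_fun setT _) => //.
  exact: measurable_addmx.
have T0 k : lsym (T k) = 0%E.
  transitivity (\int[lsym]_M (\1_(pd_mx p) (M + k%:R%:M))%:E)%E.
    by rewrite -{1}[T k]setIT -integral_indic.
  rewrite (@lebesgue_sym_translate _ _ _ (fun M => (\1_(pd_mx p) M)%:E))//.
  - by rewrite integral_indic// setIT.
  - exact: tr_scalar_mx.
  - by apply/measurable_EFinP; exact: measurable_indic.
have mU : measurable (\bigcup_k T k) by exact: bigcupT_measurable.
have := @lebesgue_sym_setT_gt0 R p.
suff -> : lsym setT = 0%E by rewrite ltxx.
have -> : lsym setT = lsym (\bigcup_k T k).
  have := @eq_integral_lebesgue_sym R p (fun M => (\1_setT M)%:E)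
    (fun M => (\1_(\bigcup_k T k) M)%:E).
  rewrite !integral_indic// !setIT; apply => //.
  - exact/measurable_EFinP.
  - exact/measurable_EFinP.
  move=> M MT; rewrite !indicE !mem_set//.
  by have [k Mk] := sym_add_scalar_pd MT; exists k.
apply/eqP; rewrite eq_le measure_ge0 andbT.
have := measure_sigma_subadditive lsym mT mU (@subset_refl _ _).
by move=> /le_trans; apply; rewrite eseries0// => k _ _; exact: T0.
Qed.

Lemma cone_dens_gt0 al A : (0 < \int[lsym]_Om (cone_dens al A Om)%:E)%E.
Proof.
rewrite lt_neqAle eq_sym integral_ge0 ?andbT; last by move=> *; rewrite lee_fin cone_dens_ge0.
apply/negP => /eqP I0.
have mc : measurable_fun setT (fun Om => (cone_dens al A Om)%:E).
  by apply/measurable_EFinP; exact: measurable_cone_dens.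
have : (\int[lsym]_Om `|(cone_dens al A Om)%:E|%E = 0)%E.
  rewrite -I0; apply: eq_integral => Om _.
  by rewrite gee0_abs// lee_fin cone_dens_ge0.
move=> /(ae_eq_integral_abs lsym measurableT mc).
move=> [N [mN N0 sub]].
have := pd_measure_gt0; rewrite lt_neqAle eq_sym => /andP[/negP + _]; apply.
rewrite -measure_le0 -N0 le_measure ?inE//; first exact: measurable_pd_mx.
move=> Om Opd; apply: sub => /= /(_ I) /eqP.
by rewrite eqe /cone_dens indicE mem_set// mul1r gt_eqF// expR_gt0.
Qed.

End cone_measure.

(** * The law of a quadratic form *)
Section stretch_laws.
Context {R : realType} (p : nat).
Notation leb := (@lebesgue_measure R).
Notation lsym := (@lebesgue_sym R p).
Implicit Types (v : 'cV[R]_p) (A Om : 'M[R]_p).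

Lemma pd_congr_iff (B Om : 'M[R]_p) : B \in unitmx ->
  pd_mx p (congr_mx B Om) <-> pd_mx p Om.
Proof.
move=> Bu; split; last exact: pd_congr.
have B'u : invmx B \in unitmx by rewrite unitmx_inv.
by move=> /(pd_congr B'u); rewrite -congr_mxM mulVmx// congr_mx1.
Qed.

Lemma cone_dens_stretch al A v s Om : pd_mx p A -> v != 0 -> 0 < s ->
  cone_dens al A (congr_mx (stretch_mx (stretch_dir A v) v s) Om) =
  cone_dens al A Om * expR (2 * al * ln s -
    2^-1 * ((s ^+ 2 - 1) / quad_form (invmx A) v * quad_form Om v)).
Proof.
move=> Apd v0 s0; rewrite /cone_dens.
have Su := stretch_unitmx Apd v0 s0.
have [Opd|nO] := pselect (pd_mx p Om); last first.
  by rewrite !indicE memNset ?memNset ?mul0r// => /(pd_congr_iff _ Su).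
rewrite !indicE !mem_set//; last exact: pd_congr.
rewrite !mul1r -expRD; congr expR.
rewrite det_congr_stretch// tr_congr_stretch//.
rewrite lnM ?posrE ?exprn_gt0 ?pd_det_gt0// lnXn//.
by rewrite -mulr_natl; field; rewrite gt_eqF// quad_form_inv_gt0.
Qed.

(** K is the density divided by its Haar-gamma factor.  A stretch along v by r
    multiplies v' Om v by r^2, its Jacobian and the change of the density being
    absorbed by K, so the image of K is dilation invariant. *)
Lemma quad_law al A v (h : R -> \bar R) : pd_mx p A -> v != 0 ->
  measurable_fun setT h -> (forall z, 0 <= h z)%E ->
  let c := (2 * quad_form (invmx A) v)^-1 in
  let al' := al + (p.+1)%:R / 2 - 1 in
  (\int[lsym]_Om ((cone_dens al A Om)%:E * h (quad_form Om v)) *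
     \int[leb]_s (gamma_dens al' c s)%:E =
   \int[lsym]_Om (cone_dens al A Om)%:E *
     \int[leb]_s ((gamma_dens al' c s)%:E * h s))%E.
Proof.
move=> Apd v0 mh h0 c al'.
have q0 := quad_form_inv_gt0 Apd v0.
pose L t := c * t - (al' + 1) * ln t.
pose K Om : \bar R := (cone_dens al A Om * expR (L (quad_form Om v)))%:E.
have mL : measurable_fun setT L.
  by apply: measurable_funB; apply: measurable_funM => //; exact: measurable_ln.
have mK : measurable_fun setT K.
  apply/measurable_EFinP; apply: measurable_funM; first exact: measurable_cone_dens.
  apply: measurableT_comp => //; apply: (measurableT_comp mL).
  exact: measurable_quad_form.
have K0 Om : (0 <= K Om)%E by rewrite lee_fin mulr_ge0 ?expR_ge0// cone_dens_ge0.
pose e t : \bar R := (expR (- L t))%:E.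
have me : measurable_fun setT e.
  by apply/measurable_EFinP; do 2 apply: measurableT_comp => //.
have e0 t : (0 <= e t)%E by rewrite lee_fin expR_ge0.
have Ke Om : (K Om * e (quad_form Om v) = (cone_dens al A Om)%:E)%E.
  by rewrite -EFinM -mulrA -expRD addrN expR0 mulr1.
have haare s : ((mulhaar s)%:E * e s = (gamma_dens al' c s)%:E)%E.
  rewrite -EFinM /mulhaar; case: ifPn => [s0|/negP s0]; last by rewrite mul0r gamma_dens_le0.
  rewrite gamma_dens_gt0// -{1}(lnK s0) -expRN -expRD; congr (expR _)%:E.
  by rewrite /L; ring.
have phi0 Om : quad_form Om v <= 0 -> K Om = 0%E.
  move=> Ov; rewrite /K /cone_dens indicE memNset ?mul0r//.
  by case=> _ /(_ _ v0); rewrite ltNge Ov.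
have inv (s : R) (h1 : R -> \bar R) : 0 < s -> measurable_fun setT h1 ->
     (forall z, 0 <= h1 z)%E ->
     (\int[lsym]_Om (K Om * h1 (s * quad_form Om v)%R) =
      \int[lsym]_Om (K Om * h1 (quad_form Om v)))%E.
  move=> s0 mh1 h10.
  pose r := Num.sqrt s.
  have r0 : 0 < r by rewrite sqrtr_gt0.
  have r2 : r ^+ 2 = s by rewrite sqr_sqrtr// ltW.
  have mF : measurable_fun setT (fun Om => K Om * h1 (quad_form Om v))%E.
    apply: emeasurable_funM => //; apply: (measurableT_comp mh1).
    exact: measurable_quad_form.
  have F0 Om : (0 <= K Om * h1 (quad_form Om v))%E by exact: mule_ge0.
  rewrite -(lebesgue_sym_stretch (dotmx_stretch_dir Apd v0) r0 mF F0).
  set S := stretch_mx _ _ _.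
  have mFS : measurable_fun setT (fun Om => K (congr_mx S Om) *
      h1 (quad_form (congr_mx S Om) v))%E.
    by apply: (measurableT_comp mF); exact: measurable_congr_mx.
  have rp0 : (0 <= (r ^+ p.+1)%:E :> \bar R)%E by rewrite lee_fin exprn_ge0// ltW.
  rewrite -(ge0_integralZl _ measurableT mFS (fun Om _ => F0 _) rp0).
  apply: eq_integral => Om _.
  rewrite muleA quad_form_stretch// r2; congr (_ * _)%E.
  rewrite -EFinM /K cone_dens_stretch// quad_form_stretch// r2.
  have [Ov|Ov] := leP (quad_form Om v) 0.
    rewrite (_ : cone_dens al A Om = 0) ?mul0r ?mulr0//.
    rewrite /cone_dens indicE memNset ?mul0r//.
    by case=> _ /(_ _ v0); rewrite ltNge Ov.
  rewrite -{1}(lnK (r0 : r \in Num.pos)) -expRM_natl -mulrA -expRD mulrCA -expRD.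
  congr (_ * expR _)%:E; rewrite /L /al' /c lnM// -r2 lnXn//.
  rewrite -[ln r *+ 2]mulr_natl; field; rewrite gt_eqF//.
have := @dilation_flow_swap R _ _ lsym K _ mK K0 (measurable_quad_form v)
  (fun t => e t * h t)%E e phi0 inv.
move=> /(_ (emeasurable_funM me mh) me (fun z => mule_ge0 (e0 z) (h0 z)) e0).
under eq_integral do rewrite muleA Ke.
move=> swap.
transitivity (\int[lsym]_Om ((cone_dens al A Om)%:E * h (quad_form Om v)) *
  \int[leb]_s ((mulhaar s)%:E * e s))%E.
  by congr (_ * _)%E; apply: eq_integral => s _; rewrite haare.
rewrite swap; congr (_ * _)%E; apply: eq_integral => s _; [exact: Ke|].
by rewrite muleA haare.
Qed.

(** Replacing the scale I by I + x x^T is undone by the stretch along x with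
    factor sqrt(1 + |x|^2); the constant is its Jacobian. *)
Lemma cone_rank1_tilt (x : 'cV[R]_p) :
  ((Num.sqrt (1 + dotmx x x) ^+ p.+1)%:E *
   \int[lsym]_Om (cone_dens 0 1%:M Om * expR (- 2^-1 * quad_form Om x))%:E =
   \int[lsym]_Om (cone_dens 0 1%:M Om)%:E)%E.
Proof.
have [->|x0] := eqVneq x 0.
  rewrite dotmx0r addr0 sqrtr1 expr1n mul1e; apply: eq_integral => Om _.
  by rewrite quad_form_dot mulmx0 dotmx0r mulr0 expR0 mulr1.
have Ipd : pd_mx p (1%:M : 'M[R]_p).
  by split; [exact: trmx1|move=> y y0; rewrite quad_form1 dotmx_gt0].
have x2 := dotmx_gt0 x0.
set s := Num.sqrt _.
have s0 : 0 < s by rewrite sqrtr_gt0; lra.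
have mF : measurable_fun setT (fun Om : 'M[R]_p => (cone_dens 0 1%:M Om)%:E).
  by apply/measurable_EFinP; exact: measurable_cone_dens.
have F0 Om : (0 <= (cone_dens 0 1%:M Om)%:E :> \bar R)%E by rewrite lee_fin cone_dens_ge0.
rewrite -[RHS](lebesgue_sym_stretch (dotmx_stretch_dir Ipd x0) s0 mF F0).
congr (_ * _)%E; apply: eq_integral => Om _; rewrite cone_dens_stretch//.
congr (_ * expR _)%:E; rewrite mulr0 mul0r add0r sqr_sqrtr; last by lra.
by rewrite invmx1 quad_form1; field; rewrite gt_eqF.
Qed.

End stretch_laws.

(** * Integrable weights with polynomial decay *)
Section cauchy_weight.
Context {R : realType}.
Notation leb := (@lebesgue_measure R).

(** The function (1 + x^2)^(- be). *)
Definition cauchy_weight (be x : R) : R := expR (- be * ln (1 + x ^+ 2)).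

Lemma cauchy_weight_ge0 be x : 0 <= cauchy_weight be x.
Proof. exact: expR_ge0. Qed.

Lemma measurable_cauchy_weight be : measurable_fun setT (cauchy_weight be).
Proof.
apply: measurableT_comp => //; apply: measurable_funM => //.
apply: measurableT_comp; first exact: measurable_ln.
by apply: measurable_funD => //; exact: measurable_funX.
Qed.

Lemma cvg_powRN (ga : R) : 0 < ga -> y `^ (- ga) @[y --> +oo] --> (0 : R).
Proof.
move=> ga0; apply/cvgr0Pnorm_lt => e e0; near=> y.
have y0 : 0 < y by [].
rewrite ger0_norm ?powR_ge0// /powR gt_eqF// -[ltRHS](lnK (e0 : e \in Num.pos)) ltr_expR.
rewrite mulNr ltrNl -ltr_pdivrMl// -(expRK (_ * _)) ltr_ln ?posrE ?expR_gt0//.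
Unshelve. all: by end_near. Qed.

Lemma integral_powR_lty (ga : R) : 0 < ga ->
  (\int[leb]_(x in `[1%R, +oo[) (x `^ (- ga - 1))%:E < +oo)%E.
Proof.
move=> ga0.
pose f x : R := x `^ (- ga - 1); pose F (x : R) : R := (- ga)^-1 * x `^ (- ga).
have dF (x : R) : 0 < x -> is_derive x 1 F (f x).
  move=> x0; rewrite (_ : f x = (- ga)^-1 *: (- ga * x `^ (- ga - 1))).
    by apply: is_deriveZ; exact: is_derive1_powR.
  by rewrite /f /GRing.scale/= mulKf// oppr_eq0 gt_eqF.
have cpow (a x : R) : 0 < x -> {for x, continuous (fun y : R => y `^ a)}.
  move=> x0; apply: differentiable_continuous; apply/derivable1_diffP.
  by have [] := is_derive1_powR a x0.
rewrite (@ge0_continuous_FTC2y _ f F 1 0)//.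
- by rewrite sub0e -EFinN ltry.
- by move=> x _; exact: powR_ge0.
- apply: continuous_in_subspaceT => x; rewrite inE/= in_itv/= andbT => x1.
  by apply: cpow; exact: lt_le_trans x1.
- rewrite -[X in _ --> X](mulr0 (- ga)^-1).
  apply: cvgM; [exact: cvg_cst|].
  exact: cvg_powRN.
- by move=> x x1; have [] := dF x (lt_trans ltr01 x1).
- apply: cvg_at_right_filter; apply: cvgM; first exact: cvg_cst.
  exact: cpow.
- move=> x; rewrite in_itv/= andbT => x1; rewrite derive1E.
  by apply: derive_val; exact: dF (lt_trans ltr01 x1).
Qed.

Lemma integral_cauchy_weight_lty (be : R) : 2^-1 < be ->
  (\int[leb]_x (cauchy_weight be x)%:E < +oo)%E.
Proof.
move=> be2; pose ga := 2 * be - 1.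
have ga0 : 0 < ga by rewrite /ga; lra.
pose g (x : R) : \bar R := (\1_(`[1%R, +oo[%classic : set R) x * x `^ (- ga - 1))%:E.
have mg : measurable_fun setT g.
  apply/measurable_EFinP; apply: measurable_funM => //; exact: measurable_powR.
have g0 x : (0 <= g x)%E by rewrite lee_fin mulr_ge0 ?powR_ge0.
have gy : (\int[leb]_x g x < +oo)%E.
  have := integral_powR_lty ga0; rewrite integral_mkcond; congr (_ < _)%E.
  apply: eq_integral => x _; rewrite /g patchE indicE.
  by case: ifP => _; rewrite ?mul1r ?mul0r.
pose u (x : R) : \bar R := (\1_(`[(-1)%R, 1%R]%classic : set R) x)%:E.
have mu : measurable_fun setT u by apply/measurable_EFinP.
have u0 x : (0 <= u x)%E by rewrite lee_fin.
have uy : (\int[leb]_x u x < +oo)%E.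
  rewrite integral_indic//= setIT lebesgue_measure_itv/= lte_fin.
  by case: ifP => _; rewrite ?ltry// -EFinD ltry.
have mgN : measurable_fun setT (fun x : R => g (0 - x)).
  by apply: (measurableT_comp mg); exact: measurable_funB.
apply: (@le_lt_trans _ _ (\int[leb]_x (u x + (g x + g (0 - x)%R)))%E); last first.
  rewrite ge0_integralD//; last 2 first.
  - by move=> x _; rewrite adde_ge0.
  - exact: emeasurable_funD.
  rewrite ge0_integralD//.
  rewrite (ge0_integral_reflect 0 mg g0); apply: lte_add_pinfty => //; exact: lte_add_pinfty.
apply: ge0_le_integral => //.
- by move=> x _; rewrite lee_fin cauchy_weight_ge0.
- by apply/measurable_EFinP; exact: measurable_cauchy_weight.
- by apply: emeasurable_funD => //; exact: emeasurable_funD.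
move=> x _.
have tail (y : R) : 1 <= y -> cauchy_weight be y <= y `^ (- ga - 1).
  move=> y1; have y0 : 0 < y := lt_le_trans ltr01 y1.
  rewrite /powR gt_eqF// ler_expR (_ : (- ga - 1) * ln y = - be * ln (y ^+ 2)); last first.
    by rewrite lnXn// -mulr_natl /ga; ring.
  rewrite ler_nM2l ?oppr_lt0; last by lra.
  by rewrite ler_ln ?posrE ?exprn_gt0//; have := sqr_ge0 y; lra.
rewrite /u /g -!EFinD lee_fin.
have [x1|x1] := leP 1 x.
  rewrite [X in _ + (X * _ + _)]indicE mem_set/= ?in_itv/= ?andbT// mul1r.
  by rewrite (le_trans (tail _ x1))// addrCA lerDl addr_ge0// mulr_ge0// powR_ge0.
have [xN1|xN1] := leP x (-1).
  rewrite [X in _ + (_ + X * _)]indicE mem_set/= ?in_itv/= ?andbT; last by lra.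
  rewrite mul1r addrA (_ : cauchy_weight be x = cauchy_weight be (0 - x)); last first.
    by rewrite /cauchy_weight sub0r sqrrN.
  by rewrite (le_trans (tail _ _)) ?lerDr ?addr_ge0// ?mulr_ge0// ?powR_ge0//; lra.
rewrite [X in X + _]indicE mem_set/= ?in_itv/= ?(ltW xN1) ?(ltW x1)//.
rewrite (@le_trans _ _ 1)// ?lerDl ?addr_ge0 ?mulr_ge0// ?powR_ge0//.
rewrite /cauchy_weight -expR0 ler_expR mulNr oppr_le0 mulr_ge0 ?ln_ge0//; first by lra.
by rewrite expR0 lerDl sqr_ge0.
Qed.

End cauchy_weight.

(** * Finite total mass *)
Section finiteness.
Context {R : realType}.
Notation leb := (@lebesgue_measure R).

Lemma det_le_entries p (M : 'M[R]_p) (t : R) : 0 <= t ->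
  (forall i j, `|M i j| <= t) -> `|\det M| <= (p`!)%:R * t ^+ p.
Proof.
move=> t0 Mt; rewrite /determinant.
apply: (le_trans (ler_norm_sum _ _ _)).
apply: (@le_trans _ _ (\sum_(s : 'S_p) t ^+ p)).
  apply: ler_sum => s _; rewrite normrM normrX normrN1 expr1n mul1r normr_prod.
  rewrite -[in leRHS](card_ord p) -prodr_const; apply: ler_prod => i _.
  by rewrite normr_ge0 Mt.
by rewrite sumr_const card_Sn mulr_natl.
Qed.

Lemma ln_le_subr1 (x : R) : 0 < x -> ln x <= x - 1.
Proof.
move=> x0; have := expR_ge1Dx (ln x).
by rewrite lnK ?posrE//; lra.
Qed.

Lemma cauchy_weight1E (x : R) : cauchy_weight 1 x = (1 + x ^+ 2)^-1.
Proof.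
have x0 : 0 < 1 + x ^+ 2 by have := sqr_ge0 x; lra.
by rewrite /cauchy_weight mulN1r expRN lnK.
Qed.

Lemma expRN_le_cauchy (c : R) : 0 < c ->
  exists2 C, 0 < C & forall x, 0 <= x -> expR (- c * x) <= C * cauchy_weight 1 x.
Proof.
move=> c0; exists (1 + 4 / c ^+ 2); first by rewrite ltr_wpDr// divr_ge0// sqr_ge0.
move=> x x0; rewrite cauchy_weight1E.
have x2 : 0 < 1 + x ^+ 2 by have := sqr_ge0 x; lra.
rewrite ler_pdivlMr// mulNr expRN mulrC ler_pdivrMr ?expR_gt0//.
have -> : expR (c * x) = expR (c * x / 2) ^+ 2.
  by rewrite expr2 -expRD; congr expR; field.
have e1 : 1 + c * x / 2 <= expR (c * x / 2) by exact: expR_ge1Dx.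
have cx : 0 <= c * x by rewrite mulr_ge0// ltW.
have e2 : (1 + c * x / 2) ^+ 2 <= expR (c * x / 2) ^+ 2.
  by rewrite ler_pXn2r// nnegrE ?expR_ge0//; lra.
apply: le_trans (_ : (1 + 4 / c ^+ 2) * (1 + c * x / 2) ^+ 2 <= _); last first.
  by rewrite ler_pM2l// ltr_wpDr// divr_ge0// sqr_ge0.
rewrite (_ : (1 + 4 / c ^+ 2) * _ = 1 + x ^+ 2 + (4 / c ^+ 2 + 4 * x / c + c * x + (c * x) ^+ 2 / 4)); last first.
  by field; rewrite gt_eqF.
rewrite lerDl !addr_ge0//.
- by rewrite divr_ge0// sqr_ge0.
- by rewrite divr_ge0 ?mulr_ge0// ltW.
- by rewrite divr_ge0// sqr_ge0.
Qed.

Section fixed_size.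
Context (p : nat).
Notation lsym := (@lebesgue_sym R p).

(** On the cone all entries are bounded by the trace, so the logarithm of the
    determinant grows at most like p ln(tr) and part of the linear term in the
    trace absorbs it. *)
Lemma log_dens_le (al : R) : 0 <= al -> exists C : R, forall Om : 'M[R]_p,
  pd_mx p Om -> al * ln (\det Om) - 2^-1 * \tr Om <= C - 4^-1 * \tr Om.
Proof.
move=> al0; pose k := al * p%:R; have k0 : 0 <= k by rewrite mulr_ge0.
(* m makes the slope k / m of the tangent bound on k ln(tr) at most 1/4 *)
pose m := 4 * k + 1; have m0 : 0 < m by rewrite /m; lra.
exists (al * ln ((p`!)%:R) + k * ln m) => Om Opd.
have Opsd := pd_psd Opd.
have d0 := pd_det_gt0 Opd.
have t0 : 0 <= \tr Om by rewrite /mxtrace sumr_ge0// => i _; exact: psd_diag_ge0.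
have p0 : 0 < (p`!)%:R :> R by rewrite ltr0n fact_gt0.
have dle : \det Om <= (p`!)%:R * (\tr Om) ^+ p.
  apply: (le_trans (ler_norm _)); apply: det_le_entries => // i j.
  exact: psd_entry_le_tr.
have tp : 0 < (\tr Om) ^+ p.
  by have := lt_le_trans d0 dle; rewrite pmulr_rgt0.
suff H : al * ln (\det Om) <= al * ln ((p`!)%:R) + k * ln m + 4^-1 * \tr Om by lra.
have H1 : al * ln (\det Om) <= al * (ln ((p`!)%:R) + ln ((\tr Om) ^+ p)).
  by rewrite ler_wpM2l// -lnM ?posrE// ler_ln ?posrE// mulr_gt0.
apply: (le_trans H1); rewrite mulrDr -addrA lerD2l.
have [p00|p1] := posnP p.
  rewrite /k; move: (\tr Om) t0 => t t0.
  by rewrite p00 expr0 ln1 !mulr0 mul0r add0r mulr_ge0.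
have tgt0 : 0 < \tr Om.
  rewrite lt_neqAle t0 andbT eq_sym; apply: contraL tp => /eqP ->.
    by rewrite expr0n gtn_eqF// ltxx.
rewrite lnXn// -[ln _ *+ _]mulr_natl mulrA -/k.
have -> : ln (\tr Om) = ln m + ln (\tr Om / m) by rewrite ln_div ?posrE//; lra.
rewrite mulrDr lerD2l.
apply: (@le_trans _ _ (k * (\tr Om / m))).
  rewrite ler_wpM2l//; have := @ln_le_subr1 (\tr Om / m) (divr_gt0 tgt0 m0); lra.
rewrite mulrCA mulrC ler_pM2r// ler_pdivrMr// /m; lra.
Qed.

(** The trace dominates every coordinate, so the density is bounded by a product
    of integrable functions of the single coordinates. *)
Lemma cone_dens_lty (al : R) : 0 <= al ->
  (\int[lsym]_Om (cone_dens al 1%:M Om)%:E < +oo)%E.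
Proof.
move=> /log_dens_le[C CP].
pose N := size (upper_entries p).
have c0 : 0 < (4 * N.+1%:R)^-1 :> R by rewrite invr_gt0 mulr_gt0.
set c := _^-1 in c0.
have [D D0 DP] := expRN_le_cauchy c0.
have Dc0 y : 0 <= D * cauchy_weight 1 y.
  by apply: mulr_ge0; [exact: ltW|exact: cauchy_weight_ge0].
have mcd : measurable_fun setT (fun Om : 'M[R]_p => (cone_dens al 1%:M Om)%:E).
  by apply/measurable_EFinP; exact: measurable_cone_dens.
rewrite ge0_integral_lebesgue_sym//; last by move=> Om; rewrite lee_fin cone_dens_ge0.
have mprod : measurable_fun setT (fun x : N.-tuple (measurableTypeR R) =>
    (\prod_i (D * cauchy_weight 1 (tnth x i)))%:E).
  apply/measurable_EFinP; apply: measurable_prod => i _.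
  apply: measurable_funM => //.
  apply: (measurableT_comp (@measurable_cauchy_weight R 1)); exact: measurable_tnth.
apply: (@le_lt_trans _ _ (\int[product_tuple leb N]_x ((expR C)%:E *
    (\prod_i (D * cauchy_weight 1 (tnth x i)))%:E)))%E; last first.
  rewrite ge0_integralZl//; last first.
    by move=> x _; rewrite lee_fin prodr_ge0.
  apply: lte_mul_pinfty; [by rewrite lee_fin expR_ge0|by []|].
  apply: (integral_product_lty (f := fun i x => D * cauchy_weight 1 x)).
  - by move=> i; apply: measurable_funM => //; exact: measurable_cauchy_weight.
  - by [].
  - move=> i; under eq_integral do rewrite EFinM.
    rewrite (ge0_integralZl _ measurableT); last 3 first.
    + by apply/measurable_EFinP; exact: measurable_cauchy_weight.
    + by move=> x _; rewrite lee_fin cauchy_weight_ge0.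
    + by rewrite lee_fin ltW.
    apply: lte_mul_pinfty; [by rewrite lee_fin ltW|by []|].
    by apply: integral_cauchy_weight_lty; lra.
have msym := @measurable_sym_of_upper R p.
apply: ge0_le_integral => //.
- by move=> x _; rewrite lee_fin cone_dens_ge0.
- exact: (measurableT_comp mcd msym).
- by apply: emeasurable_funM.
move=> x _; rewrite -EFinM lee_fin /cone_dens.
have prod0 : 0 <= \prod_i (D * cauchy_weight 1 (tnth x i)).
  by rewrite prodr_ge0.
set Om := sym_of_upper x.
have [Opd|nO] := pselect (pd_mx p Om); last first.
  by rewrite indicE memNset// mul0r mulr_ge0// expR_ge0.
rewrite indicE mem_set// mul1r mulmx1.
apply: (@le_trans _ _ (expR (C - 4^-1 * \tr Om))); first by rewrite ler_expR CP.
rewrite expRD ler_wpM2l ?expR_ge0//.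
have t0 : 0 <= \tr Om.
  by rewrite /mxtrace sumr_ge0// => i _; apply: psd_diag_ge0; exact: pd_psd.
apply: (@le_trans _ _ (\prod_(i < N) expR (- c * `|tnth x i|))); last first.
  apply: ler_prod => i _; rewrite expR_ge0/=.
  apply: (le_trans (DP _ (normr_ge0 _))).
  by rewrite /cauchy_weight real_normK// num_real.
rewrite -expR_sum ler_expR -mulr_sumr mulNr lerN2.
apply: (@le_trans _ _ (c * (N%:R * \tr Om))).
  rewrite ler_pM2l// mulr_natl -[X in _ *+ X](card_ord N) -sumr_const.
  by apply: ler_sum => i _; rewrite -sym_of_upperE; apply: psd_entry_le_tr; exact: pd_psd.
rewrite mulrA ler_wpM2r// /c invfM -mulrA ler_piMr ?invr_ge0//.
by rewrite mulrC ler_pdivrMr// mul1r ler_nat.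
Qed.

(** Each factor on the right carries the share 1 / p of the total exponent
    (p + 1) / 2; this share exceeds 1 / 2, which is what integrability on the
    line requires. *)
Lemma sqrt_le_prod_cauchy (x : 'cV[R]_p) : (0 < p)%N ->
  (Num.sqrt (1 + dotmx x x) ^+ p.+1)^-1 <=
  \prod_i cauchy_weight ((p.+1)%:R / (2 * p%:R)) (x i ord0).
Proof.
move=> p0; have pR : 0 < p%:R :> R by rewrite ltr0n.
have d0 : 0 < 1 + dotmx x x by have := dotmx_ge0 x; lra.
have -> : (Num.sqrt (1 + dotmx x x) ^+ p.+1)^-1 =
    expR (- (p.+1%:R / 2) * ln (1 + dotmx x x)).
  rewrite -[in LHS](@lnK _ (Num.sqrt _)) ?posrE ?sqrtr_gt0//.
  rewrite -expRM_natl -expRN; congr expR.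
  have e : ln (1 + dotmx x x) = 2 * ln (Num.sqrt (1 + dotmx x x)).
    by rewrite -{1}(sqr_sqrtr (ltW d0)) lnXn ?sqrtr_gt0// mulr_natl.
  by rewrite e; field.
rewrite -expR_sum ler_expR -mulr_sumr.
have -> : - (p.+1%:R / 2) * ln (1 + dotmx x x) =
    - (p.+1%:R / (2 * p%:R)) * (p%:R * ln (1 + dotmx x x)).
  by field; rewrite gt_eqF.
apply: ler_wnM2l; first by rewrite oppr_le0 divr_ge0// mulr_ge0.
rewrite mulr_natl -[X in _ *+ X](card_ord p) -sumr_const; apply: ler_sum => i _.
have xi : x i ord0 ^+ 2 <= dotmx x x.
  rewrite dotmx_sumE (bigD1 i)//= -expr2 lerDl sumr_ge0// => l _.
  by rewrite -expr2 sqr_ge0.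
by rewrite ler_ln ?posrE//; have := sqr_ge0 (x i ord0); lra.
Qed.

(** The case b = 1, where the density is unbounded at the boundary.  Write
    det(Om)^(-1/2) as a Gaussian integral over x in R^p and exchange the order:
    for fixed x the integral over Om is that of exponent 0 with scale I + x x^T,
    which is a multiple of (1 + |x|^2)^(-(p + 1) / 2), integrable over R^p. *)
Lemma cone_dens_half_lty : (0 < p)%N ->
  (\int[lsym]_Om (cone_dens (- 2^-1) 1%:M Om)%:E < +oo)%E.
Proof.
move=> p0; pose c : R := Num.sqrt (2 * pi) ^+ p.
have c0 : 0 < c by rewrite exprn_gt0// sqrtr_gt0 mulr_gt0// pi_gt0.
have mcd al : measurable_fun setT (fun Om : 'M[R]_p => (cone_dens al 1%:M Om)%:E).
  by apply/measurable_EFinP; exact: measurable_cone_dens.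
pose H (z : 'M[R]_p * p.-tuple (measurableTypeR R)) : \bar R :=
  ((cone_dens 0 1%:M z.1)%:E * (gauss_quad z.1 z.2)%:E)%E.
have mH : measurable_fun setT H.
  apply: emeasurable_funM; first exact: (measurableT_comp (mcd 0) measurable_fst).
  apply/measurable_EFinP; apply: measurableT_comp => //.
  apply: measurable_funM => //; apply: measurable_fun_quad_form.
    exact: measurable_fst.
  apply: measurableT_comp; first exact: measurable_col_tuple.
  exact: measurable_snd.
have H0 z : (0 <= H z)%E by rewrite mule_ge0// lee_fin ?cone_dens_ge0 ?expR_ge0.
suff : (c%:E * \int[lsym]_Om (cone_dens (- 2^-1) 1%:M Om)%:E < +oo)%E.
  have : (0 <= \int[lsym]_Om (cone_dens (- 2^-1) 1%:M Om)%:E)%E.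
    by apply: integral_ge0 => Om _; rewrite lee_fin cone_dens_ge0.
  case: (\int[lsym]_Om _)%E => [r||]//=; rewrite ?ltry//.
  by rewrite gt0_muley// lte_fin.
have -> : (c%:E * \int[lsym]_Om (cone_dens (- 2^-1) 1%:M Om)%:E =
    \int[lsym]_Om \int[product_tuple leb p]_t H (Om, t))%E.
  rewrite -(ge0_integralZl _ measurableT (mcd _)); last 2 first.
  - by move=> Om _; rewrite lee_fin cone_dens_ge0.
  - by rewrite lee_fin ltW.
  apply: eq_integral => Om _; rewrite /H/=.
  rewrite (ge0_integralZl _ measurableT); last 3 first.
  - exact: measurable_gauss_quad.
  - by move=> t _; rewrite lee_fin expR_ge0.
  - by rewrite lee_fin cone_dens_ge0.
  have [Opd|nO] := pselect (pd_mx p Om); last first.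
    by rewrite /cone_dens indicE memNset// !mul0r mul0e mule0.
  rewrite integral_gauss_quad// -!EFinM /cone_dens indicE mem_set// !mul1r.
  have d0 := pd_det_gt0 Opd.
  have e : expR (- 2^-1 * ln (\det Om)) = (Num.sqrt (\det Om))^-1.
    rewrite -{1}(sqr_sqrtr (ltW d0)) lnXn ?sqrtr_gt0//.
    rewrite mulNr expRN -[ln _ *+ _]mulr_natl mulKf// lnK//.
    by rewrite posrE sqrtr_gt0.
  by rewrite expRD e mul0r add0r -/c; congr EFin; ring.
rewrite (fubini_tonelli (m1 := lsym) (m2 := product_tuple leb p) _ mH)//.
pose be : R := (p.+1)%:R / (2 * p%:R).
pose Z := (\int[lsym]_Om (cone_dens 0 1%:M Om)%:E)%E.
have Zy : (Z < +oo)%E by exact: cone_dens_lty.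
have Z0 : (0 <= Z)%E by apply: integral_ge0 => Om _; rewrite lee_fin cone_dens_ge0.
have Zfin : Z \is a fin_num by rewrite ge0_fin_numE.
have mprod : measurable_fun setT (fun x : p.-tuple (measurableTypeR R) =>
    (\prod_i (cauchy_weight be (tnth x i)))%:E).
  apply/measurable_EFinP; apply: measurable_prod => i _.
  apply: (measurableT_comp (@measurable_cauchy_weight R be)); exact: measurable_tnth.
have prod0 (x : p.-tuple R) : 0 <= \prod_i cauchy_weight be (tnth x i).
  by rewrite prodr_ge0// => i _; exact: cauchy_weight_ge0.
apply: (@le_lt_trans _ _ (\int[product_tuple leb p]_t (Z *
    (\prod_i cauchy_weight be (tnth t i))%:E)))%E; last first.
  rewrite (ge0_integralZl _ measurableT)//; last first.
    by move=> x _; rewrite lee_fin.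
  apply: lte_mul_pinfty => //.
  apply: (integral_product_lty (f := fun i x => cauchy_weight be x)).
  - by move=> i; exact: measurable_cauchy_weight.
  - by move=> i x; exact: cauchy_weight_ge0.
  - move=> i; apply: integral_cauchy_weight_lty.
    have pR : 0 < p%:R :> R by rewrite ltr0n.
    rewrite /be ltr_pdivlMr ?mulr_gt0// mulrA mulVf// mul1r ltr_nat//.
apply: ge0_le_integral => //.
- by move=> t _; exact: integral_ge0.
- exact: (measurable_fun_fubini_tonelli_G _ mH).
- by apply: emeasurable_funM.
move=> t _.
set x := col_tuple t.
have tilt := cone_rank1_tilt x.
set s := Num.sqrt _ ^+ _ in tilt.
have s0 : 0 < s.
  by rewrite exprn_gt0// sqrtr_gt0; have := dotmx_ge0 x; lra.
rewrite (_ : (\int[lsym]_x0 H (x0, t) = s^-1%:E * Z)%E); last first.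
  rewrite /Z -tilt muleA -EFinM mulVf ?gt_eqF// mul1e.
  by apply: eq_integral => Om _; rewrite /H -EFinM.
rewrite muleC lee_wpmul2l// lee_fin.
have := sqrt_le_prod_cauchy x p0.
by under eq_bigr do rewrite mxE.
Qed.

End fixed_size.
End finiteness.

(** * The posterior as a ratio of integrals *)
Section density.
Context {R : realType} d (T : measurableType d).
Variables (mu nu : {measure set T -> \bar R}) (w : T -> R).
Hypotheses (mw : measurable_fun setT w) (w0 : forall x, 0 <= w x).
Hypothesis nuE : forall B, measurable B -> (nu B = \int[mu]_x ((\1_B x)%:E * (w x)%:E))%E.
Import HBNNSimple.

Lemma ge0_integral_density (F : T -> \bar R) :
  measurable_fun setT F -> (forall x, 0 <= F x)%E ->
  (\int[nu]_x F x = \int[mu]_x (F x * (w x)%:E))%E.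
Proof.
move=> mF F0.
have mwE : measurable_fun setT (fun x => (w x)%:E) by exact/measurable_EFinP.
have w0E x : (0 <= (w x)%:E)%E by rewrite lee_fin.
pose f := nnsfun_approx measurableT mF.
have mf n : measurable_fun setT (fun x => (f n x)%:E) by exact/measurable_EFinP.
have cvgf x : (f n x)%:E @[n --> \oo] --> F x.
  by apply: cvg_nnsfun_approx => // y _; exact: F0.
have ndf x : {homo (fun n => (f n x)%:E) : m n / (m <= n)%N >-> (m <= n)%E}.
  by move=> m n mn; rewrite lee_fin; exact/lefP/nd_nnsfun_approx.
have simple n : (\int[nu]_x (f n x)%:E = \int[mu]_x ((f n x)%:E * (w x)%:E))%E.
  under eq_integral do rewrite fimfunE -fsumEFin//.
  under [RHS]eq_integral do rewrite fimfunE -fsumEFin//.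
  rewrite ge0_integral_fsum//; last 2 first.
  - by move=> y; exact/measurable_EFinP/measurable_funM.
  - by move=> y x _; rewrite nnfun_muleindic_ge0.
  under [RHS]eq_integral.
    move=> x _; rewrite ge0_mule_fsuml; last by move=> y; rewrite nnfun_muleindic_ge0.
    over.
  rewrite ge0_integral_fsum//; last 2 first.
  - by move=> y; apply: emeasurable_funM => //; exact/measurable_EFinP/measurable_funM.
  - by move=> y x _; rewrite mule_ge0// nnfun_muleindic_ge0.
  apply: eq_fsbigr => y /[!inE] -[x0 _ <-].
  set r := f n x0; set B := f n @^-1` [set r].
  have r0 : 0 <= r by [].
  have mB : measurable B by exact: measurable_sfunP.
  under eq_integral do rewrite EFinM.
  under [RHS]eq_integral do rewrite EFinM -muleA.
  rewrite !ge0_integralZl//.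
  - by rewrite integral_indic// setIT nuE.
  - by apply: emeasurable_funM => //; exact/measurable_EFinP.
  - by move=> x _; rewrite mule_ge0.
  - exact/measurable_EFinP.
transitivity (limn (fun n => \int[nu]_x (f n x)%:E))%E.
  rewrite -monotone_convergence//.
  - by apply: eq_integral => x _; apply/esym/cvg_lim.
  - by move=> n x _; rewrite lee_fin.
under eq_fun do rewrite simple.
rewrite -monotone_convergence//.
- apply: eq_integral => x _; apply/cvg_lim => //.
  exact: cvgeZr.
- by move=> n; apply: emeasurable_funM.
- by move=> n x _; rewrite mule_ge0 ?lee_fin.
- by move=> x _ m n mn; rewrite lee_wpmul2r//; exact: ndf.
Qed.

End density.

Section posterior_formula.
Context {R : realType} (p b n : nat).
Hypotheses (p0 : (0 < p)%N) (b0 : (1 <= b)%N).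
Notation lsym := (@lebesgue_sym R p).
Implicit Types (A Om S : 'M[R]_p).

Let al0 : R := (b%:R - 2) / 2.

(** The exponent (k + b - 2) / 2 is nonnegative unless k = 0 and b = 1, when it
    is - 1 / 2. *)
Lemma prior_dens_lty (k : nat) :
  (\int[lsym]_Om (cone_dens ((k%:R + b%:R - 2) / 2) 1%:M Om)%:E < +oo)%E.
Proof.
have [kb|kb] := leqP 2 (k + b).
  apply: cone_dens_lty; by rewrite divr_ge0// subr_ge0 -natrD ler_nat.
have -> : k%:R + b%:R - 2 = -1 :> R.
  have -> : k = 0%N by lia.
  have -> : b = 1%N by lia.
  by rewrite add0r; lra.
by rewrite mulN1r; exact: cone_dens_half_lty.
Qed.

(** The boundary of the cone, where the prior density is a junk value, is null. *)
Lemma wishart_weightE (B : set 'M[R]_p) : measurable B ->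
  wishart_weight p b B = (\int[lsym]_Om ((\1_B Om)%:E * (cone_dens al0 1%:M Om)%:E))%E.
Proof.
move=> mB; rewrite /wishart_weight.
have mpsd := @measurable_psd_mx R p.
have mpd := @measurable_pd_mx R p.
have mw : measurable_fun setT (fun Om : 'M[R]_p => (wishart_density b Om)%:E).
  by apply/measurable_EFinP; exact: measurable_wishart_density.
have w0 Om : (0 <= (wishart_density b Om)%:E)%E by rewrite lee_fin expR_ge0.
transitivity (\int[lsym]_(Om in B `&` pd_mx p) (wishart_density b Om)%:E)%E.
  rewrite (_ : B `&` psd_mx p = (B `&` pd_mx p) `|` (B `&` (psd_mx p `\` pd_mx p))).
    rewrite ge0_integral_setU//.
    - rewrite [X in (_ + X)%E]null_set_integral ?adde0//.
      + by apply: measurableI => //; exact: measurableD.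
      + exact: measurable_funTS.
      + apply/eqP; rewrite -measure_le0 -(@psd_boundary_null R p) le_measure ?inE//.
        * by apply: measurableI => //; exact: measurableD.
        * exact: measurableD.
    - exact: measurableI.
    - by apply: measurableI => //; exact: measurableD.
    - exact: measurable_funTS.
    - apply/disj_set2P; rewrite -subset0 => Om [[_ Opd] [_ [_ nO]]]; exact: nO.
  rewrite -setIUr setDE setUIr setUv setIT; congr (_ `&` _).
  by apply/esym/setUidPr => Om; exact: pd_psd.
rewrite integral_mkcond; apply: eq_integral => Om _.
rewrite patchE -EFinM /cone_dens !indicE in_setI mulmx1.
by case: (Om \in B); case: (Om \in pd_mx p); rewrite ?mul0r ?mulr0 ?mul1r.
Qed.

Let Z0 := fine (\int[lsym]_Om (cone_dens al0 1%:M Om)%:E)%E.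

Let mcd al A : measurable_fun setT (fun Om : 'M[R]_p => (cone_dens al A Om)%:E).
Proof. by apply/measurable_EFinP; exact: measurable_cone_dens. Qed.

Let Z0E : (Z0%:E = \int[lsym]_Om (cone_dens al0 1%:M Om)%:E)%E.
Proof.
rewrite fineK// ge0_fin_numE.
  by have := prior_dens_lty 0; rewrite add0r.
by apply: integral_ge0 => Om _; rewrite lee_fin cone_dens_ge0.
Qed.

Let Z0_gt0 : 0 < Z0.
Proof. by rewrite -lte_fin Z0E cone_dens_gt0. Qed.

Lemma integral_wishart_prior (F : 'M[R]_p -> \bar R) :
  measurable_fun setT F -> (forall Om, 0 <= F Om)%E ->
  (\int[wishart_prior p b]_Om F Om =
   Z0^-1%:E * \int[lsym]_Om (F Om * (cone_dens al0 1%:M Om)%:E))%E.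
Proof.
move=> mF F0.
have Zi0 : 0 <= Z0^-1 by rewrite invr_ge0 ltW.
have mZ : measurable_fun setT (fun Om => Z0^-1 * cone_dens al0 1%:M Om).
  by apply: measurable_funM => //; exact: measurable_cone_dens.
have WT : wishart_weight p b setT = Z0%:E.
  rewrite wishart_weightE// Z0E; apply: eq_integral => Om _.
  by rewrite indicT mul1e.
rewrite (@ge0_integral_density _ _ _ lsym (wishart_prior p b) _ mZ)//.
- rewrite -(ge0_integralZl _ measurableT)//.
  + by apply: eq_integral => Om _; rewrite EFinM muleCA.
  + by apply: emeasurable_funM.
  + by move=> Om _; rewrite mule_ge0// lee_fin cone_dens_ge0.
- by move=> Om; rewrite mulr_ge0// cone_dens_ge0.
move=> B mB; rewrite [LHS]/= /mnormalize /= WT eqe gt_eqF//= wishart_weightE//.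
rewrite muleC -(ge0_integralZl _ measurableT)//.
- by apply: eq_integral => Om _; rewrite EFinM muleCA.
- by apply: emeasurable_funM => //; exact/measurable_EFinP/measurable_indic.
- by move=> Om _; rewrite mule_ge0// lee_fin cone_dens_ge0.
Qed.

(** Conjugacy: likelihood times prior density is again a cone density. *)
Lemma posteriorE S (B : set 'M[R]_p) : measurable B ->
  (forall Om, psd_mx p Om -> 0 <= \tr (Om *m S)) ->
  let al := (n%:R + b%:R - 2) / 2 in
  let A := 1%:M + n%:R *: S in
  (\int[lsym]_Om (cone_dens al A Om)%:E < +oo)%E /\
  posterior (wishart_prior p b) n S B =
  fine (\int[lsym]_Om ((cone_dens al A Om)%:E * (\1_B Om)%:E))%E /
  fine (\int[lsym]_Om (cone_dens al A Om)%:E)%E.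
Proof.
move=> mB S0 al A.
have Zy : (\int[lsym]_Om (cone_dens al A Om)%:E < +oo)%E.
  apply: le_lt_trans (prior_dens_lty n).
  apply: ge0_le_integral => //.
  - by move=> Om _; rewrite lee_fin cone_dens_ge0.
  move=> Om _; rewrite lee_fin /cone_dens.
  have [Opd|nO] := pselect (pd_mx p Om); last by rewrite !indicE memNset// !mul0r.
  rewrite ler_wpM2l// ler_expR lerD2l lerN2 ler_pM2l// mulmx1 mulmxDr mulmx1.
  rewrite mxtraceD lerDl -scalemxAr mxtraceZ mulr_ge0//.
  by apply: S0; exact: pd_psd.
split => //.
have key Om : (expR (log_likelihood n S Om) * cone_dens al0 1%:M Om = cone_dens al A Om)%R.
  rewrite mulrCA -expRD; congr (_ * expR _).
  rewrite /log_likelihood /A mulmxDr mulmx1 mxtraceD -scalemxAr mxtraceZ /al /al0.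
  by field.
have ml : measurable_fun setT (fun Om : 'M[R]_p => (expR (log_likelihood n S Om))%:E).
  apply/measurable_EFinP; apply: measurableT_comp => //.
  apply: measurable_funB; apply: measurable_funM => //.
    by apply: measurableT_comp => //; exact: measurable_det.
  by apply: (measurableT_comp (@measurable_tr R p)); exact: measurable_mulmx.
have l0 Om : (0 <= (expR (log_likelihood n S Om))%:E)%E by rewrite lee_fin expR_ge0.
have mi : measurable_fun setT (fun Om : 'M[R]_p => (\1_B Om)%:E : \bar R).
  by apply/measurable_EFinP; exact: measurable_indic.
rewrite /posterior.
have -> : (\int[wishart_prior p b]_Om (expR (log_likelihood n S Om))%:E =
    Z0^-1%:E * \int[lsym]_Om (cone_dens al A Om)%:E)%E.
  rewrite integral_wishart_prior//; congr (_ * _)%E.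
  by apply: eq_integral => Om _; rewrite -EFinM key.
have -> : (\int[wishart_prior p b]_(Om in B) (expR (log_likelihood n S Om))%:E =
    Z0^-1%:E * \int[lsym]_Om ((cone_dens al A Om)%:E * (\1_B Om)%:E))%E.
  transitivity (\int[wishart_prior p b]_Om
      ((expR (log_likelihood n S Om))%:E * (\1_B Om)%:E))%E.
    rewrite integral_mkcond; apply: eq_integral => Om _.
    by rewrite patchE indicE; case: ifP => _; rewrite ?mule1 ?mule0.
  rewrite integral_wishart_prior//.
  - congr (_ * _)%E; apply: eq_integral => Om _.
    by rewrite muleAC -EFinM key.
  - by apply: emeasurable_funM.
have Zi0 : Z0^-1 != 0 by rewrite invr_eq0 gt_eqF.
have fin1 : (\int[lsym]_Om (cone_dens al A Om)%:E)%E \is a fin_num.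
  by rewrite ge0_fin_numE// integral_ge0// => Om _; rewrite lee_fin cone_dens_ge0.
have fin2 : (\int[lsym]_Om ((cone_dens al A Om)%:E * (\1_B Om)%:E))%E \is a fin_num.
  rewrite ge0_fin_numE; last first.
    by apply: integral_ge0 => Om _; rewrite mule_ge0// lee_fin ?cone_dens_ge0.
  apply: le_lt_trans Zy; apply: ge0_le_integral => //.
  - by move=> Om _; rewrite mule_ge0// lee_fin ?cone_dens_ge0.
  - exact: emeasurable_funM.
  - move=> Om _; rewrite -EFinM lee_fin ler_piMr//; exact: cone_dens_ge0.
rewrite !fineM//= invfM mulrACA divff ?mul1r//.
Qed.

End posterior_formula.

(** * Normal approximation of the gamma density *)
Section gamma_normal.
Context {R : realType}.
Notation leb := (@lebesgue_measure R).

Lemma ln_taylor2 (z : R) : `|z| <= 2^-1 ->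
  `|ln (1 + z) - z + z ^+ 2 / 2| <= 2 * `|z| ^+ 3.
Proof.
move=> z2.
pose F (y : R) : R := ln (1 + y) - y + y ^+ 2 / 2.
have dF (y : R) : -1 < y -> is_derive y 1 F (y ^+ 2 / (1 + y)).
  move=> y1; have y10 : 0 < 1 + y by lra.
  have dln : is_derive y 1 (fun y : R => ln (1 + y)) ((1 + y)^-1).
    rewrite -[X in is_derive _ _ _ X]mulr1.
    apply: (@is_derive1_comp _ (@ln R) (fun y : R => 1 + y)).
    - exact: is_derive1_ln.
    - by rewrite -[X in is_derive _ _ _ X]add0r; apply: is_deriveD.
  have dsq : is_derive y 1 (fun y : R => y ^+ 2 / 2) y.
    have -> : (fun y : R => y ^+ 2 / 2) = 2^-1 \*: (fun y : R => y ^+ 2).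
      by apply/funext => t /=; rewrite /GRing.scale/= mulrC.
    by apply: is_derive_eq; rewrite /GRing.scale/=; field.
  rewrite (_ : y ^+ 2 / (1 + y) = (1 + y)^-1 - 1 + y); last first.
    by field; rewrite gt_eqF.
  by apply: is_deriveD.
have cF (y : R) : -1 < y -> {for y, continuous F}.
  by move=> y1; apply: differentiable_continuous; apply/derivable1_diffP; have [] := dF y y1.
have F0 : F 0 = 0 by rewrite /F addr0 ln1 expr0n/= mul0r subrr addr0.
have z2' := z2; move: z2'; rewrite ler_norml => /andP[zl zr].
have bound (c : R) : `|c| <= `|z| -> `|c ^+ 2 / (1 + c) * z| <= 2 * `|z| ^+ 3.
  move=> cz; have c2 := le_trans cz z2.
  move: (c2); rewrite ler_norml => /andP[cl cr].
  have c1 : 0 < 1 + c by lra.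
  rewrite normrM [in leRHS]exprSr mulrA ler_wpM2r//.
  rewrite normrM normrX (@ger0_norm _ (1 + c)^-1); last by rewrite invr_ge0 ltW.
  have h2 : `|c| ^+ 2 <= `|z| ^+ 2 by rewrite ler_pXn2r ?nnegrE.
  have h1 : (1 + c)^-1 <= 2 by rewrite -[leRHS]invrK lef_pV2 ?posrE ?invr_gt0//; lra.
  by rewrite mulrC; apply: ler_pM => //; rewrite invr_ge0 ltW.
rewrite -/(F z).
have [z0|z0] := leP 0 z.
  have [|c|c] := @MVT_segment R F (fun y => y ^+ 2 / (1 + y)) 0 z z0.
  - by move=> x; rewrite in_itv/= => /andP[x0 _]; apply: dF; lra.
  - apply: continuous_in_subspaceT => x; rewrite inE/= in_itv/= => /andP[x0 _].
    by apply: cF; lra.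
  rewrite in_itv/= F0 !subr0 => /andP[c0 cz] ->; apply: bound.
  by rewrite !ger0_norm//.
have [|c|c] := @MVT_segment R F (fun y => y ^+ 2 / (1 + y)) z 0 (ltW z0).
- by move=> x; rewrite in_itv/= => /andP[x0 _]; apply: dF; lra.
- apply: continuous_in_subspaceT => x; rewrite inE/= in_itv/= => /andP[x0 _].
  by apply: cF; lra.
rewrite in_itv/= F0 !sub0r mulrN => /andP[zc c0] /oppr_inj ->; apply: bound.
by rewrite !ler0_norm ?lerN2// ltW.
Qed.

(** The density of [gamma_z] for a variable with density [gamma_dens], up to a
    constant, with the rate scaled out. *)
Definition std_gamma (a x : R) : R :=
  \1_(`]0, +oo[%classic) (1 + x / Num.sqrt a) *
  expR (a * ln (1 + x / Num.sqrt a) - Num.sqrt a * x).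

Definition bell (x : R) : R := expR (- 2^-1 * x ^+ 2).

Lemma std_gamma_ge0 a x : 0 <= std_gamma a x.
Proof. by rewrite mulr_ge0 ?expR_ge0. Qed.

Lemma bell_ge0 x : 0 <= bell x.
Proof. exact: expR_ge0. Qed.

Lemma measurable_std_gamma a : measurable_fun setT (std_gamma a).
Proof.
have m1 : measurable_fun setT (fun x : R => 1 + x / Num.sqrt a).
  by apply: measurable_funD => //; exact: measurable_funM.
apply: measurable_funM.
  by apply: (measurableT_comp _ m1); exact: measurable_indic.
apply: measurableT_comp => //; apply: measurable_funB; apply: measurable_funM => //.
by apply: (measurableT_comp _ m1); exact: measurable_ln.
Qed.

Lemma measurable_bell : measurable_fun setT bell.
Proof.
by apply: measurableT_comp => //; apply: measurable_funM => //; exact: measurable_funX.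
Qed.

(** An integrable bound uniform in a >= 1, from ln y <= 2 (sqrt y - 1); the
    cruder bound ln y <= y - 1 only gives a constant. *)
Lemma std_gamma_le a x : 1 <= a -> std_gamma a x <= expR (1 - 2^-1 * `|x|).
Proof.
move=> a1; have a0 : 0 < a by lra.
rewrite /std_gamma; set r := Num.sqrt a.
have r1 : 1 <= r by rewrite -sqrtr1 ler_wsqrtr.
have r0 : 0 < r by lra.
have r2 : r ^+ 2 = a by rewrite sqr_sqrtr// ltW.
have [z0|z0] := ltP 0 (1 + x / r); last first.
  by rewrite indicE memNset ?mul0r ?expR_ge0//= in_itv/= andbT; apply/negP; rewrite -leNgt.
rewrite indicE mem_set/= ?in_itv/= ?andbT// mul1r ler_expR.
set s := Num.sqrt (1 + x / r).
have s0 : 0 < s by rewrite sqrtr_gt0.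
have s2 : s ^+ 2 = 1 + x / r by rewrite sqr_sqrtr// ltW.
have xE : x = r * (s ^+ 2 - 1) by rewrite s2; field; rewrite gt_eqF.
have lnb : ln (1 + x / r) <= 2 * (s - 1).
  by rewrite -s2 lnXn// -[ln s *+ 2]mulr_natl ler_pM2l// ln_le_subr1.
have : a * ln (1 + x / r) <= a * (2 * (s - 1)) by rewrite ler_pM2l.
move=> /(fun h => lerB h (lexx (r * x))) => h; apply: (le_trans h).
rewrite xE -r2 normrM (gtr0_norm r0).
have [s1|s1] := leP 1 s.
  rewrite ger0_norm; last by nra.
  have : 0 <= (r - 1) * ((r * (s - 1)) * (s - 1)) by rewrite !mulr_ge0//; lra.
  have := sqr_ge0 (r * (s - 1) - 1); nra.
rewrite ler0_norm; last by nra.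
have : 0 <= (1 - s) * (r * (1 - s)) by rewrite !mulr_ge0//; lra.
have := sqr_ge0 (r * (1 - s) - 1); nra.
Qed.

Lemma std_gamma_cvg (a : nat -> R) x : (forall k, k.+1%:R <= a k) ->
  std_gamma (a k) x @[k --> \oo] --> bell x.
Proof.
move=> ak.
have a0 k : 0 < a k by apply: lt_le_trans (ak k); rewrite ltr0n.
have sqrt_large (M : R) : \forall k \near \oo, M <= Num.sqrt (a k).
  near=> k; apply: (le_trans (ler_norm M)); rewrite -sqrtr_sqr ler_wsqrtr//.
  apply: le_trans (ak k); rewrite -natr1.
  have : M ^+ 2 <= k%:R by near: k; exact: nbhs_infty_ger.
  by move=> /le_trans; apply; rewrite lerDl.
have zE k : x / Num.sqrt (a k) * Num.sqrt (a k) = x.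
  by rewrite divfK// gt_eqF// sqrtr_gt0.
have small : \forall k \near \oo, `|x / Num.sqrt (a k)| <= 2^-1.
  near=> k; have s0 : 0 < Num.sqrt (a k) by rewrite sqrtr_gt0.
  rewrite normrM normfV (gtr0_norm s0) ler_pdivrMr// -ler_pdivrMl ?invr_gt0// invrK.
  by near: k; exact: sqrt_large.
apply: (@cvg_trans _ (expR (a k * (ln (1 + x / Num.sqrt (a k)) - x / Num.sqrt (a k)
   + (x / Num.sqrt (a k)) ^+ 2 / 2) + (- 2^-1 * x ^+ 2)) @[k --> \oo])).
  apply: near_eq_cvg; near=> k.
  have : `|x / Num.sqrt (a k)| <= 2^-1 by near: k.
  rewrite /std_gamma; have := zE k; set r := Num.sqrt (a k); set z := x / r => zr.
  rewrite ler_norml => /andP[zl _].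
  have r2 : a k = r ^+ 2 by rewrite sqr_sqrtr// ltW.
  rewrite indicE mem_set/= ?in_itv/= ?andbT; last by lra.
  by rewrite mul1r; congr expR; rewrite r2 -zr; field.
have -> : bell x = expR (0 + - 2^-1 * x ^+ 2) by rewrite add0r.
apply: continuous_cvg; first exact: continuous_expR.
apply: cvgD; last exact: cvg_cst.
apply/cvgr0Pnorm_le => e e0; near=> k.
have zs : `|x / Num.sqrt (a k)| <= 2^-1 by near: k.
have s0 : 0 < Num.sqrt (a k) by rewrite sqrtr_gt0.
rewrite normrM (gtr0_norm (a0 k)).
apply: (le_trans (ler_wpM2l (ltW (a0 k)) (ln_taylor2 zs))).
have -> : a k * (2 * `|x / Num.sqrt (a k)| ^+ 3) = 2 * `|x| ^+ 3 / Num.sqrt (a k).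
  rewrite normrM normfV (gtr0_norm s0) -{1}(sqr_sqrtr (ltW (a0 k))).
  by field; rewrite gt_eqF.
rewrite ler_pdivrMr// -ler_pdivrMl//.
by near: k; exact: sqrt_large.
Unshelve. all: by end_near. Qed.

(** Dominated convergence along sequences tending to infinity; uniformity in a
    follows by contradiction. *)
Lemma std_gamma_L1 (e : R) : 0 < e -> exists2 A : R, 1 <= A & forall a, A <= a ->
  (\int[leb]_x `|std_gamma a x - bell x|%:E <= e%:E)%E.
Proof.
move=> e0; apply: contrapT => noA.
have /choice[a aP] : forall k : nat, exists a : R, k.+1%:R <= a /\
    (e%:E < \int[leb]_x `|std_gamma a x - bell x|%:E)%E.
  move=> k; apply: contrapT => nok; apply: noA; exists k.+1%:R; first by rewrite ler1n.
  move=> a ka; rewrite leNgt; apply/negP => ea; apply: nok; by exists a.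
have ak k : k.+1%:R <= a k := (aP k).1.
have a1 k : 1 <= a k by apply: le_trans (ak k); rewrite ler1n.
have [C C0 CP] := @expRN_le_cauchy R 2^-1 ltac:(by rewrite invr_gt0).
pose g x : \bar R := ((expR 1 * C) * cauchy_weight 1 x)%:E.
have mg : measurable_fun setT g.
  by apply/measurable_EFinP; apply: measurable_funM => //; exact: measurable_cauchy_weight.
have g0 x : (0 <= g x)%E.
  by rewrite lee_fin !mulr_ge0 ?expR_ge0 ?ltW// expR_gt0.
have ig : leb.-integrable setT g.
  apply/integrableP; split => //.
  under eq_integral do rewrite gee0_abs//.
  rewrite /g; under eq_integral do rewrite EFinM.
  rewrite (ge0_integralZl _ measurableT).
  - apply: lte_mul_pinfty; [by rewrite lee_fin mulr_ge0 ?expR_ge0// ltW|by []|].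
    by apply: integral_cauchy_weight_lty; lra.
  - by apply/measurable_EFinP; exact: measurable_cauchy_weight.
  - by move=> x _; rewrite lee_fin cauchy_weight_ge0.
  - by rewrite lee_fin mulr_ge0 ?expR_ge0// ltW.
have mf k : measurable_fun setT (fun x => (std_gamma (a k) x)%:E).
  by apply/measurable_EFinP; exact: measurable_std_gamma.
have mb : measurable_fun setT (fun x => (bell x)%:E).
  by apply/measurable_EFinP; exact: measurable_bell.
have cv : {ae leb, forall x, setT x -> (std_gamma (a k) x)%:E @[k --> \oo] --> (bell x)%:E}.
  by apply: aeW => x _; apply: cvg_EFin; [exact: nearW|exact: std_gamma_cvg].
have dom : {ae leb, forall x k, setT x -> (`|(std_gamma (a k) x)%:E| <= g x)%E}.
  apply: aeW => x k _; rewrite gee0_abs ?lee_fin ?std_gamma_ge0//.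
  apply: (le_trans (std_gamma_le _ (a1 k))).
  rewrite expRD -mulrA ler_pM2l ?expR_gt0// -mulNr.
  apply: (le_trans (CP _ (normr_ge0 _))).
  by rewrite /cauchy_weight real_normK// num_real.
have [_ + _] := @dominated_convergence _ (measurableTypeR R) R leb setT measurableT
  _ _ _ mf mb cv ig dom.
move=> /fine_cvgP[fin /cvgr0Pnorm_lt /(_ _ e0) small].
have [k _ kP] : \forall k \near \oo, (\int[leb]_x `|(std_gamma (a k) x)%:E - (bell x)%:E| < e%:E)%E.
  near=> k.
  have finI : (\int[leb]_x `|(std_gamma (a k) x)%:E - (bell x)%:E|)%E \is a fin_num.
    by near: k; exact: fin.
  rewrite -(fineK finI) lte_fin; apply: le_lt_trans (ler_norm _) _.
  by near: k; exact: small.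
have [_] := aP k; rewrite ltNge => /negP; apply.
have := kP k (leqnn _) => /= /ltW; apply: le_trans.
by rewrite le_eqVlt; apply/orP; left; apply/eqP; apply: eq_integral => x _.
Unshelve. all: by end_near. Qed.

Lemma integral_bell : (\int[leb]_x (bell x)%:E = (Num.sqrt (2 * pi))%:E)%E.
Proof.
have := integral_gauss_affine 0 (@ltr01 R); rewrite sqrtr1 invr1 mulr1 => <-.
by apply: eq_integral => x _; rewrite /bell addr0 mul1r.
Qed.

Lemma normal_prob_bell (B : set R) : measurable B ->
  (normal_prob 0 1 B = (Num.sqrt (2 * pi))^-1%:E * \int[leb]_x ((bell x)%:E * (\1_B x)%:E))%E.
Proof.
move=> mB; rewrite /normal_prob.
have mb : measurable_fun setT (fun x => (bell x)%:E).
  by apply/measurable_EFinP; exact: measurable_bell.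
rewrite -(ge0_integralZl _ measurableT); last 3 first.
- by apply: emeasurable_funM => //; exact/measurable_EFinP/measurable_indic.
- by move=> x _; rewrite mule_ge0// lee_fin bell_ge0.
- by rewrite lee_fin invr_ge0 sqrtr_ge0.
rewrite [LHS]integral_mkcond; apply: eq_integral => x _.
rewrite patchE indicE; case: ifP => _; last by rewrite mule0 mule0.
rewrite mule1 normal_pdfE ?oner_eq0// /normal_peak /normal_fun -EFinM.
rewrite !expr1n mul1r subr0 /bell -[pi *+ 2]mulr_natl; congr (_ * expR _)%:E.
by field.
Qed.

(** Centred at the mode a / c and scaled by the curvature of the logarithm of
    [gamma_dens] at the mode. *)
Definition gamma_z (a c s : R) : R := (c * s - a) / Num.sqrt a.

Lemma gamma_dens_std (a c : R) (h : R -> \bar R) : 0 < a -> 0 < c ->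
  measurable_fun setT h -> (forall x, 0 <= h x)%E ->
  (\int[leb]_s ((gamma_dens a c s)%:E * h (gamma_z a c s)) =
   (Num.sqrt a / c * expR (a * ln (a / c) - a))%:E *
   \int[leb]_x ((std_gamma a x)%:E * h x))%E.
Proof.
move=> a0 c0 mh h0.
have r0 : 0 < Num.sqrt a by rewrite sqrtr_gt0.
have rc0 : 0 < Num.sqrt a / c by rewrite divr_gt0.
have mz : measurable_fun setT (gamma_z a c).
  by apply: measurable_funM => //; apply: measurable_funB => //; exact: measurable_funM.
have mG : measurable_fun setT (fun s => (gamma_dens a c s)%:E * h (gamma_z a c s))%E.
  apply: emeasurable_funM; first by apply/measurable_EFinP; exact: measurable_gamma_dens.
  exact: measurableT_comp.
rewrite -(ge0_integral_affine (a / c) rc0 mG); last first.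
  by move=> s; rewrite mule_ge0// lee_fin gamma_dens_ge0.
rewrite [in RHS]EFinM -muleA; congr (_ * _)%E.
rewrite -(ge0_integralZl _ measurableT); last 3 first.
- apply: emeasurable_funM => //; apply/measurable_EFinP; exact: measurable_std_gamma.
- by move=> x _; rewrite mule_ge0// lee_fin std_gamma_ge0.
- by rewrite lee_fin expR_ge0.
apply: eq_integral => x _.
have r2 : a = Num.sqrt a ^+ 2 by rewrite sqr_sqrtr// ltW.
have sE : Num.sqrt a / c * x + a / c = a / c * (1 + x / Num.sqrt a).
  by rewrite {2 3}r2; field; rewrite !gt_eqF.
have zE : gamma_z a c (Num.sqrt a / c * x + a / c) = x.
  by rewrite /gamma_z; field; rewrite !gt_eqF.
rewrite zE muleA -EFinM; congr (_%:E * _)%E; rewrite sE /std_gamma.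
have ac0 : 0 < a / c by rewrite divr_gt0.
have [z0|z0] := ltP 0 (1 + x / Num.sqrt a); last first.
  rewrite gamma_dens_le0; last by apply/negP; rewrite -leNgt pmulr_rle0.
  by rewrite indicE memNset ?mul0r ?mulr0//= in_itv/= andbT; apply/negP; rewrite -leNgt.
rewrite gamma_dens_gt0; last exact: mulr_gt0.
rewrite indicE mem_set/= ?in_itv/= ?andbT// mul1r -expRD.
have e : c * (a / c * (1 + x / Num.sqrt a)) = a + Num.sqrt a * x.
  transitivity (a + a / Num.sqrt a * x); first by field; rewrite !gt_eqF.
  by rewrite {2}r2 expr2 mulfK ?gt_eqF.
by congr expR; rewrite e lnM ?posrE//; ring.
Qed.

End gamma_normal.

Section posterior_normal.
Context {R : realType}.
Notation leb := (@lebesgue_measure R).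

Lemma le_integral_L1 (f g w : R -> R) (D : R) :
  measurable_fun setT f -> measurable_fun setT g -> measurable_fun setT w ->
  (forall x, 0 <= f x) -> (forall x, 0 <= g x) -> (forall x, 0 <= w x <= 1) ->
  (\int[leb]_x `|f x - g x|%:E <= D%:E)%E ->
  (\int[leb]_x ((f x)%:E * (w x)%:E) <= \int[leb]_x ((g x)%:E * (w x)%:E) + D%:E)%E.
Proof.
move=> mf mg mw f0 g0 w01 fgD.
have w0 x : 0 <= w x by have /andP[] := w01 x.
have mgw : measurable_fun setT (fun x => (g x)%:E * (w x)%:E)%E.
  by apply: emeasurable_funM; exact/measurable_EFinP.
have mfw : measurable_fun setT (fun x => (f x)%:E * (w x)%:E)%E.
  by apply: emeasurable_funM; exact/measurable_EFinP.
have md : measurable_fun setT (fun x => `|f x - g x|%:E).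
  apply/measurable_EFinP; apply: measurableT_comp => //; exact: measurable_funB.
apply: (@le_trans _ _ (\int[leb]_x ((g x)%:E * (w x)%:E + `|f x - g x|%:E)))%E.
  apply: ge0_le_integral => //.
  - by move=> x _; rewrite mule_ge0// lee_fin.
  - exact: emeasurable_funD.
  move=> x _; rewrite -!EFinM -EFinD lee_fin.
  have /andP[wx0 wx1] := w01 x.
  rewrite -lerBlDl -mulrBl; apply: (le_trans (ler_norm _)).
  by rewrite normrM (ger0_norm wx0) ler_piMr.
rewrite ge0_integralD//; first by rewrite leeD2l.
- by move=> x _; rewrite mule_ge0// lee_fin.
Qed.

(** Both numerator and denominator are within the L1 distance of their Gaussian
    counterparts, so the ratio is within a multiple of it. *)
Lemma gamma_ratio_normal (e : R) : 0 < e -> exists2 A : R, 1 <= A &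
  forall a c (B : set R), A <= a -> 0 < c -> measurable B ->
  [/\ (0 < \int[leb]_s (gamma_dens a c s)%:E < +oo)%E,
    (\int[leb]_s ((gamma_dens a c s)%:E * (\1_B (gamma_z a c s))%:E) < +oo)%E &
  `|fine (\int[leb]_s ((gamma_dens a c s)%:E * (\1_B (gamma_z a c s))%:E))%E /
    fine (\int[leb]_s (gamma_dens a c s)%:E)%E - fine (normal_prob 0 1 B)| <= e].
Proof.
move=> e0; pose M : R := Num.sqrt (2 * pi).
have M0 : 0 < M by rewrite sqrtr_gt0 mulr_gt0// pi_gt0.
pose D := Num.min (e * M / 2) (M / 2).
have D0 : 0 < D by rewrite lt_min !divr_gt0// mulr_gt0.
have [A A1 AP] := std_gamma_L1 D0; exists A => // a c B Aa c0 mB.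
have L1 := AP a Aa.
have L1' : (\int[leb]_x `|bell x - std_gamma a x|%:E <= D%:E)%E.
  by under eq_integral do rewrite distrC.
have a0 : 0 < a by apply: lt_le_trans Aa; lra.
have msg := @measurable_std_gamma R a; have mbe := @measurable_bell R.
have key (w : R -> R) : measurable_fun setT w -> (forall x, 0 <= w x <= 1) ->
   exists x X, [/\ (\int[leb]_x ((std_gamma a x)%:E * (w x)%:E) = x%:E)%E,
     (\int[leb]_x ((bell x)%:E * (w x)%:E) = X%:E)%E, 0 <= x & `|x - X| <= D].
  move=> mw w01.
  have w0 x : 0 <= w x by have /andP[] := w01 x.
  have up := le_integral_L1 msg mbe mw (@std_gamma_ge0 R a) (@bell_ge0 R) w01 L1.
  have dn := le_integral_L1 mbe msg mw (@bell_ge0 R) (@std_gamma_ge0 R a) w01 L1'.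
  have bfin : (\int[leb]_x ((bell x)%:E * (w x)%:E) < +oo)%E.
    apply: (@le_lt_trans _ _ (\int[leb]_x (bell x)%:E)%E); last first.
      by rewrite integral_bell ltry.
    apply: ge0_le_integral => //.
    - by move=> x _; rewrite mule_ge0// lee_fin ?bell_ge0.
    - by apply: emeasurable_funM; exact/measurable_EFinP.
    - exact/measurable_EFinP.
    - move=> x _; rewrite -EFinM lee_fin ler_piMr ?bell_ge0//.
      by have /andP[] := w01 x.
  have b0 : (0 <= \int[leb]_x ((bell x)%:E * (w x)%:E))%E.
    by apply: integral_ge0 => x _; rewrite mule_ge0// lee_fin ?bell_ge0.
  have s0 : (0 <= \int[leb]_x ((std_gamma a x)%:E * (w x)%:E))%E.
    by apply: integral_ge0 => x _; rewrite mule_ge0// lee_fin ?std_gamma_ge0.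
  have sfin : (\int[leb]_x ((std_gamma a x)%:E * (w x)%:E) < +oo)%E.
    by apply: le_lt_trans up _; rewrite lte_add_pinfty// ltry.
  move: up dn bfin b0 s0 sfin.
  case: (\int[leb]_x ((std_gamma a x)%:E * (w x)%:E))%E => [x||]//.
  case: (\int[leb]_x ((bell x)%:E * (w x)%:E))%E => [X||]//.
  rewrite -!EFinD !lee_fin => up dn _ _ x0 _; exists x, X; split => //.
  by rewrite ler_distl; lra.
have mi : measurable_fun setT (\1_B : R -> R) by exact: measurable_indic.
have i01 x : 0 <= (\1_B x : R) <= 1.
  by rewrite indicE; case: (_ \in _); rewrite lexx ler01.
have [x [X [xE XE x0 xX]]] := key _ mi i01.
have [y [Y [yE YE y0 yY]]] := key (fun=> 1) (measurable_cst _) (fun=> ltac:(by rewrite ler01 lexx)).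
have YM : Y = M.
  apply: EFin_inj; rewrite -YE -[RHS]integral_bell.
  by apply: eq_integral => z _; rewrite mule1.
have xy : x <= y.
  rewrite -lee_fin -xE -yE; apply: ge0_le_integral => //.
  - by move=> z _; rewrite mule_ge0// lee_fin ?std_gamma_ge0.
  - by apply: emeasurable_funM; exact/measurable_EFinP.
  - by apply: emeasurable_funM; exact/measurable_EFinP.
  - by move=> z _; rewrite -!EFinM lee_fin ler_wpM2l ?std_gamma_ge0.
have Dm2 : D <= M / 2 by rewrite ge_min lexx orbT.
have Dm1 : D <= e * M / 2 by rewrite ge_min lexx.
have ygt0 : 0 < y.
  by move: yY; rewrite YM ler_norml => /andP[]; lra.
set k := Num.sqrt a / c * expR (a * ln (a / c) - a).
have k0 : 0 < k by rewrite mulr_gt0 ?expR_gt0// divr_gt0// sqrtr_gt0.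
have IE : (\int[leb]_s ((gamma_dens a c s)%:E * (\1_B (gamma_z a c s))%:E) = (k * x)%:E)%E.
  rewrite (gamma_dens_std (h := fun z => (\1_B z)%:E))//.
  - by rewrite xE.
  - exact/measurable_EFinP.
have I1 : (\int[leb]_s (gamma_dens a c s)%:E = (k * y)%:E)%E.
  rewrite EFinM -yE -(gamma_dens_std (h := fun=> 1%E))//.
  by apply: eq_integral => s _; rewrite mule1.
rewrite IE I1; split; [by rewrite lte_fin mulr_gt0//= ltry|by rewrite ltry|].
rewrite normal_prob_bell// XE -EFinM /= -/M.
have -> : k * x / (k * y) - M^-1 * X = (x - X) / M + x / y * ((M - y) / M).
  by field; rewrite !gt_eqF.
apply: (le_trans (ler_normD _ _)).
have h1 : `|(x - X) / M| <= e / 2.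
  rewrite normrM normfV (gtr0_norm M0) ler_pdivrMr//.
  by apply: (le_trans xX); lra.
have h2 : `|x / y * ((M - y) / M)| <= e / 2.
  have h3 : `|(M - y) / M| <= e / 2.
    rewrite normrM normfV (gtr0_norm M0) ler_pdivrMr// distrC -YM.
    by apply: (le_trans yY); rewrite YM; lra.
  rewrite normrM; apply: le_trans h3; rewrite ler_piMl//.
  by rewrite ger0_norm ?divr_ge0// ler_pdivrMr// mul1r.
lra.
Qed.

End posterior_normal.

(** * The standard normal distribution function *)
Section std_normal.
Context {R : realType}.
Notation leb := (@lebesgue_measure R).
Notation Phi := (@std_normal_cdf R).

Lemma normal_prob_fin (B : set R) : measurable B -> normal_prob 0 1 B \is a fin_num.
Proof. by move=> mB; exact: fin_num_measure. Qed.

Lemma std_normal_cdf_itv (a b : R) : a <= b ->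
  Phi b - Phi a = fine (normal_prob 0 1 `]a, b]).
Proof.
move=> ab; rewrite /std_normal_cdf.
have -> : `]-oo, b]%classic = `]-oo, a]%classic `|` `]a, b]%classic :> set R.
  apply/seteqP; split => x /=; rewrite !in_itv/=.
    by move=> xb; have [xa|xa] := leP x a; [left|right].
  by case=> [xa|/andP[]//]; exact: le_trans ab.
rewrite measureU//.
- by rewrite fineD ?normal_prob_fin// addrC addKr.
- apply/seteqP; split => x //= -[]; rewrite !in_itv/= => xa /andP[ax _].
  by have := lt_le_trans ax xa; rewrite ltxx.
Qed.

Lemma std_normal_cdf_le (a b : R) : a <= b -> Phi a <= Phi b.
Proof.
move=> ab; rewrite -subr_ge0 std_normal_cdf_itv//; exact: fine_ge0.
Qed.

(** The normal density is bounded by 1. *)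
Lemma std_normal_cdf_lip (a b : R) : a <= b -> Phi b - Phi a <= b - a.
Proof.
move=> ab; rewrite std_normal_cdf_itv// -lee_fin fineK ?normal_prob_fin//.
rewrite normal_prob_bell//.
have M1 : 1 <= Num.sqrt (2 * pi) :> R.
  rewrite -[leLHS]sqrtr1 ler_wsqrtr//; have := @pi_ge2 R; lra.
apply: (@le_trans _ _ (\int[leb]_x (\1_(`]a, b]%classic : set R) x)%:E)%E); last first.
  rewrite integral_indic//= setIT lebesgue_measure_itv/= lte_fin.
  by case: ifP => _; rewrite ?lee_fin// -?EFinD ?lee_fin//; lra.
rewrite -(ge0_integralZl _ measurableT); last 3 first.
- apply: emeasurable_funM; first by apply/measurable_EFinP; exact: measurable_bell.
  by apply/measurable_EFinP; exact: measurable_indic.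
- by move=> x _; rewrite mule_ge0// lee_fin bell_ge0.
- by rewrite lee_fin invr_ge0 sqrtr_ge0.
apply: ge0_le_integral => //.
- by move=> x _; rewrite !mule_ge0// lee_fin ?bell_ge0// invr_ge0 sqrtr_ge0.
- apply: emeasurable_funM => //.
  apply: emeasurable_funM; first by apply/measurable_EFinP; exact: measurable_bell.
  by apply/measurable_EFinP; exact: measurable_indic.
- by apply/measurable_EFinP; exact: measurable_indic.
move=> x _; rewrite -!EFinM lee_fin mulrA ler_piMl//.
rewrite mulr_ile1 ?bell_ge0 ?invr_ge0 ?sqrtr_ge0//.
  by rewrite invf_le1// (lt_le_trans _ M1).
rewrite /bell -expR0 ler_expR mulNr oppr_le0 mulr_ge0 ?sqr_ge0//.
Qed.

Lemma std_normal_cdf_dist (a b : R) : `|Phi a - Phi b| <= `|a - b|.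
Proof.
wlog ab : a b / a <= b => [wh|].
  by have [/wh//|/ltW/wh] := leP a b; rewrite distrC [in leRHS]distrC.
rewrite distrC ger0_norm ?subr_ge0 ?std_normal_cdf_le// distrC ger0_norm ?subr_ge0//.
exact: std_normal_cdf_lip.
Qed.

Lemma normal_prob_reflect (z : R) : fine (normal_prob 0 1 `[z, +oo[) = Phi (- z).
Proof.
rewrite /std_normal_cdf !normal_prob_bell//; congr (fine (_ * _)%E).
have mF : measurable_fun setT (fun x => (bell x)%:E * (\1_(`[z, +oo[%classic : set R) x)%:E)%E.
  apply: emeasurable_funM; first by apply/measurable_EFinP; exact: measurable_bell.
  by apply/measurable_EFinP; exact: measurable_indic.
rewrite -(ge0_integral_reflect 0 mF); last first.
  by move=> x; rewrite mule_ge0// lee_fin bell_ge0.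
apply: eq_integral => x _; rewrite sub0r /bell sqrrN; congr (_ * _%:E)%E.
rewrite !indicE (_ : (- x \in `[z, +oo[%classic) = (x \in `]-oo, - z]%classic))//.
by apply/idP/idP; rewrite !inE/= !in_itv/= andbT lerNr.
Qed.

Lemma std_normal_cdf_tails (e : R) : 0 < e ->
  exists2 L : R, 0 < L & Phi (- L) <= e /\ 1 - Phi L <= e.
Proof.
move=> e0.
pose id_mixin := isMeasurableFun.Build _ _ _ _ (idfun : measurableTypeR R -> R)
  (@measurable_id _ _ setT).
pose X : {mfun measurableTypeR R >-> R} := HB.pack (idfun : measurableTypeR R -> R) id_mixin.
pose N : probability (measurableTypeR R) R := normal_prob 0 1.
have /fine_cvg/cvgr0Pnorm_le/(_ e e0) lo : cdf (X : {RV N >-> R}) @ -oo%R --> 0%E.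
  exact: cvg_cdfNy0.
have /fine_cvg/cvgrPdist_le/(_ e e0) hi : cdf (X : {RV N >-> R}) @ +oo%R --> 1%E.
  exact: cvg_cdfy1.
have [M1 [_ lo1]] := lo; have [M2 [_ hi1]] := hi.
exists (`|M1| + `|M2| + 1); first by rewrite ltr_wpDl// addr_ge0.
set L := _ + _ + _.
have LM1 : - L < M1.
  by have := ler_norm (- M1); rewrite normrN; have := normr_ge0 M2; rewrite /L; lra.
have LM2 : M2 < L.
  by have := ler_norm M2; have := normr_ge0 M1; rewrite /L; lra.
split.
  by have := lo1 _ LM1; apply: le_trans; exact: ler_norm.
by have := hi1 _ LM2; apply: le_trans; exact: ler_norm.
Qed.

Lemma std_normal_cdf01 (x : R) : 0 <= Phi x <= 1.
Proof.
rewrite fine_ge0//= -lee_fin fineK ?normal_prob_fin//; exact: probability_le1.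
Qed.

(** Polya's theorem in finite form: outside [- L, L] both functions are close to
    0 or 1, and inside a grid of mesh e suffices because Phi is
    1-Lipschitz.  The grid depends on e only, hence is common to all posteriors. *)
Lemma polya_grid (e : R) : 0 < e -> exists s : seq R, forall H : R -> R,
  (forall x y, x <= y -> H x <= H y) -> (forall x, 0 <= H x <= 1) ->
  (forall t, t \in s -> `|H t - Phi t| <= e) ->
  forall t, `|H t - Phi t| <= 2 * e.
Proof.
move=> e0; have [L L0 [PL PL']] := std_normal_cdf_tails e0.
pose m := (Num.truncn (2 * L / e)).+1.
have mP : 2 * L < m%:R * e by rewrite -ltr_pdivrMr//; exact: truncnS_gt.
pose g (i : nat) : R := - L + i%:R * e.
exists [seq g i | i <- iota 0 m.+1] => H Hmon H01 Hs t.
have Hg i : (i <= m)%N -> `|H (g i) - Phi (g i)| <= e.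
  by move=> im; apply: Hs; apply: map_f; rewrite mem_iota.
have /andP[H0 H1] := H01 t; have /andP[P0 P1] := std_normal_cdf01 t.
have [tL|Lt] := ltP t (g 0).
  have := Hg 0 isT; have := Hmon _ _ (ltW tL); have := std_normal_cdf_le (ltW tL).
  have -> : g 0 = - L by rewrite /g mul0r addr0.
  rewrite ler_norml => h1 h2 /andP[h3 h4]; rewrite ler_norml; apply/andP; split; lra.
have [tm|mt] := ltP t (g m).
  pose i := Num.truncn ((t + L) / e).
  have tL0 : 0 <= (t + L) / e.
    by rewrite divr_ge0 ?(ltW e0)//; move: Lt; rewrite /g mul0r addr0; lra.
  have gi : g i <= t.
    have : i%:R <= (t + L) / e by rewrite /i truncn_le.
    by rewrite ler_pdivlMr// /g; lra.
  have gi1 : t <= g i.+1.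
    have : (t + L) / e < i.+1%:R by exact: truncnS_gt.
    by rewrite ltr_pdivrMr// /g; lra.
  have im : (i < m)%N.
    rewrite ltnNge; apply/negP => mi.
    have : g m <= g i by rewrite /g lerD2l ler_pM2r// ler_nat.
    by move=> /le_trans /(_ gi); rewrite leNgt tm.
  have := Hg i (ltnW im); have := Hg i.+1 im.
  have := Hmon _ _ gi; have := Hmon _ _ gi1.
  have := std_normal_cdf_le gi; have := std_normal_cdf_le gi1.
  have gg : g i <= g i.+1 by exact: le_trans gi1.
  have := std_normal_cdf_lip gg.
  have -> : g i.+1 - g i = e by rewrite /g -natr1; ring.
  rewrite !ler_norml => h1 h2 h3 h4 h5 /andP[h6 h7] /andP[h8 h9].
  by apply/andP; split; lra.
have Lm : L <= g m by rewrite /g; lra.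
have := Hg m (leqnn m); have := Hmon _ _ mt; have := std_normal_cdf_le mt.
have := std_normal_cdf_le Lm.
rewrite !ler_norml => h0 h1 h2 /andP[h3 h4]; apply/andP; split; lra.
Qed.

End std_normal.

(** * Standardized thresholds *)
Section thresholds.
Context {R : realType}.

Lemma cvg_bounded_mul0 {I : Type} (F : set_system I) {FF : Filter F} (K : R) (g u : I -> R) :
  (\forall i \near F, `|g i| <= K) -> u i @[i --> F] --> 0 ->
  g i * u i @[i --> F] --> (0 : R).
Proof.
move=> gK /cvgr0Pnorm_le u0; apply/cvgr0Pnorm_le => e e0.
have K0 : 0 < `|K| + 1 by rewrite ltr_wpDl.
near=> i.
have gi : `|g i| <= `|K| + 1.
  by apply: (@le_trans _ _ K); [near: i|rewrite (le_trans (ler_norm _))// lerDl].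
have ui : `|u i| <= e / (`|K| + 1) by near: i; apply: u0; rewrite divr_gt0.
rewrite normrM; apply: (le_trans (ler_pM _ _ gi ui)) => //.
by rewrite mulrC divfK// gt_eqF.
Unshelve. all: by end_near. Qed.

Lemma cvg_sqrtV {I : Type} (F : set_system I) {FF : Filter F} (n : I -> nat) :
  (forall N, \forall i \near F, (N <= n i)%N) ->
  (Num.sqrt (n i)%:R)^-1 @[i --> F] --> (0 : R).
Proof.
move=> nF; apply/cvgr0Pnorm_le => e e0; near=> i.
have ni : (Num.truncn (e^-1 ^+ 2) < n i)%N by near: i; exact: nF.
have ni1 : e^-1 ^+ 2 < (n i)%:R.
  by apply: lt_le_trans (truncnS_gt _) _; rewrite ler_nat.
have eV : 0 < e^-1 by rewrite invr_gt0.
have s0 : e^-1 <= Num.sqrt (n i)%:R.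
  rewrite -[leLHS](ger0_norm (ltW eV)) -sqrtr_sqr ler_wsqrtr// ltW//.
have sp := lt_le_trans eV s0.
rewrite ger0_norm; last by rewrite invr_ge0 ltW.
by rewrite -[e]invrK lef_pV2.
Unshelve. all: by end_near. Qed.

(** End point of the first event in the [gamma_z] scale, with T = v'Sv / v'Sigma v
    and ka = |v|^2 / v'Sigma v. *)
Definition z_inv (n : nat) (b T ka t : R) : R :=
  let al := (n%:R + b - 2) / 2 in
  (2^-1 * (ka + n%:R * T) / (T + Num.sqrt 2 * t / Num.sqrt n%:R) - al) / Num.sqrt al.

(** End point of the second event in the [gamma_z] scale, with
    W = v'Sigma^-1 v / v'S^-1 v and rho the difference v'S^-1 v / v'A^-1 v - n. *)
Definition z_dir (n : nat) (p b W rho t : R) : R :=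
  let al := (n%:R + b + p - 3) / 2 in
  (2^-1 * (n%:R + rho) * (1 + Num.sqrt 2 * t / Num.sqrt n%:R * W) - al) / Num.sqrt al.

Lemma sqrt_half : Num.sqrt (2^-1 : R) = (Num.sqrt 2)^-1.
Proof. by rewrite sqrtrV. Qed.

(** Dividing numerator and denominator by sqrt n turns the threshold into a
    continuous function of quantities that converge. *)
Lemma cvg_z_inv {I : Type} (F : set_system I) {FF : Filter F} (n : I -> nat)
    (b T ka : I -> R) (K Bd t : R) :
  (forall N, \forall i \near F, (N <= n i)%N) -> T i @[i --> F] --> (1 : R) ->
  (forall i, 0 <= ka i <= K) -> (forall i, 1 <= b i <= Bd) ->
  (z_inv (n i) (b i) (T i) (ka i) t @[i --> F] --> - t) /\
  \forall i \near F, 0 < T i + Num.sqrt 2 * t / Num.sqrt (n i)%:R.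
Proof.
move=> nF T1 kaK bB.
pose u i : R := (Num.sqrt (n i)%:R)^-1.
have u0 : u i @[i --> F] --> (0 : R) by exact: cvg_sqrtV.
pose A i : R := 2^-1 * (1 + (b i - 2) * u i * u i).
have bu : (b i - 2) * u i @[i --> F] --> (0 : R).
  apply: (@cvg_bounded_mul0 _ _ _ (Bd + 2)) => //.
  by near=> i; have := bB i; rewrite ler_norml => /andP[? ?]; apply/andP; split; lra.
have ku : ka i * u i @[i --> F] --> (0 : R).
  apply: (@cvg_bounded_mul0 _ _ _ K) => //.
  by near=> i; have /andP[k0 kK] := kaK i; rewrite ger0_norm.
have A2 : A i @[i --> F] --> (2^-1 : R).
  rewrite (_ : (2^-1 : R) = 2^-1 * (1 + 0 * 0)); last by rewrite mulr0 addr0 mulr1.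
  apply: cvgM; first exact: cvg_cst.
  by apply: cvgD; [exact: cvg_cst|exact: cvgM].
have sA : Num.sqrt (A i) @[i --> F] --> ((Num.sqrt 2)^-1 : R).
  rewrite -sqrt_half; apply: continuous_cvg => //; exact: sqrt_continuous.
have TW : T i + Num.sqrt 2 * t * u i @[i --> F] --> (1 : R).
  have : T i + Num.sqrt 2 * t * u i @[i --> F] --> (1 + Num.sqrt 2 * t * 0 : R).
    apply: cvgD; [exact: T1|apply: cvgM; [exact: cvg_cst|exact: u0]].
  by rewrite mulr0 addr0.
have s20 : 0 < Num.sqrt 2 :> R by rewrite sqrtr_gt0.
have s22 : Num.sqrt 2 * Num.sqrt 2 = 2 :> R by rewrite -expr2 sqr_sqrtr.
have Tw0 : \forall i \near F, 0 < T i + Num.sqrt 2 * t * u i.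
  by apply: (cvgr_gt 1 TW); exact: ltr01.
split => //.
have cz : (ka i * u i - (b i - 2) * u i * T i - 2 * (Num.sqrt 2 * t) * A i) /
    (2 * Num.sqrt (A i) * (T i + Num.sqrt 2 * t * u i)) @[i --> F] --> (- t : R).
  have -> : - t = (0 - 0 * 1 - 2 * (Num.sqrt 2 * t) * 2^-1) / (2 * (Num.sqrt 2)^-1 * 1).
    have e : (2 : R) = Num.sqrt 2 ^+ 2 by rewrite expr2 s22.
    by rewrite [X in _ / (X * _ * _)]e; field; rewrite gt_eqF.
  apply: cvgM.
    apply: cvgB; last by apply: cvgM => //; exact: cvg_cst.
    by apply: cvgB => //; exact: cvgM.
  apply: cvgV; first by rewrite mulr1 mulf_neq0// invr_eq0 gt_eqF.
  by apply: cvgM => //; apply: cvgM => //; exact: cvg_cst.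
apply: cvg_trans cz; apply: near_eq_cvg; near=> i.
have n1 : (1 < n i)%N by near: i; exact: nF.
have nR : 1 < (n i)%:R :> R by rewrite ltr1n.
have n0 : 0 < (n i)%:R :> R by lra.
have r0 : 0 < Num.sqrt (n i)%:R :> R by rewrite sqrtr_gt0.
have r2 : (n i)%:R = Num.sqrt (n i)%:R ^+ 2 :> R by rewrite sqr_sqrtr// ltW.
have Tw : 0 < T i + Num.sqrt 2 * t * u i.
  by near: i.
have al0 : 0 < ((n i)%:R + b i - 2) / 2 by have := bB i; move=> /andP[? ?]; rewrite divr_gt0//; lra.
have AE : A i = ((n i)%:R + b i - 2) / 2 / (n i)%:R.
  by rewrite /A /u [in RHS]r2; field; rewrite gt_eqF.
have A0 : 0 < A i by rewrite AE divr_gt0.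
have sAE : Num.sqrt (((n i)%:R + b i - 2) / 2) = Num.sqrt (A i) * Num.sqrt (n i)%:R.
  by rewrite -sqrtrM ?ltW// AE divfK// gt_eqF.
rewrite /z_inv sAE -/(u i).
have -> : ((n i)%:R + b i - 2) / 2 = A i * (n i)%:R by rewrite AE divfK// gt_eqF.
have bE : b i - 2 = (2 * A i - 1) * (n i)%:R by rewrite AE; field; rewrite gt_eqF.
rewrite bE.
have -> : u i = (Num.sqrt (n i)%:R)^-1 by [].
have sA0 : 0 < Num.sqrt (A i) by rewrite sqrtr_gt0.
move: Tw; rewrite /u r2 sqrtr_sqr (gtr0_norm r0); move: r0 sA0.
move: (Num.sqrt (n i)%:R) (Num.sqrt (A i)) (A i) => r sa a r0 sa0 Tw.
field; rewrite !gt_eqF//=.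
by have := mulr_gt0 Tw r0; rewrite mulrDl divfK ?gt_eqF.
Unshelve. all: by end_near. Qed.

Lemma cvg_z_dir {I : Type} (F : set_system I) {FF : Filter F} (n : I -> nat)
    (b p W rho : I -> R) (K Bd t : R) :
  (forall N, \forall i \near F, (N <= n i)%N) -> W i @[i --> F] --> (1 : R) ->
  (forall i, 0 <= rho i <= K) -> (forall i, 1 <= b i <= Bd) -> (forall i, 0 <= p i) ->
  p i / Num.sqrt (n i)%:R @[i --> F] --> (0 : R) ->
  z_dir (n i) (p i) (b i) (W i) (rho i) t @[i --> F] --> t.
Proof.
move=> nF W1 rK bB p0 pF.
pose u i : R := (Num.sqrt (n i)%:R)^-1.
have u0 : u i @[i --> F] --> (0 : R) by exact: cvg_sqrtV.
have pu : p i * u i @[i --> F] --> (0 : R) by exact: pF.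
pose A i : R := 2^-1 * (1 + (b i - 3) * u i * u i + p i * u i * u i).
have bu : (b i - 3) * u i @[i --> F] --> (0 : R).
  apply: (@cvg_bounded_mul0 _ _ _ (Bd + 3)) => //.
  by near=> i; have := bB i; rewrite ler_norml => /andP[? ?]; apply/andP; split; lra.
have ru : rho i * u i @[i --> F] --> (0 : R).
  apply: (@cvg_bounded_mul0 _ _ _ K) => //.
  by near=> i; have /andP[k0 kK] := rK i; rewrite ger0_norm.
have A2 : A i @[i --> F] --> (2^-1 : R).
  have : A i @[i --> F] --> (2^-1 * (1 + 0 * 0 + 0 * 0) : R).
    apply: cvgM; [exact: cvg_cst|apply: cvgD; last exact: cvgM].
    by apply: cvgD; [exact: cvg_cst|exact: cvgM].
  by rewrite mulr0 !addr0 mulr1.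
have sA : Num.sqrt (A i) @[i --> F] --> ((Num.sqrt 2)^-1 : R).
  rewrite -sqrt_half; apply: continuous_cvg => //; exact: sqrt_continuous.
have s20 : 0 < Num.sqrt 2 :> R by rewrite sqrtr_gt0.
have s22 : Num.sqrt 2 * Num.sqrt 2 = 2 :> R by rewrite -expr2 sqr_sqrtr.
have A0 : \forall i \near F, 0 < A i.
  by apply: (cvgr_gt (2^-1 : R) A2); rewrite invr_gt0.
have cz : (2^-1 * (rho i * u i - (b i - 3) * u i - p i * u i) +
    2^-1 * (Num.sqrt 2 * t) * W i * (1 + rho i * u i * u i)) / Num.sqrt (A i)
    @[i --> F] --> (t : R).
  have tE : (2^-1 * (0 - 0 - 0) + 2^-1 * (Num.sqrt 2 * t) * 1 * (1 + 0 * 0)) /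
      (Num.sqrt 2)^-1 = t.
    rewrite mulr0 addr0 !mulr1 !subr0 mulr0 add0r invrK -mulrA [_ * t * _]mulrAC s22.
    by rewrite mulrA mulVf ?mul1r.
  rewrite -[X in _ --> X]tE.
  apply: cvgM; last by apply: cvgV => //; rewrite invr_eq0 gt_eqF.
  apply: cvgD.
    by apply: cvgM; [exact: cvg_cst|apply: cvgB => //; exact: cvgB].
  apply: cvgM; first by apply: cvgM => //; exact: cvg_cst.
  by apply: cvgD; [exact: cvg_cst|exact: cvgM].
apply: cvg_trans cz; apply: near_eq_cvg; near=> i.
have n3 : (3 < n i)%N by near: i; exact: nF.
have n0 : 0 < (n i)%:R :> R by rewrite ltr0n; lia.
have r0 : 0 < Num.sqrt (n i)%:R :> R by rewrite sqrtr_gt0.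
have r2 : (n i)%:R = Num.sqrt (n i)%:R ^+ 2 :> R by rewrite sqr_sqrtr// ltW.
have Ai0 : 0 < A i by near: i.
have AE : A i = ((n i)%:R + b i + p i - 3) / 2 / (n i)%:R.
  by rewrite /A /u [in RHS]r2; field; rewrite gt_eqF.
have sAE : Num.sqrt (((n i)%:R + b i + p i - 3) / 2) = Num.sqrt (A i) * Num.sqrt (n i)%:R.
  by rewrite -sqrtrM ?ltW// AE divfK// gt_eqF.
rewrite /z_dir sAE.
have -> : u i = (Num.sqrt (n i)%:R)^-1 by [].
have sA0 : 0 < Num.sqrt (A i) by rewrite sqrtr_gt0.
rewrite r2 sqrtr_sqr (gtr0_norm r0); move: r0 sA0.
move: (Num.sqrt (n i)%:R) (Num.sqrt (A i)) => r sa r0 sa0.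
by field; rewrite !gt_eqF.
Unshelve. all: by end_near. Qed.

Section uniform.
Context (K Bd : R).

(** The parameters range over a set, not a sequence.  The sets that
    contain all parameters with n large and T close to 1 form a filter, and
    the convergence lemma along this filter is the uniform statement. *)
Lemma z_inv_uniform (t e : R) : 0 < e -> exists2 de : R, 0 < de &
  exists N : nat, forall (n : nat) (b T ka : R), (N <= n)%N -> `|T - 1| <= de ->
    0 <= ka <= K -> 1 <= b <= Bd ->
  0 < T + Num.sqrt 2 * t / Num.sqrt n%:R /\ `|z_inv n b T ka t + t| <= e.
Proof.
move=> e0.
pose J := {x : nat * R * R * R | 0 <= x.1.2 <= K /\ 1 <= x.2 <= Bd}.
pose n (i : J) := (sval i).1.1.1; pose T (i : J) := (sval i).1.1.2.
pose ka (i : J) := (sval i).1.2; pose b (i : J) := (sval i).2.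
pose F : set_system J := [set A | exists2 de : R, 0 < de & exists N : nat,
  forall i, (N <= n i)%N -> `|T i - 1| <= de -> A i].
have FF : Filter F.
  split.
  - by exists 1 => //; exists 0%N.
  - move=> A B [d1 d10 [N1 H1]] [d2 d20 [N2 H2]]; exists (Num.min d1 d2).
      by rewrite lt_min d10.
    exists (maxn N1 N2) => i; rewrite geq_max le_min => /andP[? ?] /andP[? ?].
    by split; [exact: H1|exact: H2].
  - by move=> A B AB [d1 d10 [N1 H1]]; exists d1 => //; exists N1 => i ? ?; apply: AB; exact: H1.
have nF N : \forall i \near F, (N <= n i)%N by exists 1 => //; exists N.
have TF : T i @[i --> F] --> (1 : R).
  apply/cvgrPdist_le => d d0; exists d => //; exists 0%N => i _ /=.
  by rewrite distrC.
have [] := @cvg_z_inv J F FF n b T ka K Bd t nF TF (fun i => (svalP i).1) (fun i => (svalP i).2).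
move=> /cvgrPdist_le /(_ e e0) H1 H2.
have [de de0 [N HN]] : F (fun i => 0 < T i + Num.sqrt 2 * t / Num.sqrt (n i)%:R /\
   `|- t - z_inv (n i) (b i) (T i) (ka i) t| <= e) by exact: filterI.
exists de => //; exists N => n1 b1 T1 ka1 Nn Td kK bB.
have [h1 h2] := HN (exist _ (n1, T1, ka1, b1) (conj kK bB)) Nn Td; split => //.
by rewrite -normrN opprD addrC.
Qed.

Lemma z_dir_uniform (t e : R) : 0 < e -> exists2 de : R, 0 < de &
  exists N : nat, forall (n : nat) (p b W rho : R), (N <= n)%N -> `|W - 1| <= de ->
    0 <= p -> p / Num.sqrt n%:R <= de ->
    0 <= rho <= K -> 1 <= b <= Bd -> `|z_dir n p b W rho t - t| <= e.
Proof.
move=> e0.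
pose J := {x : nat * R * R * R * R | [/\ 0 <= x.1.2 <= K, 1 <= x.2 <= Bd & 0 <= x.1.1.2]}.
pose n (i : J) := (sval i).1.1.1.1; pose W (i : J) := (sval i).1.1.1.2.
pose p (i : J) := (sval i).1.1.2; pose rho (i : J) := (sval i).1.2; pose b (i : J) := (sval i).2.
pose F : set_system J := [set A | exists2 de : R, 0 < de & exists N : nat,
  forall i, (N <= n i)%N -> `|W i - 1| <= de -> p i / Num.sqrt (n i)%:R <= de -> A i].
have FF : Filter F.
  split.
  - by exists 1 => //; exists 0%N.
  - move=> A B [d1 d10 [N1 H1]] [d2 d20 [N2 H2]]; exists (Num.min d1 d2).
      by rewrite lt_min d10.
    exists (maxn N1 N2) => i; rewrite geq_max !le_min => /andP[? ?] /andP[? ?] /andP[? ?].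
    by split; [exact: H1|exact: H2].
  - by move=> A B AB [d1 d10 [N1 H1]]; exists d1 => //; exists N1 => i ? ? ?; apply: AB; exact: H1.
have nF N : \forall i \near F, (N <= n i)%N by exists 1 => //; exists N.
have WF : W i @[i --> F] --> (1 : R).
  apply/cvgrPdist_le => d d0; exists d => //; exists 0%N => i _ /=.
  by rewrite distrC.
have p0 i : 0 <= p i by have [] := svalP i.
have pF : p i / Num.sqrt (n i)%:R @[i --> F] --> (0 : R).
  apply/cvgr0Pnorm_le => d d0; exists d => //; exists 0%N => i _ _ /=.
  by rewrite ger0_norm// divr_ge0// sqrtr_ge0.
have rK i : 0 <= rho i <= K by have [] := svalP i.
have bB i : 1 <= b i <= Bd by have [] := svalP i.
have := @cvg_z_dir J F FF n b p W rho K Bd t nF WF rK bB p0 pF.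
move=> /cvgrPdist_le /(_ e e0) [de de0 [N HN]].
exists de => //; exists N => n1 p1 b1 W1 rho1 Nn Wd p10 pd kK b1B.
have := HN (exist _ (n1, W1, p1, rho1, b1) (And3 kK b1B p10)) Nn Wd pd.
by rewrite distrC.
Qed.

End uniform.

End thresholds.

(** * Posterior probabilities as gamma probabilities *)
Section posterior_cdf.
Context {R : realType}.

Section sample_covariance.
Context (p n : nat) (x : 'I_n -> 'cV[R]_p).
Let S := sample_covariance x.

Lemma quad_form_sample u : quad_form S u = n%:R^-1 * \sum_i dotmx u (x i) ^+ 2.
Proof.
rewrite /S /sample_covariance quad_form_scalemx quad_form_dot mulmx_suml.
rewrite {1}/dotmx mulmx_sumr summxE; congr (_ * _); apply: eq_bigr => i _.
by rewrite -[LHS]/(dotmx u (x i *m (x i)^T *m u)) -quad_form_dot quad_form_rank1 dotmxC.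
Qed.

Lemma sample_covariance_sym : S^T = S.
Proof.
rewrite /S /sample_covariance linearZ/= raddf_sum/=; congr (_ *: _).
by apply: eq_bigr => i _; rewrite trmx_mul trmxK.
Qed.

Lemma sample_covariance_psd : psd_mx p S.
Proof.
split; first exact: sample_covariance_sym.
move=> u; rewrite quad_form_sample mulr_ge0// sumr_ge0// => i _; exact: sqr_ge0.
Qed.

Lemma tr_mul_sample_ge0 Om : psd_mx p Om -> 0 <= \tr (Om *m S).
Proof.
move=> [_ O0]; rewrite /S /sample_covariance -scalemxAr mxtraceZ mulmx_sumr raddf_sum/=.
by rewrite mulr_ge0// sumr_ge0// => i _; rewrite mxtrace_mul_rank1.
Qed.

(** The scale matrix A of the posterior. *)
Definition post_scale : 'M[R]_p := 1%:M + n%:R *: S.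

Lemma quad_form_post_scale u : quad_form post_scale u = dotmx u u + n%:R * quad_form S u.
Proof. by rewrite quad_form_addmx quad_form1 quad_form_scalemx. Qed.

Lemma post_scale_pd : pd_mx p post_scale.
Proof.
split; first by rewrite linearD/= trmx1 linearZ/= sample_covariance_sym.
move=> u u0; rewrite quad_form_post_scale ltr_pwDl ?dotmx_gt0// mulr_ge0//.
by have [_] := sample_covariance_psd; apply.
Qed.

Context (b : nat) (p0 : (0 < p)%N) (b0 : (1 <= b)%N).
Let post := posterior (wishart_prior p b) n S.

Lemma posterior_le (B B' : set 'M[R]_p) : measurable B -> measurable B' ->
  B `<=` B' -> post B <= post B'.
Proof.
move=> mB mB' BB'.
rewrite /post; have [fin ->] := @posteriorE R p b n p0 b0 S _ mB tr_mul_sample_ge0.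
have [_ ->] := @posteriorE R p b n p0 b0 S _ mB' tr_mul_sample_ge0.
have mc : measurable_fun setT (fun Om : 'M[R]_p =>
    (cone_dens ((n%:R + b%:R - 2) / 2) (1%:M + n%:R *: S) Om)%:E).
  by apply/measurable_EFinP; exact: measurable_cone_dens.
have mi (C : set 'M[R]_p) : measurable C -> measurable_fun setT (fun Om : 'M[R]_p => (\1_C Om)%:E : \bar R).
  by move=> mC; apply/measurable_EFinP; exact: measurable_indic.
have ge0 (C : set 'M[R]_p) Om : (0 <= (cone_dens ((n%:R + b%:R - 2) / 2) (1%:M + n%:R *: S) Om)%:E * (\1_C Om)%:E)%E.
  by rewrite mule_ge0// lee_fin ?cone_dens_ge0.
have fin_lt (C : set 'M[R]_p) : measurable C -> (\int[lebesgue_sym p]_Om ((cone_dens ((n%:R + b%:R - 2) / 2) (1%:M + n%:R *: S) Om)%:E * (\1_C Om)%:E) < +oo)%E.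
  move=> mC; apply: le_lt_trans fin; apply: ge0_le_integral => //.
  - by apply: emeasurable_funM => //; exact: mi.
  - move=> Om _; rewrite -EFinM lee_fin ler_piMr ?cone_dens_ge0//.
rewrite ler_wpM2r ?invr_ge0 ?fine_ge0//.
  by apply: integral_ge0 => Om _; rewrite lee_fin cone_dens_ge0.
apply: fine_le; rewrite ?ge0_fin_numE ?fin_lt ?integral_ge0//.
apply: ge0_le_integral => //.
- by apply: emeasurable_funM => //; exact: mi.
- by apply: emeasurable_funM => //; exact: mi.
move=> Om _; rewrite -!EFinM lee_fin ler_wpM2l ?cone_dens_ge0//.
rewrite !indicE; have [OB|] := boolP (Om \in B); last by [].
by rewrite mem_set// ; apply: BB'; move: OB; rewrite inE.
Qed.

Lemma posterior01 (B : set 'M[R]_p) : measurable B -> 0 <= post B <= 1.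
Proof.
move=> mB; apply/andP; split.
  rewrite /post; have [fin ->] := @posteriorE R p b n p0 b0 S _ mB tr_mul_sample_ge0.
  rewrite divr_ge0// fine_ge0// integral_ge0// => Om _; last by rewrite lee_fin cone_dens_ge0.
  by rewrite mule_ge0// lee_fin ?cone_dens_ge0.
apply: (@le_trans _ _ (post setT)); first exact: posterior_le.
rewrite /post; have [fin ->] := @posteriorE R p b n p0 b0 S _ measurableT tr_mul_sample_ge0.
under eq_integral do rewrite indicT mule1.
have [->|nz] := eqVneq (fine (\int[lebesgue_sym p]_Om (cone_dens ((n%:R + b%:R - 2) / 2) (1%:M + n%:R *: S) Om)%:E))%E 0.
  by rewrite mul0r.
by rewrite divff.
Qed.

Lemma fine_cross_ratio (I G W H : \bar R) : (0 < W < +oo)%E -> (0 < G < +oo)%E ->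
  (0 <= I < +oo)%E -> (0 <= H < +oo)%E -> (I * G = W * H)%E -> fine I / fine W = fine H / fine G.
Proof.
move=> /andP[W0 Wy] /andP[G0 Gy] /andP[I0 Iy] /andP[H0 Hy].
have toE (z : \bar R) : (0 <= z < +oo)%E -> z = (fine z)%:E.
  by move=> /andP[z0 zy]; rewrite fineK// ge0_fin_numE.
have w0 : 0 < fine W by rewrite fine_gt0// W0.
have g0 : 0 < fine G by rewrite fine_gt0// G0.
rewrite (toE I) ?I0// (toE G) ?(ltW G0)// (toE W) ?(ltW W0)// (toE H) ?H0//= -!EFinM => -[E].
by apply/eqP; rewrite eqr_div ?(gt_eqF w0) ?(gt_eqF g0)// E mulrC.
Qed.

(** Normalizes the identities [pivot_law] and [quad_law]: phi is the functional,
    C the half-line to which the event B corresponds. *)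
Lemma posterior_law (B : set 'M[R]_p) (al c : R) (phi : 'M[R]_p -> R) (C : set R) :
  measurable B -> measurable C ->
  (0 < \int[@lebesgue_measure R]_s (gamma_dens al c s)%:E < +oo)%E ->
  (\int[@lebesgue_measure R]_s ((gamma_dens al c s)%:E * (\1_C (gamma_z al c s))%:E) < +oo)%E ->
  (forall Om, pd_mx p Om -> B Om <-> C (gamma_z al c (phi Om))) ->
  (forall h : R -> \bar R, measurable_fun setT h -> (forall z, 0 <= h z)%E ->
  \int[lebesgue_sym p]_Om ((cone_dens ((n%:R + b%:R - 2) / 2) post_scale Om)%:E * h (phi Om)) *
     \int[@lebesgue_measure R]_s (gamma_dens al c s)%:E =
   \int[lebesgue_sym p]_Om (cone_dens ((n%:R + b%:R - 2) / 2) post_scale Om)%:E *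
     \int[@lebesgue_measure R]_s ((gamma_dens al c s)%:E * h s))%E ->
  post B = fine (\int[@lebesgue_measure R]_s ((gamma_dens al c s)%:E * (\1_C (gamma_z al c s))%:E))%E /
    fine (\int[@lebesgue_measure R]_s (gamma_dens al c s)%:E)%E.
Proof.
move=> mB mC /andP[g0 gy] gCy BC law.
rewrite /post; have [fin ->] := @posteriorE R p b n p0 b0 S _ mB tr_mul_sample_ge0.
rewrite -/post_scale.
have mz : measurable_fun setT (gamma_z al c).
  by apply: measurable_funM => //; apply: measurable_funB => //; exact: measurable_funM.
have := law (fun s => (\1_C (gamma_z al c s))%:E).
rewrite (_ : (\int[lebesgue_sym p]_Om _ = \int[lebesgue_sym p]_Om
   ((cone_dens ((n%:R + b%:R - 2) / 2) post_scale Om)%:E * (\1_B Om)%:E))%E); last first.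
  apply: eq_integral => Om _; have [Opd|nO] := pselect (pd_mx p Om); last first.
    by rewrite /cone_dens indicE memNset// mul0r !mul0e.
  congr (_ * _%:E)%E; rewrite !indicE; congr (_%:R); congr nat_of_bool.
  by apply/idP/idP; rewrite !inE => /(BC _ Opd).
have pos := @cone_dens_gt0 R p ((n%:R + b%:R - 2) / 2) post_scale.
move=> H.
apply: fine_cross_ratio.
- by rewrite pos.
- by rewrite g0.
- apply/andP; split.
    by apply: integral_ge0 => Om _; rewrite mule_ge0// lee_fin ?cone_dens_ge0.
  apply: le_lt_trans fin; apply: ge0_le_integral => //.
  + by move=> Om _; rewrite mule_ge0// lee_fin ?cone_dens_ge0.
  + by apply: emeasurable_funM; apply/measurable_EFinP; [exact: measurable_cone_dens|exact: measurable_indic].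
  + by apply/measurable_EFinP; exact: measurable_cone_dens.
  + by move=> Om _; rewrite -EFinM lee_fin ler_piMr ?cone_dens_ge0.
- rewrite gCy andbT; apply: integral_ge0 => s _.
  by rewrite mule_ge0// lee_fin ?gamma_dens_ge0.
- refine (H _ _); last by move=> z; rewrite lee_fin.
  by apply/measurable_EFinP; apply: (measurableT_comp (measurable_indic mC) mz).
Qed.

End sample_covariance.
End posterior_cdf.

(** * Normal approximation of the two posterior marginals *)
Section marginals.
Context {R : realType}.
Notation Phi := (@std_normal_cdf R).

Lemma finite_uniform (Q : R -> nat -> R -> Prop) :
  (forall d d' N N' t, d' <= d -> (N <= N')%N -> Q d N t -> Q d' N' t) ->
  (forall t, exists2 d : R, 0 < d & exists N, Q d N t) ->
  forall s : seq R, exists2 d : R, 0 < d & exists N, forall t, t \in s -> Q d N t.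
Proof.
move=> mono HQ; elim=> [|t s [d d0 [N HN]]]; first by exists 1 => //; exists 0%N.
have [d' d'0 [N' HN']] := HQ t; exists (Num.min d d'); first by rewrite lt_min d0.
exists (maxn N N') => u; rewrite inE => /orP[/eqP->|us].
  by apply: mono HN'; [rewrite ge_min lexx orbT|exact: leq_maxr].
by apply: mono (HN _ us); [rewrite ge_min lexx|exact: leq_maxl].
Qed.

Lemma measurable_sublevel p (f : 'M[R]_p -> R) t : measurable_fun setT f ->
  measurable [set Om | f Om <= t].
Proof.
move=> mf; rewrite (_ : [set _ | _] = f @^-1` `]-oo, t]%classic).
  by rewrite -[X in measurable X]setTI; exact: mf.
by apply/seteqP; split => Om /=; rewrite in_itv/=.
Qed.

Definition inv_event p n (x : 'I_n -> 'cV[R]_p) (v : 'cV[R]_p) (sg t : R) : set 'M[R]_p :=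
  [set Om | Num.sqrt n%:R * (quad_form (invmx Om) v - quad_form (sample_covariance x) v) /
     (Num.sqrt 2 * `|sg|) <= t].

Definition dir_event p n (x : 'I_n -> 'cV[R]_p) (v : 'cV[R]_p) (om t : R) : set 'M[R]_p :=
  [set Om | Num.sqrt n%:R * (quad_form Om v - quad_form (invmx (sample_covariance x)) v) /
     (Num.sqrt 2 * `|om|) <= t].

Lemma measurable_inv_event p n (x : 'I_n -> 'cV[R]_p) v sg t : measurable (inv_event x v sg t).
Proof.
apply: measurable_sublevel; do 2!apply: measurable_funM => //; apply: measurable_funB => //.
by apply: (measurableT_comp (@measurable_quad_form R p v)); exact: measurable_invmx.
Qed.

Lemma measurable_dir_event p n (x : 'I_n -> 'cV[R]_p) v om t : measurable (dir_event x v om t).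
Proof.
apply: measurable_sublevel; do 2!apply: measurable_funM => //; apply: measurable_funB => //.
exact: measurable_quad_form.
Qed.

Lemma standardized_le (n q s w t : R) : 0 < n -> 0 < w ->
  (Num.sqrt n * (q - s) / (Num.sqrt 2 * `|w|) <= t) = (q <= s + Num.sqrt 2 * w * t / Num.sqrt n).
Proof.
move=> n0 w0; rewrite (gtr0_norm w0) ler_pdivrMr ?mulr_gt0 ?sqrtr_gt0//.
rewrite mulrC -ler_pdivlMr ?sqrtr_gt0// lerBlDl; congr (_ <= _ + _).
by field; rewrite gt_eqF// sqrtr_gt0.
Qed.

Let shape_large (A0 : R) : exists N : nat, forall n (b : R), (N <= n)%N -> 1 <= b ->
  [/\ 0 < n%:R :> R & A0 <= (n%:R + b - 2) / 2].
Proof.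
exists (Num.truncn (2 * A0 + 1)).+1 => n b Nn b1.
have h : 2 * A0 + 1 <= n%:R.
  by apply: le_trans (ltW (truncnS_gt _)) _; rewrite ler_nat.
split; first by rewrite ltr0n; apply: leq_trans Nn.
by rewrite ler_pdivlMr//; lra.
Qed.

Let inv_close (K Bd e de : R) (N : nat) (t : R) := forall p n (x : 'I_n -> 'cV[R]_p) b (v : 'cV[R]_p) (sg : R),
  (N <= n)%N -> (0 < p)%N -> (1 <= b)%N -> b%:R <= Bd -> v != 0 -> 0 < sg ->
  dotmx v v / sg <= K -> `|quad_form (sample_covariance x) v / sg - 1| <= de ->
  `|posterior (wishart_prior p b) n (sample_covariance x) (inv_event x v sg t) - Phi t| <= e.

(** Since c is proportional to sg, the event that v' Om^-1 v is at most
    s + sqrt 2 sg t / sqrt n becomes a lower bound on the standardized pivot,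
    and [z, +oo[ has normal probability Phi(- z) with z close to - t. *)
Lemma inv_marginal_at (K Bd e t : R) : 0 < e -> exists2 de : R, 0 < de & exists N : nat,
  inv_close K Bd e de N t.
Proof.
move=> e0; have e20 : 0 < e / 2 by rewrite divr_gt0.
have [A0 A01 HA] := @gamma_ratio_normal R (e / 2) e20.
have [de de0 [N1 HN1]] := @z_inv_uniform R K Bd t (e / 2) e20.
have [N2 HN2] := shape_large A0.
exists de => //; exists (maxn N1 N2) => p n x b v sg.
rewrite geq_max => /andP[n1 n2] p0 b1 bB v0 sg0 dK Td.
have bR : 1 <= b%:R :> R by rewrite ler1n.
have [n0 alA] := HN2 n _ n2 bR.
set s := quad_form (sample_covariance x) v in Td *.
set al := (_ + _ - 2) / 2 in alA.
have al0 : 0 < al by apply: lt_le_trans alA; rewrite (lt_le_trans _ A01).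
have k0 : 0 <= dotmx v v / sg by rewrite divr_ge0 ?dotmx_ge0// ltW.
have [Tw zt] := HN1 n b%:R (s / sg) (dotmx v v / sg) n1 Td (introT andP (conj k0 dK))
  (introT andP (conj bR bB)).
set z := z_inv n b%:R (s / sg) (dotmx v v / sg) t in zt.
pose c := 2^-1 * quad_form (post_scale x) v.
have cE : c = sg * (2^-1 * (dotmx v v / sg + n%:R * (s / sg))).
  by rewrite /c quad_form_post_scale -/s; field; rewrite gt_eqF.
have c0 : 0 < c by rewrite /c mulr_gt0//; exact: (post_scale_pd x).2.
have mC : measurable `[z, +oo[%classic by [].
have [g0 gC gN] := HA al c _ alA c0 mC.
have -> : posterior (wishart_prior p b) n (sample_covariance x) (inv_event x v sg t) =
    fine (\int[@lebesgue_measure R]_s ((gamma_dens al c s)%:E * (\1_(`[z, +oo[%classic) (gamma_z al c s))%:E))%E /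
    fine (\int[@lebesgue_measure R]_s (gamma_dens al c s)%:E)%E.
  apply: (@posterior_law _ _ _ _ _ p0 b1 _ _ _ (pivot v)) => //.
  - exact: measurable_inv_event.
  - move=> Om Opd; rewrite /= in_itv/= andbT /inv_event /= standardized_le// -/s.
    have -> : s + Num.sqrt 2 * sg * t / Num.sqrt n%:R = sg * (s / sg + Num.sqrt 2 * t / Num.sqrt n%:R).
      by field; rewrite !gt_eqF// sqrtr_gt0.
    have q0 : 0 < quad_form (invmx Om) v by apply: quad_form_inv_gt0.
    rewrite /z /z_inv/= -/al /gamma_z ler_pM2r ?invr_gt0 ?sqrtr_gt0// lerD2r /pivot.
    move: c0 Tw; rewrite cE pmulr_rgt0//.
    move: (2^-1 * _) (s / sg + _) => m r m0 r0.
    rewrite ler_pdivlMr// mulrAC ler_pdivrMr// [sg * m]mulrC -mulrA ler_pM2l//.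
  - by move=> h mh h0; have := @pivot_law R p ((n%:R + b%:R - 2) / 2) (post_scale x) v h v0 mh h0; apply.
rewrite (le_trans (ler_distD (fine (normal_prob 0 1 `[z, +oo[)) _ _))//.
rewrite [leRHS](splitr e) lerD// normal_prob_reflect.
apply: le_trans (std_normal_cdf_dist _ _) _.
by rewrite -normrN opprB opprK addrC.
Qed.

Lemma inv_marginal (K Bd e : R) : 0 < e -> exists2 de : R, 0 < de & exists N : nat,
  forall t, inv_close K Bd e de N t.
Proof.
move=> e0; have e20 : 0 < e / 2 by rewrite divr_gt0.
have [s Hs] := polya_grid e20.
have [|t|de de0 [N HN]] := @finite_uniform (inv_close K Bd (e / 2)) _ _ s.
- move=> d d' N N' t dd NN H p n x b v sg nN p0 b1 bB v0 sg0 dK Td.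
  by apply: H => //; [exact: leq_trans nN|exact: le_trans dd].
- exact: inv_marginal_at.
exists de => //; exists N => t p n x b v sg nN p0 b1 bB v0 sg0 dK Td.
rewrite (_ : e = 2 * (e / 2)); last by rewrite mulrC divfK.
apply: (Hs (fun u => posterior (wishart_prior p b) n (sample_covariance x) (inv_event x v sg u))).
- move=> u u' uu; apply: posterior_le => //; try exact: measurable_inv_event.
  by move=> Om; rewrite /inv_event/= => /le_trans; apply.
- by move=> u; apply: posterior01 => //; exact: measurable_inv_event.
- by move=> u us; exact: HN.
Qed.

Let dir_close (K Bd e de : R) (N : nat) (t : R) := forall p n (x : 'I_n -> 'cV[R]_p) b (v : 'cV[R]_p) (om : R),
  (N <= n)%N -> (0 < p)%N -> (1 <= b)%N -> b%:R <= Bd -> v != 0 -> 0 < om ->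
  pd_mx p (sample_covariance x) -> (forall u, dotmx u u <= K * quad_form (sample_covariance x) u) ->
  `|om / quad_form (invmx (sample_covariance x)) v - 1| <= de -> p%:R / Num.sqrt n%:R <= de ->
  `|posterior (wishart_prior p b) n (sample_covariance x) (dir_event x v om t) - Phi t| <= e.

(** The bound on rho comes from n S <= A <= (n + K) S in the Loewner
    order, where K bounds the inverse of S. *)
Lemma dir_marginal_at (K Bd e t : R) : 0 < e -> exists2 de : R, 0 < de & exists N : nat,
  dir_close K Bd e de N t.
Proof.
move=> e0; have e20 : 0 < e / 2 by rewrite divr_gt0.
have [A0 A01 HA] := @gamma_ratio_normal R (e / 2) e20.
have [de de0 [N1 HN1]] := @z_dir_uniform R K Bd t (e / 2) e20.
have [N2 HN2] := shape_large A0.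
exists de => //; exists (maxn N1 N2) => p n x b v om.
rewrite geq_max => /andP[n1 n2] p0 b1 bB v0 om0 Spd SK Wd pn.
have bR : 1 <= b%:R :> R by rewrite ler1n.
have pR : 1 <= p%:R :> R by rewrite ler1n.
have [n0 alA0] := HN2 n _ n2 bR.
set U := quad_form (invmx (sample_covariance x)) v in Wd *.
have U0 : 0 < U by apply: quad_form_inv_gt0.
pose q := quad_form (invmx (post_scale x)) v.
have Apd := post_scale_pd x.
have q0 : 0 < q by apply: quad_form_inv_gt0.
have Uq : U <= (n%:R + K) * q.
  apply: loewner_inv => // u; rewrite quad_form_post_scale addrC mulrDl lerD2l.
  exact: SK.
have qU : q <= n%:R^-1 * U.
  apply: loewner_inv => // u; rewrite quad_form_post_scale mulrDr mulKf ?gt_eqF//.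
  by rewrite lerDr mulr_ge0// dotmx_ge0.
pose rho := U / q - n%:R.
have rK : 0 <= rho <= K.
  rewrite /rho subr_ge0 lerBlDl ler_pdivlMr// ler_pdivrMr// Uq andbT.
  by move: qU; rewrite mulrC ler_pdivlMr// mulrC.
pose al := (n%:R + b%:R - 2) / 2 + p.+1%:R / 2 - 1 : R.
have alE : al = (n%:R + b%:R + p%:R - 3) / 2 by rewrite /al -natr1; field.
have alA : A0 <= al by apply: le_trans alA0 _; rewrite alE; lra.
have al0 : 0 < al by apply: lt_le_trans alA; rewrite (lt_le_trans _ A01).
have zt := HN1 n p%:R b%:R (om / U) rho n1 Wd (ler0n _ _) pn rK (introT andP (conj bR bB)).
set z := z_dir n p%:R b%:R (om / U) rho t in zt.
pose c := (2 * q)^-1.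
have c0 : 0 < c by rewrite /c invr_gt0 mulr_gt0.
have mC : measurable `]-oo, z]%classic by [].
have [g0 gC gN] := HA al c _ alA c0 mC.
have -> : posterior (wishart_prior p b) n (sample_covariance x) (dir_event x v om t) =
    fine (\int[@lebesgue_measure R]_s ((gamma_dens al c s)%:E * (\1_(`]-oo, z]%classic) (gamma_z al c s))%:E))%E /
    fine (\int[@lebesgue_measure R]_s (gamma_dens al c s)%:E)%E.
  apply: (@posterior_law _ _ _ _ _ p0 b1 _ _ _ (fun Om => quad_form Om v)) => //.
  - exact: measurable_dir_event.
  - move=> Om Opd; rewrite /= in_itv/= /dir_event /= standardized_le// -/U.
    rewrite /z /z_dir/= -alE /gamma_z ler_pM2r ?invr_gt0 ?sqrtr_gt0// lerD2r.
    have -> : 2^-1 * (n%:R + rho) * (1 + Num.sqrt 2 * t / Num.sqrt n%:R * (om / U)) =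
        c * (U + Num.sqrt 2 * om * t / Num.sqrt n%:R).
      by rewrite /rho /c; field; rewrite !gt_eqF// sqrtr_gt0.
    by rewrite ler_pM2l.
  - by move=> h mh h0; have := @quad_law R p ((n%:R + b%:R - 2) / 2) (post_scale x) v h Apd v0 mh h0; apply.
rewrite (le_trans (ler_distD (fine (normal_prob 0 1 `]-oo, z])) _ _))//.
rewrite [leRHS](splitr e) lerD//.
exact: le_trans (std_normal_cdf_dist _ _) _.
Qed.

Lemma dir_marginal (K Bd e : R) : 0 < e -> exists2 de : R, 0 < de & exists N : nat,
  forall t, dir_close K Bd e de N t.
Proof.
move=> e0; have e20 : 0 < e / 2 by rewrite divr_gt0.
have [s Hs] := polya_grid e20.
have [|t|de de0 [N HN]] := @finite_uniform (dir_close K Bd (e / 2)) _ _ s.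
- move=> d d' N N' t dd NN H p n x b v sg nN p0 b1 bB v0 sg0 Spd SK Td pn.
  by apply: H => //; [exact: leq_trans nN|exact: le_trans dd|exact: le_trans dd].
- exact: dir_marginal_at.
exists de => //; exists N => t p n x b v om nN p0 b1 bB v0 om0 Spd SK Td pn.
rewrite (_ : e = 2 * (e / 2)); last by rewrite mulrC divfK.
apply: (Hs (fun u => posterior (wishart_prior p b) n (sample_covariance x) (dir_event x v om u))).
- move=> u u' uu; apply: posterior_le => //; try exact: measurable_dir_event.
  by move=> Om; rewrite /dir_event/= => /le_trans; apply.
- by move=> u; apply: posterior01 => //; exact: measurable_dir_event.
- by move=> u us; exact: HN.
Qed.

End marginals.

(** * Moments of the standard normal law *)
Section normal_moments.
Context {R : realType}.
Notation leb := (@lebesgue_measure R).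
Notation N01 := (@normal_prob R 0 1).

Lemma integral_normal_gauss (l : R) : 0 < l ->
  (\int[N01]_x (expR (- (2^-1 * (l ^+ 2 - 1)) * x ^+ 2))%:E = l^-1%:E)%E.
Proof.
move=> l0; have k0 : 0 < (Num.sqrt (2 * pi))^-1 :> R.
  by rewrite invr_gt0 sqrtr_gt0 mulr_gt0// pi_gt0.
have mb := @measurable_bell R.
have mf : measurable_fun setT (fun x : R => expR (- (2^-1 * (l ^+ 2 - 1)) * x ^+ 2)).
  by apply: measurableT_comp => //; apply: measurable_funM => //; exact: measurable_funX.
rewrite (@ge0_integral_density _ _ _ leb _ (fun x => (Num.sqrt (2 * pi))^-1 * bell x)); first last.
- by move=> x; rewrite lee_fin expR_ge0.
- exact/measurable_EFinP.
- move=> B mB; rewrite -[LHS]/(normal_prob 0 1 B) normal_prob_bell// -(ge0_integralZl _ measurableT)//.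
  + by apply: eq_integral => x _; rewrite -!EFinM mulrA mulrC.
  + by apply/measurable_EFinP; apply: measurable_funM => //; exact: measurable_indic.
  + by move=> x _; rewrite mule_ge0// lee_fin bell_ge0.
- by move=> x; rewrite mulr_ge0 ?bell_ge0// ltW.
- exact: measurable_funM.
have -> : (\int[leb]_x ((expR (- (2^-1 * (l ^+ 2 - 1)) * x ^+ 2))%:E *
      ((Num.sqrt (2 * pi))^-1 * bell x)%:E) =
    (Num.sqrt (2 * pi))^-1%:E * \int[leb]_x (bell (l * x + 0))%:E)%E.
  rewrite -(ge0_integralZl _ measurableT)//.
  + apply: eq_integral => x _; rewrite -!EFinM addr0 mulrCA /bell -expRD.
    by congr (_ * expR _)%:E; ring.
  + apply/measurable_EFinP; apply: measurableT_comp => //.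
    by apply: measurable_funD => //; exact: measurable_funM.
  + by move=> x _; rewrite lee_fin bell_ge0.
have := @ge0_integral_affine R l 0 (fun x => (bell x)%:E) l0.
rewrite integral_bell => /(_ _ _) H.
have : (l%:E * \int[leb]_x (bell (l * x + 0))%:E = (Num.sqrt (2 * pi))%:E)%E.
  by apply: H => [|x]; [exact/measurable_EFinP|rewrite lee_fin bell_ge0].
have : (0 <= \int[leb]_x (bell (l * x + 0))%:E)%E.
  by apply: integral_ge0 => x _; rewrite lee_fin bell_ge0.
case: (\int[leb]_x _)%E => [r| |]//= _; last by rewrite gt0_muley ?lte_fin.
rewrite -!EFinM => -[E]; congr EFin.
have r0 : r != 0 by apply: contraTneq k0 => r0; rewrite -E r0 mulr0 invr0 ltxx.
by rewrite -E; field; rewrite r0 gt_eqF.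
Qed.

Let measurable_gauss (a : R) : measurable_fun setT (fun x : R => (expR (a * x ^+ 2))%:E).
Proof.
by apply/measurable_EFinP; apply: measurableT_comp => //; apply: measurable_funM => //; exact: measurable_funX.
Qed.

Let measurable_pow k : measurable_fun setT (fun x : R => (x ^+ k)%:E).
Proof. by apply/measurable_EFinP; exact: measurable_funX. Qed.

Let sq_ge (l : R) : 1 <= l ->
  (1 <= l^-1%:E + (2^-1 * (l ^+ 2 - 1))%:E * \int[N01]_x (x ^+ 2)%:E)%E.
Proof.
move=> l1; have l0 : 0 < l by lra.
have mp := measurable_pow 2; have mg a := measurable_gauss a.
have a0 : 0 <= 2^-1 * (l ^+ 2 - 1) by rewrite mulr_ge0// subr_ge0 exprn_ege1.
rewrite -(integral_normal_gauss l0) -(ge0_integralZl _ measurableT)//; last first.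
  by move=> x _; rewrite lee_fin sqr_ge0.
rewrite -ge0_integralD//; try by [apply: measurable_funeM; exact: mp | exact: mg |
  move=> x _; rewrite ?mule_ge0// ?lee_fin ?expR_ge0 ?sqr_ge0].
have {1}<- : (\int[N01]_x 1 = 1)%E by rewrite (integral_cst _ measurableT) mul1e; exact: (@probability_setT _ _ _ N01).
apply: ge0_le_integral => //.
- apply: emeasurable_funD; first (try exact: mg; exact: measurable_cst).
  by apply: measurable_funeM; exact: mp.
move=> x _; rewrite -EFinM -EFinD lee_fin -lerBlDr.
by apply: le_trans (expR_ge1Dx _); rewrite mulNr.
Qed.

Let sq_le (l : R) : 0 < l -> l <= 1 ->
  (1 + (2^-1 * (1 - l ^+ 2))%:E * \int[N01]_x (x ^+ 2)%:E <= l^-1%:E)%E.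
Proof.
move=> l0 l1.
have mp := measurable_pow 2; have mg a := measurable_gauss a.
have a0 : 0 <= 2^-1 * (1 - l ^+ 2) by rewrite mulr_ge0// subr_ge0 exprn_ile1 ?(ltW l0).
rewrite -(integral_normal_gauss l0) -(ge0_integralZl _ measurableT)//; last first.
  by move=> x _; rewrite lee_fin sqr_ge0.
have {1}<- : (\int[N01]_x 1 = 1)%E by rewrite (integral_cst _ measurableT) mul1e; exact: (@probability_setT _ _ _ N01).
rewrite -ge0_integralD//; try by [apply: measurable_funeM; exact: mp | exact: mg |
  move=> x _; rewrite ?mule_ge0// ?lee_fin ?expR_ge0 ?sqr_ge0].
apply: ge0_le_integral => //.
- by move=> x _; rewrite adde_ge0// mule_ge0// lee_fin ?sqr_ge0.
- apply: emeasurable_funD; first (try exact: mg; exact: measurable_cst).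
  by apply: measurable_funeM; exact: mp.
- exact: mg.
move=> x _; rewrite -EFinM -EFinD lee_fin.
by apply: le_trans (expR_ge1Dx _); lra.
Qed.

(** Compare the Gaussian integral of variance l^-2, which scaling evaluates, with
    its tangent at l = 1: on both sides of 1 this bounds the second moment, and
    the bounds meet as l tends to 1. *)
Lemma normal_second_moment : (\int[N01]_x (x ^+ 2)%:E = 1)%E.
Proof.
have I0 : (0 <= \int[N01]_x (x ^+ 2)%:E)%E by apply: integral_ge0 => x _; rewrite lee_fin sqr_ge0.
have h2 : 2^-1 < 1 :> R by lra.
have := @sq_le 2^-1 ltac:(lra) (ltW h2).
move: I0 sq_ge sq_le; case: (\int[N01]_x _)%E => [m| |]//=; last first.
  move=> _ _ _; rewrite gt0_muley ?lte_fin//; lra.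
rewrite lee_fin => m0 ge le _; congr EFin; apply/eqP; rewrite eq_le; apply/andP; split.
  rewrite leNgt; apply/negP => m1.
  (* a dilation close enough to 1 to contradict m > 1 *)
  pose d := (m - 1) / (4 * m).
  have mE : m * (1 - 4 * d) = 1 by rewrite /d; field; rewrite gt_eqF//; lra.
  have d0 : 0 < d by rewrite divr_gt0 ?subr_gt0// mulr_gt0//; lra.
  have d1 : 4 * d < 1 by rewrite /d mulrA ltr_pdivrMr//; lra.
  have l0 : 0 < 1 - d by lra.
  have := le _ l0 ltac:(lra).
  rewrite -EFinM -EFinD lee_fin -(ler_pM2r l0) mulVf ?gt_eqF//.
  nra.
rewrite leNgt; apply/negP => m1.
pose d := (1 - m) / 4.
have mE : m = 1 - 4 * d by rewrite /d; field.
have d0 : 0 < d by rewrite divr_gt0// subr_gt0.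
have l0 : 0 < 1 + d by lra.
have := ge (1 + d) ltac:(lra).
rewrite -EFinM -EFinD lee_fin -(ler_pM2r l0) mulrDl mulVf ?gt_eqF//.
have -> : 2^-1 * ((1 + d) ^+ 2 - 1) * m * (1 + d) = d - 2^-1 * (d ^+ 2 * (5 + 11 * d + 4 * d ^+ 2)).
  by rewrite mE; field.
have d20 : 0 < d ^+ 2 by rewrite exprn_gt0.
have : 0 < d ^+ 2 * (5 + 11 * d + 4 * d ^+ 2) by rewrite mulr_gt0//; lra.
lra.
Qed.

(** From x^4 <= 64 exp(x^2 / 4). *)
Lemma normal_fourth_moment : (\int[N01]_x (x ^+ 4)%:E < +oo)%E.
Proof.
have s0 : 0 < Num.sqrt 2^-1 :> R by rewrite sqrtr_gt0.
have := integral_normal_gauss s0; rewrite sqr_sqrtr//.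
have mp := measurable_pow 4; have mg a := measurable_gauss a.
move=> E; apply: (@le_lt_trans _ _ (64%:E * \int[N01]_x (expR (- (2^-1 * (2^-1 - 1)) * x ^+ 2))%:E)%E); last first.
  by rewrite E -EFinM ltry.
rewrite -(ge0_integralZl _ measurableT)//; last first.

- exact: mg.
apply: ge0_le_integral => //.
- by move=> x _; rewrite lee_fin exprn_even_ge0.
- by apply: measurable_funeM; exact: mg.
move=> x _; rewrite -EFinM lee_fin.
have := expR_ge1Dx (x ^+ 2 / 8) => h.
have e1 : expR (- (2^-1 * (2^-1 - 1)) * x ^+ 2) = expR (x ^+ 2 / 8) ^+ 2.
  by rewrite [RHS]expr2 -expRD; congr expR; field.
rewrite e1 (_ : x ^+ 4 = 64 * (x ^+ 2 / 8) ^+ 2); last by field.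
have x2 := sqr_ge0 x.
by rewrite ler_pM2l// ler_pXn2r ?nnegrE ?expR_ge0//; lra.
Qed.

End normal_moments.

(** * Variance of sample quadratic forms *)
Section sampling.
Context {R : realType} d (T : measurableType d) (P : probability T R) (p n : nat).
Variables (X : 'I_n -> {RV P >-> 'cV[R]_p}) (Sigma : 'M[R]_p).
Hypothesis X_gaussian : forall i, gaussian_vector (X i) Sigma.
Hypothesis X_independent : independent_vectors X.
Notation N01 := (@normal_prob R 0 1).

Lemma measurable_dotmx (u : 'cV[R]_p) : measurable_fun setT (fun x : 'cV[R]_p => dotmx u x).
Proof. by apply: measurable_fun_entry; exact: measurable_mulmx. Qed.

Lemma measurable_proj u i : measurable_fun setT (fun w => dotmx u (X i w)).
Proof. exact: (measurableT_comp (measurable_dotmx u) (measurable_funP (X i))). Qed.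

Definition normal_moment4 : R := fine (\int[N01]_x (x ^+ 4)%:E)%E.

Lemma normal_moment4E : (\int[N01]_x (x ^+ 4)%:E = normal_moment4%:E)%E.
Proof.
rewrite fineK// ge0_fin_numE; first exact: normal_fourth_moment.
by apply: integral_ge0 => x _; rewrite lee_fin exprn_even_ge0.
Qed.

Lemma normal_moment4_ge0 : 0 <= normal_moment4.
Proof. by rewrite fine_ge0// integral_ge0// => x _; rewrite lee_fin exprn_even_ge0. Qed.

Section direction.
Variable u : 'cV[R]_p.
Hypothesis u1 : quad_form Sigma u = 1.
Let Z i w := dotmx u (X i w).

Lemma proj_law i A : measurable A -> P [set w | A (Z i w)] = N01 A.
Proof.
move=> mA; have := X_gaussian i u mA; rewrite u1 /centered_normal oner_eq0 sqrtr1.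
by move=> <-.
Qed.

Lemma proj_joint_law i j A B : i != j -> measurable A -> measurable B ->
  (P [set w | A (Z i w) /\ B (Z j w)] = N01 A * N01 B)%E.
Proof.
move=> ij mA mB.
have mh C : measurable C -> measurable [set x : 'cV[R]_p | C (dotmx u x)].
  by move=> mC; rewrite -[X in measurable X]setTI; exact: measurable_dotmx.
pose F k : set 'cV[R]_p := if k == i then [set x | A (dotmx u x)]
  else if k == j then [set x | B (dotmx u x)] else setT.
have ji : j != i by rewrite eq_sym.
have := X_independent (A := F); rewrite (bigD1 i)//= (bigD1 j)//= big1 ?mule1; last first.
  by move=> k /andP[ki kj]; rewrite /F (negbTE ki) (negbTE kj) preimage_setT probability_setT.
rewrite /F eqxx (negbTE ji) eqxx -(proj_law i mA) -(proj_law j mB) => <-.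
  congr (P _); apply/seteqP; split => w /=.
    move=> [Ai Bj] k _ /=; case: eqP => [->//|_]; case: eqP => [->//|_]; by [].
  move=> H; have := H i I; have := H j I => /=; rewrite !eqxx (negbTE ji); by split.
by move=> k; case: ifP => _; [exact: mh|case: ifP => _; [exact: mh|]].
Qed.

Lemma integral_proj i (f : R -> \bar R) : measurable_fun setT f -> (forall x, 0 <= f x)%E ->
  (\int[P]_w f (Z i w) = \int[N01]_x f x)%E.
Proof.
move=> mf f0; have mZ : measurable_fun setT (Z i : T -> measurableTypeR R) := measurable_proj u i.
transitivity (\int[image_measure P mZ]_x f x)%E.
  by rewrite [RHS](ge0_integral_pushforward mZ)// preimage_setT.
rewrite [LHS](eq_measure_integral N01)// => A mA _; exact: proj_law.
Qed.

(** By independence and uniqueness of product measures, the joint law of two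
    projections is a product. *)
Lemma integral_proj_prod i j : i != j ->
  (\int[P]_w (Z i w ^+ 2 * Z j w ^+ 2)%:E = 1)%E.
Proof.
move=> ij; have mZ : measurable_fun setT (fun w => (Z i w, Z j w) : measurableTypeR R * measurableTypeR R).
  by apply/measurable_fun_pair; exact: measurable_proj.
have mf : measurable_fun setT (fun z : R * R => (z.1 ^+ 2 * z.2 ^+ 2)%:E).
  by apply/measurable_EFinP; apply: measurable_funM; exact: measurable_funX.
have f0 (z : R * R) : (0 <= (z.1 ^+ 2 * z.2 ^+ 2)%:E)%E by rewrite lee_fin mulr_ge0 ?sqr_ge0.
transitivity (\int[image_measure P mZ]_z (z.1 ^+ 2 * z.2 ^+ 2)%:E)%E.
  by rewrite [RHS](ge0_integral_pushforward mZ)// preimage_setT.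
transitivity (\int[N01 \x N01]_z (z.1 ^+ 2 * z.2 ^+ 2)%:E)%E.
  rewrite [LHS](eq_measure_integral (N01 \x N01)%E)// => A mA _; apply/esym/product_measure_unique => // B C mB mC.
  exact: proj_joint_law.
rewrite fubini_tonelli1//= /fubini_F/=.
transitivity (\int[N01]_x (x ^+ 2)%:E)%E; last exact: normal_second_moment.
apply: eq_integral => x _; under eq_integral do rewrite EFinM.
rewrite ge0_integralZl//; last 3 first.
- by apply/measurable_EFinP; exact: measurable_funX.
- by move=> y _; rewrite lee_fin sqr_ge0.
- by rewrite lee_fin sqr_ge0.
by rewrite normal_second_moment mule1.
Qed.

Let mY i : measurable_fun setT (fun w => Z i w ^+ 2).
Proof. by apply: measurable_funX; exact: measurable_proj. Qed.

Lemma integral_proj_sq_sum : (\int[P]_w ((\sum_i Z i w ^+ 2) ^+ 2)%:E =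
  (n%:R * normal_moment4 + n%:R ^+ 2 - n%:R)%:E)%E.
Proof.
transitivity (\int[P]_w (\sum_i \sum_j (Z i w ^+ 2 * Z j w ^+ 2)%:E))%E.
  apply: eq_integral => w _; rewrite expr2 mulr_suml -sumEFin; apply: eq_bigr => i _.
  by rewrite mulr_sumr -sumEFin.
have mYY i j : measurable_fun setT (fun w => (Z i w ^+ 2 * Z j w ^+ 2)%:E).
  by apply/measurable_EFinP; exact: measurable_funM.
have YY0 i j w : (0 <= (Z i w ^+ 2 * Z j w ^+ 2)%:E)%E by rewrite lee_fin mulr_ge0 ?sqr_ge0.
rewrite ge0_integral_sum//; last 2 first.
- by move=> i; exact: emeasurable_sum.
- by move=> i w _; exact: sume_ge0.
have E i : (\int[P]_w (\sum_j (Z i w ^+ 2 * Z j w ^+ 2)%:E) = (normal_moment4 + n%:R - 1)%:E)%E.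
  rewrite ge0_integral_sum//.
  rewrite (bigD1 i)//= (eq_bigr (fun=> 1%:E)); last first.
    by move=> j ji; rewrite integral_proj_prod// eq_sym.
  have -> : (\int[P]_w (Z i w ^+ 2 * Z i w ^+ 2)%:E = normal_moment4%:E)%E.
    rewrite -normal_moment4E -(integral_proj i) //.
    - by apply: eq_integral => w _; rewrite -exprD.
    - by apply/measurable_EFinP; exact: measurable_funX.
    - by move=> x; rewrite lee_fin exprn_even_ge0.
  rewrite sumEFin -EFinD; congr EFin; rewrite sumr_const cardC1 card_ord -addrA; congr (_ + _).
  by rewrite -[in RHS](ltn_predK (ltn_ord i)) -natr1 addrK.
rewrite (eq_bigr _ (fun i _ => E i)) sumEFin sumr_const card_ord -mulr_natl; congr EFin.
by ring.
Qed.

(** Expanding the square with Y = sum of the Z_i^2, the identity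
    (Y - n)^2 + 2 n Y = Y^2 + n^2 involves nonnegative terms only, so each
    can be integrated without integrability conditions. *)
Lemma sample_quad_variance : (0 < n)%N ->
  (\int[P]_w ((quad_form (sample_covariance (fun i => X i w)) u - 1) ^+ 2)%:E <=
   (normal_moment4 / n%:R)%:E)%E.
Proof.
move=> n0; have nR : 0 < n%:R :> R by rewrite ltr0n.
pose Y w := \sum_i Z i w ^+ 2.
have mYs : measurable_fun setT Y by exact: measurable_sum.
have mYE : measurable_fun setT (fun w => (Y w)%:E) by exact/measurable_EFinP.
have Y0 w : 0 <= Y w by apply: sumr_ge0 => i _; exact: sqr_ge0.
have IY : (\int[P]_w (Y w)%:E = n%:R%:E)%E.
  under eq_integral do rewrite /Y -sumEFin.
  rewrite ge0_integral_sum//; last 2 first.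
  - by move=> i; exact/measurable_EFinP.
  - by move=> i w _; rewrite lee_fin sqr_ge0.
  rewrite (eq_bigr (fun=> 1%:E)); first by rewrite sumEFin sumr_const card_ord.
  move=> i _; rewrite (integral_proj i (f := fun x => (x ^+ 2)%:E)) ?normal_second_moment//.
  - by apply/measurable_EFinP; exact: measurable_funX.
  - by move=> x; rewrite lee_fin sqr_ge0.
have mD : measurable_fun setT (fun w => ((Y w - n%:R) ^+ 2)%:E).
  by apply/measurable_EFinP; apply: measurable_funX; exact: measurable_funB.
have key : (\int[P]_w ((Y w - n%:R) ^+ 2)%:E + (2 * n%:R ^+ 2)%:E =
    (n%:R * normal_moment4 + n%:R ^+ 2 - n%:R)%:E + (n%:R ^+ 2)%:E)%E.
  rewrite -integral_proj_sq_sum.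
  have -> : ((n%:R ^+ 2)%:E = \int[P]_w (n%:R ^+ 2)%:E)%E.
    by rewrite (integral_cst _ measurableT) -[LHS]mule1; congr (_ * _)%E; exact/esym/probability_setT.
  have -> : ((2 * n%:R ^+ 2)%:E = \int[P]_w ((2 * n%:R)%:E * (Y w)%:E))%E.
    rewrite ge0_integralZl//; last by move=> w _; rewrite lee_fin.
    by rewrite IY -EFinM; congr EFin; ring.
  rewrite -!ge0_integralD//.
  - by apply: eq_integral => w _; rewrite -EFinM -!EFinD; congr EFin; rewrite /Y; ring.
  - by move=> w _; rewrite lee_fin sqr_ge0.
  - by apply/measurable_EFinP; exact: measurable_funX.
  - by move=> w _; rewrite lee_fin sqr_ge0.
  - by move=> w _; rewrite mule_ge0// lee_fin ?mulr_ge0.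
  - exact: measurable_funeM.
have I0 : (0 <= \int[P]_w ((Y w - n%:R) ^+ 2)%:E)%E.
  by apply: integral_ge0 => w _; rewrite lee_fin sqr_ge0.
have IE : (\int[P]_w ((Y w - n%:R) ^+ 2)%:E <= (n%:R * normal_moment4)%:E)%E.
  move: key I0; case: (\int[P]_w _)%E => [r| |]//=.
  rewrite -!EFinD => -[E] _; rewrite lee_fin.
  have -> : r = n%:R * normal_moment4 - n%:R by lra.
  by lra.
have -> : (\int[P]_w ((quad_form (sample_covariance (fun i => X i w)) u - 1) ^+ 2)%:E =
    (n%:R^-1 ^+ 2)%:E * \int[P]_w ((Y w - n%:R) ^+ 2)%:E)%E.
  rewrite -ge0_integralZl//.
  - apply: eq_integral => w _; rewrite -EFinM quad_form_sample -exprMn; congr (_ ^+ 2)%:E.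
    by rewrite mulrBr mulVf ?gt_eqF.
  - by move=> w _; rewrite lee_fin sqr_ge0.
apply: (@le_trans _ _ ((n%:R^-1 ^+ 2)%:E * (n%:R * normal_moment4)%:E)%E).
  by rewrite lee_wpmul2l// lee_fin sqr_ge0.
rewrite -EFinM lee_fin le_eqVlt; apply/orP; left; apply/eqP.
by field; rewrite gt_eqF.
Qed.

End direction.
End sampling.

(** * Spectral and Frobenius norms *)
Section spectral.
Context {R : realType} {p : nat}.
Implicit Types (A S Sg : 'M[R]_p) (u v : 'cV[R]_p).

Definition frob A : R := \sum_i \sum_j A i j ^+ 2.

Lemma dotmx_cauchy_schwarz u v : dotmx u v ^+ 2 <= dotmx u u * dotmx v v.
Proof.
have I1 : pd_mx p (1%:M : 'M[R]_p).
  by split; [rewrite trmx1|move=> x x0; rewrite quad_form1 dotmx_gt0].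
by have := pd_cauchy_schwarz u v I1; rewrite invmx1 !quad_form1.
Qed.

Lemma l2_norm_sq u : l2_norm u ^+ 2 = dotmx u u.
Proof.
rewrite /l2_norm sqr_sqrtr ?sumr_ge0// => [|i _]; last exact: sqr_ge0.
by rewrite dotmx_sumE; apply: eq_bigr => i _; rewrite expr2.
Qed.

Lemma l2_norm_ge0 u : 0 <= l2_norm u.
Proof. exact: sqrtr_ge0. Qed.

Lemma frob_ge0 A : 0 <= frob A.
Proof. by apply: sumr_ge0 => i _; apply: sumr_ge0 => j _; exact: sqr_ge0. Qed.

Lemma frob_mulmx A u : dotmx (A *m u) (A *m u) <= frob A * dotmx u u.
Proof.
rewrite dotmx_sumE /frob mulr_suml; apply: ler_sum => i _.
have -> : (A *m u) i ord0 = dotmx (row i A)^T u.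
  by rewrite mxE dotmx_sumE; apply: eq_bigr => j _; rewrite !mxE.
rewrite -expr2; apply: le_trans (dotmx_cauchy_schwarz _ _) _.
rewrite le_eqVlt; apply/orP; left; apply/eqP; congr (_ * _).
by rewrite dotmx_sumE; apply: eq_bigr => j _; rewrite !mxE expr2.
Qed.

Lemma frob_quad_form A u : `|quad_form A u| <= Num.sqrt (frob A) * dotmx u u.
Proof.
rewrite -ler_sqr ?nnegrE ?mulr_ge0 ?sqrtr_ge0 ?dotmx_ge0//.
rewrite exprMn sqr_sqrtr ?frob_ge0// real_normK ?num_real// quad_form_dot.
apply: le_trans (dotmx_cauchy_schwarz _ _) _.
by rewrite mulrC [X in _ <= _ * X]expr2 mulrA ler_wpM2r ?dotmx_ge0// frob_mulmx.
Qed.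

Lemma spectral_norm_mulmx A u : l2_norm u <= 1 -> l2_norm (A *m u) <= spectral_norm A.
Proof.
move=> u1; apply: ub_le_sup; last by exists u.
exists (Num.sqrt (frob A)) => _ [x /= x1 <-].
rewrite -ler_sqr ?nnegrE ?l2_norm_ge0 ?sqrtr_ge0// l2_norm_sq sqr_sqrtr ?frob_ge0//.
apply: le_trans (frob_mulmx _ _) _; rewrite ler_piMr ?frob_ge0//.
by rewrite -l2_norm_sq expr_le1 ?l2_norm_ge0.
Qed.

Lemma quad_form_spectral A M u : spectral_norm A <= M -> quad_form A u <= M * dotmx u u.
Proof.
move=> AM; have [->|u0] := eqVneq u 0.
  by rewrite dotmx0r mulr0 quad_form_dot mulmx0 dotmx0r.
have r0 : 0 < l2_norm u.
  by rewrite lt_neqAle eq_sym l2_norm_ge0 andbT -sqrf_eq0 l2_norm_sq gt_eqF ?dotmx_gt0.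
pose x := (l2_norm u)^-1 *: u.
have uE : u = l2_norm u *: x by rewrite scalerA mulfV ?scale1r// gt_eqF.
have x1 : dotmx x x = 1.
  by rewrite /x dotmxZl dotmxZr -l2_norm_sq; field; rewrite gt_eqF.
have M0 : l2_norm (A *m x) <= M.
  apply: le_trans AM; apply: spectral_norm_mulmx.
  by rewrite -(@expr_le1 _ 2)// ?l2_norm_ge0// l2_norm_sq x1.
rewrite uE quad_formZ dotmxZl dotmxZr x1 mulr1 -expr2 mulrC ler_wpM2r ?sqr_ge0//.
apply: le_trans M0; rewrite quad_form_dot; apply: le_trans (ler_norm _) _.
rewrite -ler_sqr ?nnegrE ?l2_norm_ge0// real_normK ?num_real// l2_norm_sq.
by apply: le_trans (dotmx_cauchy_schwarz _ _) _; rewrite x1 mul1r.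
Qed.

(** Cauchy-Schwarz for Sg gives |u|^4 <= (u' Sg u) (u' Sg^-1 u). *)
Lemma quad_form_spectral_inv Sg M u : pd_mx p Sg -> spectral_norm (invmx Sg) <= M ->
  dotmx u u <= M * quad_form Sg u.
Proof.
move=> Spd SM; have [->|u0] := eqVneq u 0.
  by rewrite dotmx0r quad_form_dot mulmx0 dotmx0r mulr0.
have u2 := dotmx_gt0 u0; have q0 : 0 < quad_form Sg u := Spd.2 _ u0.
rewrite -(ler_pM2r u2) -expr2; apply: le_trans (pd_cauchy_schwarz u u Spd) _.
by rewrite mulrAC mulrC ler_wpM2r ?(ltW q0)// quad_form_spectral.
Qed.

(** With eta as stated, (1 - eta) Sg <= S <= (1 + eta) Sg in the Loewner order,
    because the Frobenius norm bounds quadratic forms and Sg >= 1 / M. *)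
Lemma loewner_sandwich S Sg M v : S^T = S -> pd_mx p Sg ->
  0 < M -> spectral_norm (invmx Sg) <= M -> v != 0 ->
  let eta := Num.sqrt (frob (S - Sg)) * M in eta <= 2^-1 ->
  [/\ pd_mx p S, forall u, dotmx u u <= 2 * M * quad_form S u &
      `|quad_form (invmx Sg) v / quad_form (invmx S) v - 1| <= eta].
Proof.
move=> Ssym Spd M0 SM v0 eta eta2.
have eta0 : 0 <= eta by rewrite mulr_ge0 ?sqrtr_ge0// ltW.
have close u : `|quad_form S u - quad_form Sg u| <= eta * quad_form Sg u.
  have -> : quad_form S u - quad_form Sg u = quad_form (S - Sg) u.
    by rewrite quad_form_addmx -(scaleN1r Sg) quad_form_scalemx mulN1r.
  apply: le_trans (frob_quad_form _ _) _.
  by rewrite -mulrA ler_wpM2l ?sqrtr_ge0// quad_form_spectral_inv.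
have up u : quad_form S u <= (1 + eta) * quad_form Sg u.
  by have := close u; rewrite ler_distl => /andP[_]; rewrite mulrDl mul1r addrC.
have lo u : (1 - eta) * quad_form Sg u <= quad_form S u.
  by have := close u; rewrite ler_distl => /andP[+ _]; rewrite mulrBl mul1r.
have e1 : 0 < 1 - eta by lra.
have pdS : pd_mx p S.
  split=> // u u0; apply: lt_le_trans (lo u); rewrite mulr_gt0//; exact: Spd.2.
split=> // [u|].
  apply: (le_trans (quad_form_spectral_inv u Spd SM)).
  rewrite -mulrA mulrCA ler_pM2l//; apply: le_trans (_ : 2 * ((1 - eta) * quad_form Sg u) <= _).
    by rewrite mulrA ler_peMl ?(pd_psd Spd).2//; lra.
  by rewrite ler_pM2l.
have U0 := quad_form_inv_gt0 pdS v0.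
have b1 : quad_form (invmx Sg) v <= (1 + eta) * quad_form (invmx S) v by exact: loewner_inv.
have b2 : quad_form (invmx S) v <= (1 - eta)^-1 * quad_form (invmx Sg) v.
  by apply: loewner_inv => // u; rewrite mulrC ler_pdivlMr// mulrC.
rewrite ler_distl; apply/andP; split; last by rewrite ler_pdivrMr.
by rewrite ler_pdivlMr//; move: b2; rewrite mulrC ler_pdivlMr// mulrC.
Qed.

End spectral.

(** * Tail bounds for the sample covariance *)
Section deviations.
Context {R : realType} d (T : measurableType d) (P : probability T R).

(** Markov inequality. *)
Lemma tail_le_integral (f : T -> R) (e C : R) : measurable_fun setT f ->
  (forall w, 0 <= f w) -> 0 < e -> (\int[P]_w (f w)%:E <= C%:E)%E ->
  measurable [set w | e < f w] /\ (P [set w | (e < f w)%R] <= (C / e)%:E)%E.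
Proof.
move=> mf f0 e0 fC.
have mA : measurable [set w | e < f w].
  rewrite (_ : [set w | _] = f @^-1` `]e, +oo[%classic).
    by rewrite -[X in measurable X]setTI; exact: mf.
  by apply/seteqP; split => w /=; rewrite in_itv/= andbT.
split => //; rewrite -(@lee_pmul2l _ e%:E) ?lte_fin// -EFinM.
rewrite (_ : e * (C / e) = C); last by field; rewrite gt_eqF.
apply: le_trans fC; rewrite -(setIT [set w | _]) -integral_indic// -ge0_integralZl//; try by [apply/measurable_EFinP; exact: measurable_indic |
  move=> w _; rewrite lee_fin | rewrite ?lee_fin ltW].
apply: ge0_le_integral => //.
- by move=> w _; rewrite mule_ge0// lee_fin ltW.
- by apply: measurable_funeM; apply/measurable_EFinP; exact: measurable_indic.
- exact/measurable_EFinP.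
- move=> w _; rewrite -EFinM lee_fin indicE; have [/set_mem/= wA|_] := boolP (w \in _).
    by rewrite mulr1 ltW.
  by rewrite mulr0.
Qed.

Context (p n : nat).
Variables (X : 'I_n -> {RV P >-> 'cV[R]_p}) (Sigma : 'M[R]_p).
Hypothesis X_gaussian : forall i, gaussian_vector (X i) Sigma.
Hypothesis X_independent : independent_vectors X.
Hypothesis Sigma_pd : pd_mx p Sigma.
Hypothesis n0 : (0 < n)%N.
Let S w := sample_covariance (fun i => X i w).
Notation normal_moment4 := (@normal_moment4 R).

Lemma measurable_sample_covariance : measurable_fun setT S.
Proof.
apply: measurable_fun_mx => i j.
rewrite (_ : (fun w => S w i j) = fun w => n%:R^-1 * \sum_k (X k w i ord0 * X k w j ord0)).
  apply: measurable_funM => //; apply: measurable_sum => k.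
  by apply: measurable_funM; apply: measurable_fun_entry; exact: measurable_funP.
apply/funext => w; rewrite /S /sample_covariance mxE summxE; congr (_ * _).
by apply: eq_bigr => k _; rewrite !mxE big_ord1 !mxE.
Qed.

Lemma measurable_quad_dev u : measurable_fun setT (fun w => quad_form (S w) u - quad_form Sigma u).
Proof.
by apply: measurable_funB => //; exact: (measurableT_comp (measurable_quad_form u) measurable_sample_covariance).
Qed.

(** By homogeneity it suffices to treat a direction of unit variance. *)
Lemma sample_quad_dev u :
  (\int[P]_w ((quad_form (S w) u - quad_form Sigma u) ^+ 2)%:E <=
   (normal_moment4 / n%:R * quad_form Sigma u ^+ 2)%:E)%E.
Proof.
have [->|u0] := eqVneq u 0.
  rewrite quad_form_dot mulmx0 dotmx0r expr0n/= mulr0.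
  rewrite (eq_integral (fun=> 0%E)) ?integral0// => w _.
  by rewrite quad_form_dot mulmx0 dotmx0r subr0 expr0n.
have s0 : 0 < quad_form Sigma u := Sigma_pd.2 _ u0.
set s := quad_form Sigma u in s0 *.
pose u' := (Num.sqrt s)^-1 *: u.
have r0 : 0 < Num.sqrt s by rewrite sqrtr_gt0.
have r2 : s = Num.sqrt s ^+ 2 by rewrite sqr_sqrtr// ltW.
have u1 : quad_form Sigma u' = 1.
  by rewrite /u' quad_formZ -/s [in X in _ * X]r2; field; rewrite gt_eqF.
have uE A : quad_form A u = s * quad_form A u'.
  by rewrite /u' quad_formZ mulrA [in X in X * _ * _]r2 exprVn mulfV ?mul1r// expf_neq0 ?gt_eqF.
have := sample_quad_variance X_gaussian X_independent u1 n0.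
have mq : measurable_fun setT (fun w => ((quad_form (S w) u' - 1) ^+ 2)%:E).
  by apply/measurable_EFinP; apply: measurable_funX; rewrite -u1; exact: measurable_quad_dev.
have -> : (\int[P]_w ((quad_form (S w) u - s) ^+ 2)%:E =
    (s ^+ 2)%:E * \int[P]_w ((quad_form (S w) u' - 1) ^+ 2)%:E)%E.
  rewrite -ge0_integralZl//; last 2 first.
  - by move=> w _; rewrite lee_fin sqr_ge0.
  - by rewrite lee_fin sqr_ge0.
  by apply: eq_integral => w _; rewrite -EFinM uE; congr EFin; ring.
move=> H; apply: (@le_trans _ _ ((s ^+ 2)%:E * (normal_moment4 / n%:R)%:E)%E).
  by rewrite lee_wpmul2l// lee_fin sqr_ge0.
by rewrite -EFinM mulrC.
Qed.

Lemma quad_ratio_tail v (de : R) : v != 0 -> 0 < de ->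
  let B := [set w | de ^+ 2 < (quad_form (S w) v / quad_form Sigma v - 1) ^+ 2] in
  measurable B /\ (P B <= (normal_moment4 / n%:R / de ^+ 2)%:E)%E.
Proof.
move=> v0 de0; have s0 : 0 < quad_form Sigma v := Sigma_pd.2 _ v0.
have E w : quad_form (S w) v / quad_form Sigma v - 1 =
    (quad_form Sigma v)^-1 * (quad_form (S w) v - quad_form Sigma v).
  by rewrite mulrBr mulVf ?gt_eqF// mulrC.
apply: tail_le_integral; rewrite ?exprn_gt0//.
- apply: measurable_funX; under eq_fun do rewrite E.
  by apply: measurable_funM => //; exact: measurable_quad_dev.
- by move=> w; exact: sqr_ge0.
have -> : (\int[P]_w ((quad_form (S w) v / quad_form Sigma v - 1) ^+ 2)%:E =
    ((quad_form Sigma v)^-1 ^+ 2)%:E * \int[P]_w ((quad_form (S w) v - quad_form Sigma v) ^+ 2)%:E)%E.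
  rewrite -ge0_integralZl//; last 3 first.
  - by apply/measurable_EFinP; apply: measurable_funX; exact: measurable_quad_dev.
  - by move=> w _; rewrite lee_fin sqr_ge0.
  - by rewrite lee_fin sqr_ge0.
  by apply: eq_integral => w _; rewrite E exprMn EFinM.
apply: (@le_trans _ _ (((quad_form Sigma v)^-1 ^+ 2)%:E * (normal_moment4 / n%:R * quad_form Sigma v ^+ 2)%:E)%E).
  by rewrite lee_wpmul2l ?lee_fin ?sqr_ge0//; exact: sample_quad_dev.
rewrite -EFinM lee_fin le_eqVlt; apply/orP; left; apply/eqP.
by field; rewrite !gt_eqF ?ltr0n.
Qed.

Lemma dotmx_delta i j : dotmx (delta_mx i ord0 : 'cV[R]_p) (delta_mx j ord0) = (i == j)%:R.
Proof.
rewrite dotmx_sumE (bigD1 i)//= big1 ?addr0; last first.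
  by move=> k ki; rewrite !mxE (negbTE ki) mul0r.
by rewrite !mxE !eqxx mul1r andbT.
Qed.

(** Recovers an entry from three quadratic forms, whose variances are known. *)
Lemma entry_polar (A : 'M[R]_p) i j : A^T = A ->
  A i j = 2^-1 * (quad_form A (delta_mx j ord0 + delta_mx i ord0) -
     quad_form A (delta_mx j ord0) - quad_form A (delta_mx i ord0)).
Proof.
move=> Asym; rewrite quad_formD//.
have -> : dotmx (delta_mx i ord0) (A *m delta_mx j ord0) = A i j.
  by rewrite /dotmx trmx_delta -colE -rowE !mxE.
by field.
Qed.

Variable M : R.
Hypothesis M0 : 0 <= M.
Hypothesis Sigma_M : spectral_norm Sigma <= M.

Lemma entry_dev i j :
  (\int[P]_w (((S w - Sigma) i j) ^+ 2)%:E <= (14 * normal_moment4 * M ^+ 2 / n%:R)%:E)%E.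
Proof.
pose q u w := quad_form (S w) u - quad_form Sigma u.
have mq u : measurable_fun setT (fun w => (q u w ^+ 2)%:E).
  by apply/measurable_EFinP; apply: measurable_funX; exact: measurable_quad_dev.
have q0 u w : (0 <= (q u w ^+ 2)%:E)%E by rewrite lee_fin sqr_ge0.
have dev u k : dotmx u u <= k -> (\int[P]_w (q u w ^+ 2)%:E <= (normal_moment4 / n%:R * (M * k) ^+ 2)%:E)%E.
  move=> uk; apply: le_trans (sample_quad_dev u) _; rewrite lee_fin.
  have k0 : 0 <= k := le_trans (dotmx_ge0 _) uk.
  rewrite ler_wpM2l ?divr_ge0 ?normal_moment4_ge0// ler_pXn2r ?nnegrE ?mulr_ge0//.
    by apply: (le_trans (quad_form_spectral u Sigma_M)); rewrite ler_wpM2l.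
  exact: (pd_psd Sigma_pd).2.
set ei : 'cV[R]_p := delta_mx i ord0; set ej : 'cV[R]_p := delta_mx j ord0.
have di : dotmx ei ei <= 1 by rewrite dotmx_delta eqxx.
have dj : dotmx ej ej <= 1 by rewrite dotmx_delta eqxx.
have dij : dotmx (ej + ei) (ej + ei) <= 4.
  rewrite dotmxDl !dotmxDr !dotmx_delta !eqxx.
  by case: (j == i); case: (i == j) => /=; lra.
have pt w : ((S w - Sigma) i j) ^+ 2 <= 4^-1 * 3 * (q (ej + ei) w ^+ 2 + q ej w ^+ 2 + q ei w ^+ 2).
  rewrite entry_polar; last by rewrite linearB/= sample_covariance_sym Sigma_pd.1.
  have E u : quad_form (S w - Sigma) u = q u w.
    by rewrite quad_form_addmx -(scaleN1r Sigma) (quad_form_scalemx (-1)) mulN1r.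
  rewrite !E -/ei -/ej; move: (q (ej + ei) w) (q ej w) (q ei w) => a b c.
  have h1 := sqr_ge0 (a + b); have h2 := sqr_ge0 (a + c); have h3 := sqr_ge0 (b - c).
  by nra.
apply: (@le_trans _ _ (\int[P]_w ((4^-1 * 3)%:E * ((q (ej + ei) w ^+ 2)%:E + (q ej w ^+ 2)%:E + (q ei w ^+ 2)%:E)))%E).
  apply: ge0_le_integral => //.
  - by move=> w _; rewrite lee_fin sqr_ge0.
  - apply/measurable_EFinP; apply: measurable_funX; apply: measurable_fun_entry.
    apply: measurable_addmx; [exact: measurable_sample_covariance|exact: measurable_cst].
  - by apply: measurable_funeM; apply: emeasurable_funD => //; exact: emeasurable_funD.
  - by move=> w _; rewrite -!EFinD -EFinM lee_fin; exact: pt.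
rewrite ge0_integralZl//; try by [apply: emeasurable_funD => //; exact: emeasurable_funD |
  move=> w _; rewrite !adde_ge0].
rewrite !ge0_integralD//; try by [exact: emeasurable_funD | move=> w _; rewrite adde_ge0].
apply: (@le_trans _ _ ((4^-1 * 3)%:E * ((normal_moment4 / n%:R * (M * 4) ^+ 2)%:E + (normal_moment4 / n%:R * (M * 1) ^+ 2)%:E +
  (normal_moment4 / n%:R * (M * 1) ^+ 2)%:E))%E).
  by rewrite lee_wpmul2l ?lee_fin// !leeD// dev.
rewrite -!EFinD -EFinM lee_fin.
have h : 0 <= normal_moment4 / n%:R * M ^+ 2 by rewrite mulr_ge0 ?sqr_ge0// divr_ge0// normal_moment4_ge0.
rewrite (_ : 14 * normal_moment4 * M ^+ 2 / n%:R = 14 * (normal_moment4 / n%:R * M ^+ 2)); last by ring.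
by rewrite !exprMn; lra.
Qed.

Lemma frob_tail (e : R) : 0 < e ->
  let B := [set w | e < frob (S w - Sigma)] in
  measurable B /\ (P B <= (14 * normal_moment4 * M ^+ 2 * (p%:R ^+ 2 / n%:R) / e)%:E)%E.
Proof.
move=> e0; have mD i j : measurable_fun setT (fun w => (S w - Sigma) i j ^+ 2).
  apply: measurable_funX; apply: measurable_fun_entry.
  by apply: measurable_addmx; [exact: measurable_sample_covariance|exact: measurable_cst].
apply: tail_le_integral => //.
- by apply: measurable_sum => i; exact: measurable_sum.
- by move=> w; exact: frob_ge0.
have -> : (\int[P]_w (frob (S w - Sigma))%:E =
    \sum_i \sum_j \int[P]_w ((S w - Sigma) i j ^+ 2)%:E)%E.
  rewrite /frob; under eq_integral do rewrite -sumEFin.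
  under eq_integral => w _ do under eq_bigr => i _ do rewrite -sumEFin.
  rewrite ge0_integral_sum//; last 2 first.
  - by move=> i; apply: emeasurable_sum => j; exact/measurable_EFinP.
  - by move=> i w _; apply: sume_ge0 => j _; rewrite lee_fin sqr_ge0.
  apply: eq_bigr => i _; rewrite ge0_integral_sum//.
  - by move=> j; exact/measurable_EFinP.
  - by move=> j w _; rewrite lee_fin sqr_ge0.
apply: (@le_trans _ _ (\sum_(i < p) \sum_(j < p) (14 * normal_moment4 * M ^+ 2 / n%:R)%:E)%E).
  by apply: lee_sum => i _; apply: lee_sum => j _; exact: entry_dev.
have cst (c : R) : \sum_(i < p) c = p%:R * c by rewrite sumr_const card_ord mulr_natl.
under eq_bigr do rewrite sumEFin cst.
rewrite sumEFin cst lee_fin le_eqVlt; apply/orP; left; apply/eqP.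
by ring.
Qed.

End deviations.

(** * From good events to expectations *)
Section assembly.
Context {R : realType}.
Import HBNNSimple.

(** The supremum over all t is not shown to be measurable; the integral is still
    monotone, being a supremum over simple functions below. *)
Lemma ge0_le_integral_nonmeas d (T : measurableType d) (mu : {measure set T -> \bar R})
    (f g : T -> \bar R) : (forall x, 0 <= f x)%E -> (forall x, f x <= g x)%E ->
  (\int[mu]_x f x <= \int[mu]_x g x)%E.
Proof.
move=> f0 fg; have g0 x : (0 <= g x)%E := le_trans (f0 x) (fg x).
rewrite !ge0_integralTE//; apply: ereal_sup_le => _ [h hf <-].
by exists h => // x; exact: le_trans (hf x) (fg x).
Qed.

Lemma expectation_le_good d (T : measurableType d) (P : probability T R)
    (g : T -> R) (B : set T) (e : R) : 0 <= e -> measurable B ->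
  (forall w, 0 <= g w <= 1) -> (forall w, ~ B w -> g w <= e) ->
  (0 <= 'E_P[g])%E /\ ('E_P[g] <= e%:E + P B)%E.
Proof.
move=> e0 mB g01 gB; rewrite unlock; split.
  by apply: integral_ge0 => w _; rewrite lee_fin; have /andP[] := g01 w.
apply: (@le_trans _ _ (\int[P]_w (e%:E + (\1_B w)%:E))%E).
  apply: ge0_le_integral_nonmeas => w; first by rewrite lee_fin; have /andP[] := g01 w.
  rewrite -EFinD lee_fin indicE; have [/set_mem Bw|nBw] := boolP (w \in B).
    by have /andP[_ /le_trans] := g01 w; apply; rewrite lerDr.
  by rewrite addr0; apply: gB => Bw; move: nBw; rewrite mem_set.
rewrite ge0_integralD//; last by apply/measurable_EFinP; exact: measurable_indic.
rewrite (integral_cst _ measurableT) integral_indic// setIT.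
by apply: leeD2r; rewrite -[leRHS]mule1; apply: lee_wpmul2l; rewrite ?lee_fin//; exact: probability_le1.
Qed.

Lemma cvg_ereal0 (f : nat -> \bar R) :
  (forall e : R, 0 < e -> \forall n \near \oo, (0 <= f n <= e%:E)%E) ->
  f n @[n --> \oo] --> 0%E.
Proof.
move=> H; apply/fine_cvgP; split.
  apply: filterS (H 1 ltr01) => n /andP[f0 f1].
  by rewrite ge0_fin_numE// (le_lt_trans f1)// ltry.
apply/cvgr0Pnorm_le => e e0; apply: filterS (H e e0) => n /andP[f0 fe] /=.
have ff : f n \is a fin_num by rewrite ge0_fin_numE// (le_lt_trans fe)// ltry.
by rewrite ger0_norm ?fine_ge0// -lee_fin fineK.
Qed.

Lemma sup_range_le (h : R -> R) (c : R) : (forall t, h t <= c) ->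
  sup [set h t | t in [set: R]] <= c.
Proof. by move=> hc; apply: ge_sup; [exists (h 0), 0|move=> _ [t _ <-]]. Qed.

Lemma sup_range01 (h : R -> R) : (forall t, 0 <= h t) -> (forall t, h t <= 1) ->
  0 <= sup [set h t | t in [set: R]] <= 1.
Proof.
move=> h0 hc; rewrite sup_range_le// andbT.
apply: (le_trans (h0 0)); apply: ub_le_sup; last by exists 0.
by exists 1 => _ [t _ <-].
Qed.

Lemma near_divn_le (C e : R) : 0 < e -> \forall n \near \oo, C / n%:R <= e.
Proof.
move=> e0; exists (Num.truncn (C / e)).+1 => // n /= nC.
have n0 : 0 < n%:R :> R by rewrite ltr0n (leq_trans _ nC).
rewrite ler_pdivrMr// -ler_pdivrMl// mulrC; apply: le_trans (ltW (truncnS_gt _)) _.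
by rewrite ler_nat.
Qed.

Lemma bigO_1_bounded (f : nat -> R^o) : f =O_\oo (fun=> 1 : R^o) ->
  exists2 M : R, 0 < M & \forall n \near \oo, f n <= M.
Proof.
move=> /eqOP H; have [M M0 HM] : exists2 M : R, 0 < M & \forall n \near \oo, `|f n| <= M * `|1 : R^o|.
  by near (pinfty_nbhs R) => M; exists M; near: M => //; exact: nbhs_pinfty_gt.
exists M => //; apply: filterS HM => n; rewrite normr1 mulr1; apply: le_trans; exact: ler_norm.
Unshelve. all: by end_near. Qed.

Lemma posterior_dist01 p n (x : 'I_n -> 'cV[R]_p) b (B : set 'M[R]_p) t :
  (0 < p)%N -> (1 <= b)%N -> measurable B ->
  `|posterior (wishart_prior p b) n (sample_covariance x) B - std_normal_cdf t| <= 1.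
Proof.
move=> p0 b1 mB; have /andP[h0 h1] := posterior01 x p0 b1 mB.
have /andP[k0 k1] := std_normal_cdf01 t.
by rewrite ler_distl; apply/andP; split; lra.
Qed.

End assembly.

Theorem corollary3p3 (R : realType)
  (p : nat -> nat) (b : nat -> nat)
  (v : forall n, 'cV[R]_(p n))
  (Sigma : forall n, 'M[R]_(p n))
  (d : nat -> measure_display) (T : forall n, measurableType (d n))
  (P : forall n, probability (T n) R)
  (X : forall n, 'I_n -> {RV (P n) >-> 'cV[R]_(p n)})
  (p_infty : p n @[n --> \oo] --> \oo)
  (b_ge1 : forall n, (1 <= b n)%N)
  (b_bounded : (fun n => (b n)%:R : R^o) =O_\oo (fun=> 1 : R^o))
  (v_neq0 : forall n, v n != 0)
  (Sigma_pd : forall n, pd_mx (p n) (Sigma n))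
  (X_gaussian : forall n i, gaussian_vector (X n i) (Sigma n))
  (X_independent : forall n, independent_vectors (X n))
  (Sigma_bounded :
    (fun n => Num.max (spectral_norm (Sigma n))
                      (spectral_norm (invmx (Sigma n))) : R^o)
    =O_\oo (fun=> 1 : R^o))
  (p_small : (fun n => (p n)%:R / n%:R : R^o) =o_\oo (fun=> 1 : R^o)) :
  let S n w := sample_covariance (fun i => X n i w) in
  let Post n w := posterior (wishart_prior (p n) (b n)) n (S n w) in
  ('E_(P n)[fun w => (sup [set
      `| Post n w [set Om |
           Num.sqrt n%:R *
             (quad_form (invmx Om) (v n) - quad_form (S n w) (v n)) /
           (Num.sqrt 2 * `|quad_form (Sigma n) (v n)|) <= t]
         - std_normal_cdf t| | t in [set: R]])%R]
    @[n --> \oo] --> 0)%E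
  /\
  ((fun n => (p n)%:R ^+ 2 / n%:R : R^o) =o_\oo (fun=> 1 : R^o) ->
   ('E_(P n)[fun w => (sup [set
      `| Post n w [set Om |
           Num.sqrt n%:R *
             (quad_form Om (v n) - quad_form (invmx (S n w)) (v n)) /
           (Num.sqrt 2 * `|quad_form (invmx (Sigma n)) (v n)|) <= t]
         - std_normal_cdf t| | t in [set: R]])%R]
    @[n --> \oo] --> 0)%E).
Proof.
move=> S Post.
have p0 n : (0 < p n)%N.
  rewrite lt0n; apply: contra_neqN (v_neq0 n) => /eqP pn0.
  by apply/matrixP => i; have := ltn_ord i; rewrite [X in (_ < X)%N]pn0.
have [M M0 SM] := bigO_1_bounded Sigma_bounded.
have [Bd Bd0 bB] := bigO_1_bounded b_bounded.
have nN N : \forall n \near \oo, (N <= n)%N by exact: nbhs_infty_ge.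
split=> [|p2_small]; apply: cvg_ereal0 => e e0.
  have e20 : 0 < e / 2 by rewrite divr_gt0.
  have [de de0 [N HN]] := @inv_marginal R M Bd (e / 2) e20.
  have tail := near_divn_le (@normal_moment4 R / de ^+ 2) e20.
  near=> n.
  have Nn : (N <= n)%N by near: n; exact: nN.
  have n0 : (0 < n)%N by near: n; exact: nN.
  have : Num.max (spectral_norm (Sigma n)) (spectral_norm (invmx (Sigma n))) <= M by near: n.
  rewrite ge_max => /andP[_ SM2].
  have bn : (b n)%:R <= Bd by near: n.
  have tn : @normal_moment4 R / de ^+ 2 / n%:R <= e / 2 by near: n.
  have sg0 : 0 < quad_form (Sigma n) (v n) := (Sigma_pd n).2 _ (v_neq0 n).
  have [mB PB] := quad_ratio_tail (X_gaussian n) (X_independent n) (Sigma_pd n) n0 (v_neq0 n) de0.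
  rewrite [e in (_ <= e%:E)%E]splitr EFinD.
  have [w|w nB|->] := @expectation_le_good R _ _ (P n) (fun w => sup [set
      `| Post n w (inv_event (fun i => X n i w) (v n) (quad_form (Sigma n) (v n)) t)
         - std_normal_cdf t| | t in [set: R]]) _ (e / 2) (ltW e20) mB.
  - apply: sup_range01 => t //; apply: posterior_dist01 => //; exact: measurable_inv_event.
  - apply: sup_range_le => t; apply: HN => //.
      by rewrite ler_pdivrMr// quad_form_spectral_inv.
    by rewrite -ler_sqr ?nnegrE ?(ltW de0)// real_normK ?num_real// leNgt; apply/negP.
  move=> E1 /=; apply: (le_trans E1); apply: leeD2l; apply: (le_trans PB).
  by rewrite lee_fin mulrAC.
have e20 : 0 < e / 2 by rewrite divr_gt0.
have [de de0 [N HN]] := @dir_marginal R (2 * M) Bd (e / 2) e20.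
(* small enough for the Frobenius distance to make eta at most both de and 1/2 *)
pose et := Num.min de 2^-1 / M.
have et0 : 0 < et by rewrite divr_gt0// lt_min de0/=.
pose C := 14 * @normal_moment4 R * M ^+ 2 / et ^+ 2.
have C0 : 0 <= C by rewrite divr_ge0 ?sqr_ge0// mulr_ge0 ?sqr_ge0// mulr_ge0// normal_moment4_ge0.
have p2 k : 0 < k -> \forall n \near \oo, (p n)%:R ^+ 2 / n%:R <= k :> R.
  move=> k0; have /eqoP/(_ k k0) := p2_small; apply: filterS => n.
  by rewrite normr1 mulr1; apply: le_trans; exact: ler_norm.
have de20 : 0 < de ^+ 2 by rewrite exprn_gt0.
have eC : 0 < e / 2 / (C + 1) by rewrite divr_gt0// ltr_wpDl.
have tail1 := p2 _ de20.
have tail2 := p2 _ eC.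
near=> n.
have Nn : (N <= n)%N by near: n; exact: nN.
have n0 : (0 < n)%N by near: n; exact: nN.
have : Num.max (spectral_norm (Sigma n)) (spectral_norm (invmx (Sigma n))) <= M by near: n.
rewrite ge_max => /andP[SM1 SM2].
have bn : (b n)%:R <= Bd by near: n.
have t1 : (p n)%:R ^+ 2 / n%:R <= de ^+ 2 by near: n.
have t2 : (p n)%:R ^+ 2 / n%:R <= e / 2 / (C + 1) by near: n.
have om0 := quad_form_inv_gt0 (Sigma_pd n) (v_neq0 n).
have et20 : 0 < et ^+ 2 by rewrite exprn_gt0.
have [mB PB] := frob_tail (X_gaussian n) (X_independent n) (Sigma_pd n) n0 (ltW M0) SM1 et20.
rewrite [e in (_ <= e%:E)%E]splitr EFinD.
have [w|w nB|->] := @expectation_le_good R _ _ (P n) (fun w => sup [set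
    `| Post n w (dir_event (fun i => X n i w) (v n) (quad_form (invmx (Sigma n)) (v n)) t)
       - std_normal_cdf t| | t in [set: R]]) _ (e / 2) (ltW e20) mB.
- apply: sup_range01 => t //; apply: posterior_dist01 => //; exact: measurable_dir_event.
- move: nB => /negP; rewrite -leNgt => FB.
  have FM : Num.sqrt (frob (S n w - Sigma n)) * M <= Num.min de 2^-1.
    rewrite -ler_pdivlMr// -/et -ler_sqr ?nnegrE ?sqrtr_ge0 ?(ltW et0)//.
    by rewrite sqr_sqrtr ?frob_ge0.
  have := FM; rewrite le_min => /andP[FM1 FM2].
  have [Spd SK Wd] := loewner_sandwich (sample_covariance_sym (fun i => X n i w)) (Sigma_pd n)
    M0 SM2 (v_neq0 n) FM2.
  apply: sup_range_le => t; apply: HN => //; first exact: le_trans FM1.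
  rewrite -ler_sqr ?nnegrE ?(ltW de0) ?divr_ge0 ?sqrtr_ge0//.
  by rewrite exprMn exprVn sqr_sqrtr.
move=> E1 /=; apply: (le_trans E1); apply: leeD2l; apply: (le_trans PB).
rewrite lee_fin mulrAC -/C; apply: (le_trans (ler_wpM2l C0 t2)).
rewrite mulrC mulrAC ler_pdivrMr ?ltr_wpDl// ler_wpM2l ?(ltW e20)// lerDl.
Unshelve. all: by end_near. Qed.
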